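(* Assume the following. (Step sizes) $(\gamma_n)_{n\ge 0}$ is non-increasing, $\sum_{n\ge 0}\gamma_n=+\infty$ and $\lim_{n\to\infty}\gamma_n\ln(n)=0$. (H1) $K$ is Feller. (H2) The cemetery point is accessible: $\sum_{n\ge1}\overline{K}^n(x,\{\partial\})>0$ for all $x\in\mathcal{E}$. (H3) There exists a non-empty open set $U\subset\mathcal{E}$ which is accessible, i.e. $\sum_{n\ge1}K^n(x,U)>0$ for all $x\in\mathcal{E}$, and which is a weak small set, i.e. there are a probability measure $\Psi$ on $\mathcal{E}$ and $\epsilon>0$ such that $\sum_{n\ge1}K^n(x,A)\ge\epsilon\Psi(A)$ for all $x\in U$ and all Borel $A\subset\mathcal{E}$. (H4) There exists a non-increasing convex function $C:\mathbb{R}^+\to\mathbb{R}^+$ with $\int_0^\infty C(s)\,ds=\infty$ such that, for the measure $\Psi$ of (H3), $\dfrac{\Psi(K^n\mathbf{1})}{\sup_{x\in\mathcal{E}}K^n\mathbf{1}(x)}\ge C(n)$ for all $n$. Then $K$ has a unique quasi-stationary distribution $\mu^\star$, and the sequence of weighted occupation measures $(\mu_n)_{n\ge0}$ converges almost surely to $\mu^\star$ in $\mathcal{P}(\mathcal{E})$.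
   Context: $\mathcal{E}$ is a compact metric space with Borel $\sigma$-field $\mathcal{B}(\mathcal{E})$; $\mathcal{P}(\mathcal{E})$ is the set of Borel probability measures on $\mathcal{E}$ with the topology of weak convergence (tested against continuous functions); $\mathbf{1}$ is the constant function $1$; $\mu(f)=\int f\,d\mu$. A sub-Markovian kernel on $\mathcal{E}$ is a map $Q:\mathcal{E}\times\mathcal{B}(\mathcal{E})\to[0,1]$ such that each $Q(x,\cdot)$ is a measure with $Q(x,\mathcal{E})>0$, and each $x\mapsto Q(x,A)$ is measurable; it is Markov if $Q(x,\mathcal{E})=1$ for all $x$. Write $Qf(x)=\int f(y)Q(x,dy)$, $\mu Q(\cdot)=\int\mu(dx)Q(x,\cdot)$, and $Q^n$ for the iterates ($Q^0(x,\cdot)=\delta_x$). $Q$ is Feller if $Qf$ is continuous whenever $f$ is continuous. A quasi-stationary distribution (QSD) for $Q$ is $\mu\in\mathcal{P}(\mathcal{E})$ with $\mu=\mu Q/(\mu Q\mathbf{1})$. $K$ is a sub-Markovian kernel on $\mathcal{E}$, $\partial\notin\mathcal{E}$ is a cemetery point, and $\overline{K}$ is the Markov kernel on $\mathcal{E}\cup\{\partial\}$ with $\overline{K}(x,A)=K(x,A)$ and $\overline{K}(x,\{\partial\})=1-K(x,\mathcal{E})$ for $x\in\mathcal{E}$, $A\in\mathcal{B}(\mathcal{E})$, and $\overline{K}(\partial,\{\partial\})=1$. Let $\delta(x)=1-K(x,\mathcal{E})$ and, for $\mu\in\mathcal{P}(\mathcal{E})$, $K_\mu(x,A)=K(x,A)+\delta(x)\mu(A)$.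 $(\eta_n)_{n\ge0}$ is a sequence of positive numbers and $\gamma_n=\eta_n/\sum_{k=0}^n\eta_k$. On a filtered probability space $(\Omega,\mathcal{F},(\mathcal{F}_n)_{n\ge0},\mathbb{P})$, $(X_n)_{n\ge0}$ is an adapted $\mathcal{E}$-valued process with $X_0=x\in\mathcal{E}$ and $\mathbb{P}(X_{n+1}\in dy\mid\mathcal{F}_n)=K_{\mu_n}(X_n,dy)$ for all $n\ge 0$, where $\mu_n=\dfrac{\sum_{k=0}^n\eta_k\delta_{X_k}}{\sum_{k=0}^n\eta_k}$ (here $\delta_{X_k}$ is the Dirac mass at $X_k$). *)

(* Defs.v *)
From HB Require Import structures.
From mathcomp Require Import all_boot all_order all_algebra.
From mathcomp Require Import interval_inference.
From mathcomp Require Import all_classical all_reals all_analysis.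
From mathcomp Require Import measurable_realfun.

Set Implicit Arguments.
Unset Strict Implicit.
Unset Printing Implicit Defensive.

Import Order.TTheory GRing.Theory Num.Theory.
Import numFieldNormedType.Exports.

Local Open Scope classical_set_scope.
Local Open Scope ring_scope.
Local Open Scope ereal_scope.

HB.mixin Record isBorel d (R : realType) E
    of Measurable d E & Metric R E := {
  measurable_borelE : @measurable d E = <<s (@open E) >> }.

#[short(type="borelMetricType")]
HB.structure Definition BorelMetric d (R : realType) :=
  { E of Measurable d E & Metric R E & isBorel d R E }.

(* sigma-field of `option T`, the space T with the cemetery point None *)
Definition option_display : measure_display -> measure_display.
Proof. exact. Qed.

Section option_measurable.
Context d (T : measurableType d).

Definition option_measurable : set (set (option T)) :=
  [set A | measurable (@Some T @^-1` A)].

Let option_measurable0 : option_measurable set0.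
Proof. by rewrite /option_measurable /= preimage_set0. Qed.

Let option_measurableC A : option_measurable A -> option_measurable (~` A).
Proof. by rewrite /option_measurable /= -preimage_setC; exact: measurableC. Qed.

Let option_measurableU (F : (set (option T))^nat) :
  (forall i, option_measurable (F i)) -> option_measurable (\bigcup_i F i).
Proof.
by move=> mF; rewrite /option_measurable /= preimage_bigcup;
  exact: bigcupT_measurable.
Qed.

HB.instance Definition _ := isMeasurable.Build (option_display d) (option T)
  option_measurable0 option_measurableC option_measurableU.

End option_measurable.

Section kernels.
Context d (T : measurableType d) (R : realType).
Implicit Types (Q : R.-spker T ~> T) (mu nu : probability T R).

Fixpoint kiter Q (n : nat) : R.-spker T ~> T :=
  if n is m.+1 then mkcomp_noparam Q (kiter Q m)
  else kdirac (@measurable_id _ T setT).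

(* kpush mu Q is the measure mu Q, kapply Q f the function Q f; restart Q mu
   below is Q_mu(x, A) = Q(x, A) + (1 - Q(x, T)) mu(A). *)
Definition kpush mu Q (A : set T) : \bar R := \int[mu]_x Q x A.
Definition kapply Q (f : T -> R) (x : T) : R := (\int[Q x]_y f y)%R.

(* Equality in `probability T R` also compares the values on non-measurable
   sets, so equality of measures is always stated on measurable sets. *)
Definition eq_prob mu nu : Prop := forall A, measurable A -> mu A = nu A.

Definition is_qsd Q mu : Prop :=
  forall A, measurable A ->
    mu A = kpush mu Q A * ((fine (kpush mu Q setT))^-1)%:E.

Definition accessible Q (U : set T) : Prop :=
  forall x, 0 < \sum_(1 <= n <oo) kiter Q n x U.

Definition weak_small_set Q (U : set T) (Psi : probability T R) : Prop :=
  exists2 eps : R, (0 < eps)%R &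
    forall x, U x -> forall A, measurable A ->
      eps%:E * Psi A <= \sum_(1 <= n <oo) kiter Q n x A.

Lemma death_subproof Q x : (0 <= 1 - fine (Q x setT))%R.
Proof.
rewrite subr_ge0 -lee_fin fineK ?sprob_kernel_le1//.
exact: finite_kernel_measure.
Qed.

Definition death Q x : {nonneg R} := NngNum (death_subproof Q x).

Definition restart Q mu (x : T) : {measure set T -> \bar R} :=
  measure_add (Q x) (mscale (death Q x) mu).

End kernels.

(* The measure instance of pushforward takes a measurability proof that cannot
   be inferred, hence this dedicated copy for the injection Some. *)
Section pushforward_Some.
Context d (T : measurableType d) (R : realType) (m : {measure set T -> \bar R}).

Definition push_Some (A : set (option T)) : \bar R := pushforward m (@Some T) A.

Let push_Some0 : push_Some set0 = 0.
Proof. by rewrite /push_Some /pushforward preimage_set0 measure0. Qed.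

Let push_Some_ge0 A : 0 <= push_Some A.
Proof. by rewrite /push_Some /pushforward measure_ge0. Qed.

Let push_Some_semi_sigma_additive : semi_sigma_additive push_Some.
Proof.
move=> F mF tF mUF; rewrite /push_Some /pushforward preimage_bigcup.
apply: measure_semi_sigma_additive.
- by move=> n; exact: mF.
- apply/trivIsetP => /= i j _ _ ij; rewrite -preimage_setI.
  by move/trivIsetP : tF => /(_ _ _ _ _ ij) ->//; rewrite preimage_set0.
- by rewrite -preimage_bigcup.
Qed.

HB.instance Definition _ := isMeasure.Build _ _ _ push_Some
  push_Some0 push_Some_ge0 push_Some_semi_sigma_additive.

End pushforward_Some.

Section cemetery.
Context d (T : measurableType d) (R : realType) (K : R.-spker T ~> T).

Definition cemetery_ker (x : option T) : {measure set (option T) -> \bar R} :=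
  if x is Some y
  then measure_add (push_Some (K y)) (mscale (death K y) \d_None)
  else \d_None.

Lemma cemetery_kerE y A :
  cemetery_ker (Some y) A =
  K y (@Some T @^-1` A) + (1 - K y setT) * \d_(None : option T) A.
Proof.
rewrite [LHS]measure_addE; congr (_ + _).
transitivity ((1 - fine (K y setT))%:E * \d_(None : option T) A) => //.
by rewrite EFinB fineK//; exact: finite_kernel_measure.
Qed.

Let measurable_cemetery_ker U : measurable U ->
  measurable_fun [set: option T] (cemetery_ker ^~ U).
Proof.
move=> mU _ B mB; rewrite setTI.
have mf : measurable_fun [set: T] (fun y => cemetery_ker (Some y) U).
  apply: (eq_measurable_fun (fun y =>
    K y (@Some T @^-1` U) + (1 - K y setT) * \d_(None : option T) U)).
    by move=> y _; rewrite cemetery_kerE.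
  apply: emeasurable_funD; first exact: measurable_kernel.
  apply: emeasurable_funM => //; apply: emeasurable_funB => //.
  exact: measurable_kernel.
by have := mf measurableT B mB; rewrite setTI.
Qed.

HB.instance Definition _ := isKernel.Build _ _ _ _ R cemetery_ker
  measurable_cemetery_ker.

Let cemetery_kerT x : cemetery_ker x setT = 1.
Proof.
case: x => [y|]; last exact: diracT.
rewrite cemetery_kerE diracT mule1 preimage_setT addeC subeK//.
exact: finite_kernel_measure.
Qed.

HB.instance Definition _ := Kernel_isProbability.Build _ _ _ _ _
  cemetery_ker cemetery_kerT.

End cemetery.

Section weighted_occupation.
Context d (T : measurableType d) (R : realType).
Variables (eta : nat -> {posnum R}) (x : nat -> T).
(* x is a trajectory: occupation n = (\sum_(k <= n) eta_k \d_(x k)) / weight n *)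

Definition weight (n : nat) : R := (\sum_(k < n.+1) (eta k)%:num)%R.

Lemma weight_gt0 n : (0 < weight n)%R.
Proof. by rewrite /weight big_ord_recl ltr_pwDl// sumr_ge0. Qed.

Definition step_size (n : nat) : R := ((eta n)%:num / weight n)%R.

Lemma weightV_ge0 n : (0 <= (weight n)^-1)%R.
Proof. by rewrite invr_ge0 ltW// weight_gt0. Qed.

Definition occupation (n : nat) : set T -> \bar R :=
  mscale (NngNum (weightV_ge0 n))
    (msum (fun k => mscale ((eta k)%:num%:nng)%R \d_(x k)) n.+1).

HB.instance Definition _ n := Measure.on (occupation n).

Let occupationT n : occupation n setT = 1.
Proof.
rewrite /occupation /mscale/= /msum/=.
under eq_bigr do rewrite /mscale/= diracT mule1.
by rewrite sumEFin -EFinM mulVf// gt_eqF// weight_gt0.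
Qed.

HB.instance Definition _ n :=
  Measure_isProbability.Build _ _ _ (occupation n) (@occupationT n).

Definition weighted_occupation (n : nat) : probability T R := occupation n.

End weighted_occupation.

Lemma cvg_initialP (S : choiceType) (T : topologicalType) (f : S -> T)
    (I : Type) (F : set_system I) (u : I -> S) (s : S) : Filter F ->
  u @ F --> (s : initial_topology f) <-> f \o u @ F --> f s.
Proof.
move=> FF; split=> [us|fus A /= [B [[C oC <-] Cs CA]]].
  apply: (cvg_comp u f us); exact: initial_continuous.
have FC : (f \o u @ F) C by apply: fus; exact: open_nbhs_nbhs.
by apply: (@filterS _ F FF ((f \o u) @^-1` C)) FC => i; exact: CA.
Qed.

Section weak_convergence.
Context d (R : realType) (E : borelMetricType d R).

(* P(E) with the topology of weak convergence: the coarsest topology making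
   mu |-> \int f dmu continuous for every continuous f. *)
Definition weak_probability : Type :=
  initial_topology
    (fun mu : probability E R =>
       (fun f => \int[mu]_x sval f x)%R
       : {ptws {f : E -> R | continuous f} -> R}).

HB.instance Definition _ := Topological.on weak_probability.

Lemma cvg_weak_probabilityP (mu_ : nat -> weak_probability)
    (mu : weak_probability) :
  mu_ n @[n --> \oo] --> mu <->
  forall f : E -> R, continuous f ->
    (\int[mu_ n]_x f x)%R @[n --> \oo] --> (\int[mu]_x f x)%R.
Proof.
rewrite cvg_initialP cvg_sup; split=> [mu_cvg f cf|mu_cvg [f cf]].
  by have /cvg_initialP := mu_cvg (exist _ f cf).
by apply/cvg_initialP; exact: mu_cvg.
Qed.

End weak_convergence.

Definition feller d (R : realType) (E : borelMetricType d R)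
    (Q : R.-spker E ~> E) : Prop :=
  forall f : E -> R, continuous f -> continuous (kapply Q f).

Section conditional_probability.
Context d (Omega : measurableType d) (R : realType) (P : probability Omega R).

Definition filtration (F : nat -> set (set Omega)) : Prop :=
  [/\ forall n, sigma_algebra setT (F n),
      forall n, F n `<=` measurable
    & forall n, F n `<=` F n.+1].

Definition adapted d' (T : measurableType d') (F : nat -> set (set Omega))
    (X : nat -> Omega -> T) : Prop :=
  forall n B, measurable B -> F n (X n @^-1` B).

(* f is a version of P(A | G) *)
Definition is_cond_prob (G : set (set Omega)) (A : set Omega)
    (f : Omega -> \bar R) : Prop :=
  (forall B, measurable B -> G (f @^-1` B)) /\
  (forall B, G B -> \int[P]_(w in B) f w = P (A `&` B)).

End conditional_probability.

(* Main.v *)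
(* The killed potential [A = \sum_k K ^ k] solves the Poisson equation
   [f = A f - K (A f)], so [f (X i)] is a killing term plus a martingale increment
   plus a telescoping difference. Over a block of indices whose steps [gamma] add up
   to about [dl], the occupation measure is therefore acted on by
   [(1 - G) * id + H * A] up to [O (dl ^ 2)], where [G] is the total step of the block
   and [H] its killing; the martingale part is removed by Azuma's inequality and
   Borel-Cantelli, since [gamma n * ln n] tends to [0].

   Long products [P] of such operators forget their starting measure: the oscillation
   of [P f / P 1] is multiplied by [exp (- c * \int C)]. Indeed (H2) and (H3) give
   [A >= c0 * Psi], while [P] is a nonnegative power series in [K] whose mean degree is
   at most linear in the total mass, so by Markov's inequality (H4) bounds
   [Psi (P 1)] below by a multiple of [C] times the supremum of [P 1]. Hence [A] has a
   single eigenfunctional; it is the unique QSD and the limit of the occupation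
   measures. *)
Require Import Defs.
From HB Require Import structures.
From mathcomp Require Import all_boot all_order all_algebra.
From mathcomp Require Import interval_inference.
From mathcomp Require Import all_classical all_reals all_analysis.
From mathcomp Require Import measurable_realfun.
From mathcomp Require Import ring lra.

Set Implicit Arguments.
Unset Strict Implicit.
Unset Printing Implicit Defensive.

Import Order.TTheory GRing.Theory Num.Theory.
Import numFieldNormedType.Exports.

Local Open Scope classical_set_scope.
Local Open Scope ring_scope.

(** * Positive functionals on bounded measurable functions *)

Section bounded_measurable.
Context d (T : measurableType d) (R : realType).
Implicit Types (f g : T -> R) (L : (T -> R) -> R).

(** Measures are handled as positive linear functionals on bounded measurable functions: products,
    ratios and limits then need no sigma-additivity, and only the limiting eigenfunctional is turned
    back into a measure. The coefficients [(1 - G, H)] are random and vary from block to block, so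
    forgetting has to be uniform over all finite products of factors [a + h * A]; this is possible
    because they are all power series in the single operator [K]. The clock of the contraction is
    the accumulated killing. It cannot stall: occupation measures have mass 1, so testing the block
    relation with the function 1 forces [H] to be at least of the order of [G / sup (A 1)]. A given
    accuracy requires a certain mass, hence a number of blocks of order [1 / dl], each with an error
    of order [dl ^ 2]; the total is of order [dl], so [dl] is chosen last. Existence comes from the
    same contraction, applied to the normalised powers of [1 + A] started at [Psi]. Only countably
    many almost sure events are involved: block sizes [1 / (j + 1)], iterates of [A], and a
    countable family of test sets. *)

Definition bm f := measurable_fun setT f /\ exists B, forall x, `|f x| <= B.

Lemma bm_bound f : bm f -> exists2 B, 0 <= B & forall x, `|f x| <= B.
Proof.
case=> _ [B hB]; exists (Num.max 0 B); first by rewrite le_max lexx.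
by move=> x; rewrite le_max hB orbT.
Qed.

Lemma bm_cst c : bm (fun _ => c).
Proof. by split; [exact: measurable_cst|exists `|c|]. Qed.

Lemma bmD f g : bm f -> bm g -> bm (fun x => f x + g x).
Proof.
move=> [mf [B fB]] [mg [B' gB]]; split; first exact: measurable_funD.
by exists (B + B') => x; rewrite (le_trans (ler_normD _ _))// lerD.
Qed.

Lemma bmM f g : bm f -> bm g -> bm (fun x => f x * g x).
Proof.
move=> [mf [B fB]] [mg [B' gB]]; split; first exact: measurable_funM.
by exists (B * B') => x; rewrite normrM ler_pM.
Qed.

Lemma bmZ c f : bm f -> bm (fun x => c * f x).
Proof. by apply: bmM; exact: bm_cst. Qed.

Lemma bmN f : bm f -> bm (fun x => - f x).
Proof. by move=> /(bmZ (-1)); congr bm; apply/funext => x; rewrite mulN1r. Qed.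

Lemma bmB f g : bm f -> bm g -> bm (fun x => f x - g x).
Proof. by move=> bf /bmN; exact: bmD. Qed.

Lemma bm_sum (F : nat -> T -> R) n : (forall i, bm (F i)) ->
  bm (fun x => \sum_(i < n) F i x).
Proof.
move=> bF; elim: n => [|n IH].
  by under eq_fun do rewrite big_ord0; exact: bm_cst.
by under eq_fun do rewrite big_ord_recr/=; exact: bmD.
Qed.

Lemma bm_indic (A : set T) : measurable A -> bm (\1_A).
Proof.
move=> mA; split; first exact: measurable_indic.
by exists 1 => x; rewrite indicE; case: (x \in A) => //=; rewrite ?normr1 ?normr0.
Qed.

(* Positive linear functionals on bounded measurable functions; nothing is required
   of [L] on other functions. *)
Record plf L : Prop := Plf {
  plfD : forall f g, bm f -> bm g -> L (fun x => f x + g x) = L f + L g;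
  plfZ : forall c f, bm f -> L (fun x => c * f x) = c * L f;
  plf_ge0 : forall f, bm f -> (forall x, 0 <= f x) -> 0 <= L f }.

Section plf_theory.
Variable L : (T -> R) -> R.
Hypothesis pL : plf L.

Lemma plfN f : bm f -> L (fun x => - f x) = - L f.
Proof.
move=> bf; rewrite -[RHS]mulN1r -plfZ//; congr L.
by apply/funext => x; rewrite mulN1r.
Qed.

Lemma plfB f g : bm f -> bm g -> L (fun x => f x - g x) = L f - L g.
Proof. by move=> bf bg; rewrite plfD ?plfN//; exact: bmN. Qed.

Lemma plf_cst c : L (fun _ => c) = c * L (fun _ => 1).
Proof.
rewrite -(plfZ pL); last exact: bm_cst.
by congr L; apply/funext => x; rewrite mulr1.
Qed.

Lemma plf_mono f g : bm f -> bm g -> (forall x, f x <= g x) -> L f <= L g.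
Proof.
move=> bf bg fg; rewrite -subr_ge0 -plfB//.
by apply: (plf_ge0 pL) => [|x]; [exact: bmB|rewrite subr_ge0].
Qed.

Lemma plf1_ge0 : 0 <= L (fun _ => 1).
Proof. by apply: (plf_ge0 pL) => //; exact: bm_cst. Qed.

Lemma plf_norm f B : bm f -> (forall x, `|f x| <= B) ->
  `|L f| <= B * L (fun _ => 1).
Proof.
move=> bf fB; rewrite ler_norml -mulNr -!plf_cst.
apply/andP; split; apply: plf_mono => //; try exact: bm_cst.
  by move=> x; have := fB x; rewrite ler_norml => /andP[].
by move=> x; have := fB x; rewrite ler_norml => /andP[].
Qed.

Lemma plf_dist f g B : bm f -> bm g -> (forall x, `|f x - g x| <= B) ->
  `|L f - L g| <= B * L (fun _ => 1).
Proof. by move=> bf bg fg; rewrite -plfB// plf_norm//; exact: bmB. Qed.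

Lemma plf_sum (F : nat -> T -> R) n : (forall i, bm (F i)) ->
  L (fun x => \sum_(i < n) F i x) = \sum_(i < n) L (F i).
Proof.
move=> bF; elim: n => [|n IH].
  rewrite big_ord0; under eq_fun do rewrite big_ord0.
  by rewrite plf_cst mul0r.
rewrite big_ord_recr/= -IH; under eq_fun do rewrite big_ord_recr/=.
by rewrite plfD//; exact: bm_sum.
Qed.

End plf_theory.

(* Peeling off [e * \1_[f >= e]] repeatedly approximates [f] within [e]. *)
Lemma plf_layer_cake L1 L2 : plf L1 -> plf L2 ->
  (forall A, measurable A -> L1 \1_A <= L2 \1_A) ->
  forall (e : R) n f, 0 < e -> bm f -> (forall x, 0 <= f x <= n%:R * e) ->
  exists s, [/\ bm s, forall x, 0 <= s x, forall x, s x <= f x <= s x + e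
              & L1 s <= L2 s].
Proof.
move=> p1 p2 L12 e n f e0; elim: n f => [|n IH] f bf fn.
  exists (fun=> 0); split => //; first exact: bm_cst.
  - by move=> x; have := fn x; rewrite mul0r add0r => /andP[-> /le_trans->]//; exact: ltW.
  - by rewrite (plf_cst p1) (plf_cst p2) !mul0r.
pose f1 x := Num.max (f x - e) 0.
have bf1 : bm f1.
  split.
    apply: measurable_maxr; last exact: measurable_cst.
    by apply: measurable_funB; [exact: bf.1|exact: measurable_cst].
  exists (n.+1%:R * e) => x; rewrite /f1 ger0_norm ?le_max ?lexx ?orbT//.
  have /andP[f0 fne] := fn x; rewrite ge_max (le_trans _ fne) ?(le_trans f0)//=.
  by rewrite lerBlDr lerDl ltW.
have [x|s [bs s0 sf1 Ls]] := IH f1 bf1.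
  rewrite /f1 le_max lexx orbT/= ge_max mulr_ge0 ?(ltW e0)// andbT.
  by have /andP[_] := fn x; rewrite -natr1; lra.
pose A := [set x | e <= f x].
have mA : measurable A.
  have := bf.1 measurableT `[e, +oo[%classic (measurable_itv _).
  by rewrite setTI preimage_itvcy.
have bA := bm_indic mA.
exists (fun x => s x + e * \1_A x); split.
- by apply: bmD => //; exact: bmZ.
- by move=> x; rewrite addr_ge0// mulr_ge0// ltW.
- move=> x; have /andP[] := sf1 x; have := s0 x; have /andP[f0 _] := fn x.
  rewrite /f1 indicE; have [ef|ef] := leP e (f x).
    rewrite mem_set// max_l ?subr_ge0//= mulr1 => *.
    by apply/andP; split; lra.
  rewrite memNset/=; last by apply/negP; rewrite -ltNge.
  by rewrite max_r ?subr_le0 ?(ltW ef)// mulr0 => *; apply/andP; split; lra.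
- rewrite (plfD p1)//; last exact: bmZ.
  rewrite (plfD p2)//; last exact: bmZ.
  by rewrite (plfZ p1)// (plfZ p2)// lerD// ler_wpM2l ?L12// ltW.
Qed.

(** Uniform approximation from below by simple functions takes the place of monotone convergence, so
    the comparison of indicators extends to functionals that are merely finitely additive. *)
Lemma plf_le L1 L2 : plf L1 -> plf L2 ->
  (forall A, measurable A -> L1 \1_A <= L2 \1_A) ->
  forall f, bm f -> (forall x, 0 <= f x) -> L1 f <= L2 f.
Proof.
move=> p1 p2 L12 f bf f0; have [B B0 fB] := bm_bound bf.
have L11 := plf1_ge0 p1.
apply/ler_addgt0Pr => e0 e00; pose e := e0 / (1 + L1 (fun=> 1)).
have e_gt0 : 0 < e by rewrite divr_gt0// ltr_pwDl.
have [|s [bs s0 sf Ls]] :=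
    @plf_layer_cake _ _ p1 p2 L12 e (Num.bound (B / e)) f e_gt0 bf.
  move=> x; rewrite f0/= (le_trans (ler_norm _))// (le_trans (fB x))//.
  rewrite -ler_pdivrMr// ltW// archi_boundP//.
  by rewrite divr_ge0// ltW.
have b1 := bm_cst 1.
have h1 : L1 f <= L1 s + e * L1 (fun=> 1).
  rewrite -(plf_cst p1) -(plfD p1)//; last exact: bm_cst.
  apply: (plf_mono p1) => //; first by apply: bmD => //; exact: bm_cst.
  by move=> x; case/andP: (sf x).
have h2 : L2 s <= L2 f by apply: (plf_mono p2) => // x; case/andP: (sf x).
have h3 : e * L1 (fun=> 1) <= e0.
  by rewrite /e mulrAC ler_pdivrMr ?ltr_pwDl// ler_wpM2l ?(ltW e00)// lerDr.
lra.
Qed.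

(** Adding a bound of [f] reduces to nonnegative functions, where [plf_le] applies in both
    directions. This is the standard way below to identify two integrals: both sides are positive
    functionals, and only indicators are compared. *)
Lemma plf_eq L1 L2 : plf L1 -> plf L2 ->
  (forall A, measurable A -> L1 \1_A = L2 \1_A) ->
  forall f, bm f -> L1 f = L2 f.
Proof.
move=> p1 p2 L12.
have pos f : bm f -> (forall x, 0 <= f x) -> L1 f = L2 f.
  move=> bf f0; apply/eqP; rewrite eq_le !plf_le// => A mA.
    by rewrite L12. by rewrite -L12.
move=> f bf; have [B B0 fB] := bm_bound bf.
have bB := bm_cst B.
have : L1 (fun x => f x + B) = L2 (fun x => f x + B).
  apply: pos; first exact: bmD.
  by move=> x; have := fB x; rewrite ler_norml => /andP[+ _]; lra.
rewrite (plfD p1)// (plfD p2)// (plf_cst p1) (plf_cst p2).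
suff -> : L1 (fun=> 1) = L2 (fun=> 1) by move/addIr.
by apply: pos => //; exact: bm_cst.
Qed.

Definition plop (A : (T -> R) -> T -> R) :=
  (forall f, bm f -> bm (A f)) /\ forall x, plf (A^~ x).

Section plop_theory.
Variable A : (T -> R) -> T -> R.
Hypothesis pA : plop A.

Lemma plop_bm f : bm f -> bm (A f). Proof. exact: pA.1. Qed.

Lemma plopD f g : bm f -> bm g ->
  A (fun x => f x + g x) = (fun x => A f x + A g x).
Proof. by move=> bf bg; apply/funext => x; rewrite (plfD (pA.2 x)). Qed.

Lemma plopB f g : bm f -> bm g ->
  A (fun x => f x - g x) = (fun x => A f x - A g x).
Proof. by move=> bf bg; apply/funext => x; rewrite (plfB (pA.2 x)). Qed.

Lemma plopZ c f : bm f -> A (fun x => c * f x) = (fun x => c * A f x).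
Proof. by move=> bf; apply/funext => x; rewrite (plfZ (pA.2 x)). Qed.

Lemma plop_mono f g : bm f -> bm g -> (forall x, f x <= g x) ->
  forall x, A f x <= A g x.
Proof. by move=> bf bg fg x; apply: (plf_mono (pA.2 x)). Qed.

Lemma plop_ge0 f : bm f -> (forall x, 0 <= f x) -> forall x, 0 <= A f x.
Proof. by move=> bf f0 x; apply: (plf_ge0 (pA.2 x)). Qed.

Lemma plop_norm a f B : (forall x, A (fun=> 1) x <= a) -> 0 <= B ->
  bm f -> (forall x, `|f x| <= B) -> forall x, `|A f x| <= a * B.
Proof.
move=> Aa B0 bf fB x; rewrite (le_trans (plf_norm (pA.2 x) bf fB))//.
by rewrite mulrC ler_wpM2r.
Qed.

Lemma plf_comp L : plf L -> plf (fun f => L (A f)).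
Proof.
move=> pL; split.
- by move=> f g bf bg; rewrite plopD// (plfD pL)//; exact: plop_bm.
- by move=> c f bf; rewrite plopZ// (plfZ pL)//; exact: plop_bm.
- move=> f bf f0; apply: (plf_ge0 pL); first exact: plop_bm.
  exact: plop_ge0.
Qed.

End plop_theory.

Lemma plop_comp A B : plop A -> plop B -> plop (fun f => A (B f)).
Proof.
move=> pA pB; split=> [f bf|x]; first exact/(plop_bm pA)/(plop_bm pB).
exact: (plf_comp pB (pA.2 x)).
Qed.

Lemma plop_id : plop id. Proof. by split=> //= x; split. Qed.

Lemma plop_iter A n : plop A -> plop (iter n A).
Proof.
move=> pA; elim: n => [|n IH]; first exact: plop_id.
exact: (plop_comp pA IH).
Qed.

Lemma plfDl L1 L2 a b : 0 <= a -> 0 <= b -> plf L1 -> plf L2 ->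
  plf (fun f => a * L1 f + b * L2 f).
Proof.
move=> a0 b0 p1 p2; split.
- by move=> f g bf bg; rewrite (plfD p1)// (plfD p2)//; ring.
- by move=> c f bf; rewrite (plfZ p1)// (plfZ p2)//; ring.
- by move=> f bf f0; rewrite addr_ge0// mulr_ge0//; exact: plf_ge0.
Qed.

Lemma plopDl A B a b : 0 <= a -> 0 <= b -> plop A -> plop B ->
  plop (fun f x => a * A f x + b * B f x).
Proof.
move=> a0 b0 pA pB; split=> [f bf|x]; last exact: (plfDl a0 b0 (pA.2 x) (pB.2 x)).
by apply: bmD; apply: bmZ; exact: plop_bm.
Qed.

Lemma plop_lsum (A : nat -> (T -> R) -> T -> R) n : (forall i, plop (A i)) ->
  plop (fun f x => \sum_(i < n) A i f x).
Proof.
move=> pA; elim: n => [|n IH].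
  split=> [f bf|x]; first by under eq_fun do rewrite big_ord0; exact: bm_cst.
  by split=> *; rewrite !big_ord0 ?addr0 ?mulr0.
have := plopDl ler01 ler01 IH (pA n); congr plop.
by apply/funext => f; apply/funext => x; rewrite big_ord_recr/= !mul1r.
Qed.

Section integral.
Variable m : {measure set T -> \bar R}.
Hypothesis m_fin : (m setT < +oo)%E.

Lemma bm_integrable f : bm f -> m.-integrable setT (EFin \o f).
Proof.
move=> [mf [B fB]]; apply: measurable_bounded_integrable => //.
by exists B; split; [exact: num_real|move=> M BM x _; exact: le_trans (fB x) (ltW BM)].
Qed.

Lemma plf_Rintegral : plf (fun f => \int[m]_x f x).
Proof.
split.
- by move=> f g bf bg; rewrite RintegralD//; exact: bm_integrable.
- by move=> c f bf; rewrite RintegralZl//; exact: bm_integrable.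
- by move=> f bf f0; apply: Rintegral_ge0.
Qed.

Lemma EFin_Rintegral f : bm f -> (\int[m]_x f x)%:E = (\int[m]_x (f x)%:E)%E.
Proof.
by move=> bf; rewrite /Rintegral fineK//; apply: integrable_fin_num => //; exact: bm_integrable.
Qed.

Lemma Rintegral_indic A : measurable A -> (\int[m]_x \1_A x)%:E = m A.
Proof.
by move=> mA; rewrite EFin_Rintegral ?integral_indic ?setIT//; exact: bm_indic.
Qed.

Lemma Rintegral1 : (\int[m]_x 1)%:E = m setT.
Proof.
rewrite -(Rintegral_indic measurableT); congr EFin; congr Rintegral.
by apply/funext => x; rewrite indicT.
Qed.

Lemma bounded_cvg_Rintegral (f : nat -> T -> R) (g : T -> R) B :
  (forall n, bm (f n)) -> bm g -> (forall n x, `|f n x| <= B) ->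
  (forall x, f n x @[n --> \oo] --> g x) ->
  \int[m]_x f n x @[n --> \oo] --> \int[m]_x g x.
Proof.
move=> bf bg fB fg.
have fgE x : setT x -> (EFin \o f n) x @[n --> \oo] --> (EFin \o g) x.
  by move=> _; apply: cvg_EFin; [exact: nearW|exact: fg].
have [_ _] := @dominated_convergence _ _ _ m setT measurableT
  (fun n => EFin \o f n) (EFin \o g) (fun=> B%:E)
  (fun n => (measurable_EFinP _ _).2 (bf n).1)
  ((measurable_EFinP _ _).2 bg.1)
  (aeW _ fgE)
  (bm_integrable (bm_cst B)) (aeW _ (fun x n _ => fB n x)).
by rewrite -EFin_Rintegral// => /fine_cvg.
Qed.

End integral.

End bounded_measurable.
Arguments bm_cst {d T R} c.

Lemma cvg_dist_le (R : realType) (u : nat -> R) l a e n :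
  u k @[k --> \oo] --> l -> (forall k, (n <= k)%N -> `|u k - a| <= e) ->
  `|l - a| <= e.
Proof.
move=> ul ua.
have h : `|u k - a| @[k --> \oo] --> `|l - a|.
  by apply: cvg_norm; apply: cvgB => //; exact: cvg_cst.
rewrite -(cvg_lim _ h)//; apply: limr_le; first by apply/cvg_ex; exists `|l - a|.
by exists n.
Qed.

Lemma dist_cvg (R : realType) (u : nat -> R) :
  (forall e : R, 0 < e -> exists n, forall m, (n <= m)%N -> `|u m - u n| <= e) ->
  cvgn u.
Proof.
move=> h; apply/cauchy_cvgP/cauchy_ballP => e e0.
have [|n nh] := h (e / 3); first by rewrite divr_gt0.
exists (u @` [set m | (n <= m)%N], u @` [set m | (n <= m)%N]).
  by split; exists n => // m nm; exists m.
move=> [_ _] [/= [i ni <-] [j nj <-]]; rewrite /ball/=.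
have := nh _ ni; have := nh _ nj.
have -> : u i - u j = (u i - u n) - (u j - u n) by ring.
move=> h1 h2; rewrite (le_lt_trans (ler_normB _ _))//; lra.
Qed.

Lemma geometric_small (R : realType) (q c e : R) : 0 <= q < 1 -> 0 < e ->
  exists n, forall m, (n <= m)%N -> c * q ^+ m <= e.
Proof.
move=> /andP[q0 q1] e0.
have h : c * q ^+ m @[m --> \oo] --> 0 * c.
  by rewrite mulrC; apply: cvgMr; apply: cvg_expr; rewrite ger0_norm.
rewrite mul0r in h.
have /cvgrPdist_le/(_ e e0)[n _ nh] := h.
by exists n => m /nh; rewrite sub0r normrN; exact: le_trans (ler_norm _).
Qed.

Lemma sum_geometric_le (R : realType) (q : R) n m : 0 <= q < 1 ->
  \sum_(n <= k < n + m) q ^+ k <= q ^+ n / (1 - q).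
Proof.
move=> /andP[q0 q1]; have q1' : 1 - q != 0 by rewrite subr_eq0 gt_eqF.
suff -> : \sum_(n <= k < n + m) q ^+ k = (q ^+ n - q ^+ (n + m)) / (1 - q).
  rewrite ler_pM2r ?invr_gt0 ?subr_gt0// gerBl exprn_ge0//.
elim: m => [|m IH]; first by rewrite addn0 big_geq// subrr mul0r.
by rewrite addnS big_nat_recr ?leq_addr//= IH exprS; field.
Qed.

(** For [0 <= q < 1] the second summand is the tail of the series in closed form; keeping it makes
    the induction pure algebra. *)
Lemma sum_mul_geometric (R : realType) (q : R) n : q < 1 ->
  \sum_(k < n) k%:R * q ^+ k
  + q ^+ n * (n%:R * (1 - q) + q) / (1 - q) ^+ 2 = q / (1 - q) ^+ 2.
Proof.
move=> q1; have q1' : 1 - q != 0 by rewrite subr_eq0 gt_eqF.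
elim: n => [|n IH]; first by rewrite big_ord0 expr0 mul0r !add0r mul1r.
rewrite -[RHS]IH big_ord_recr/= exprS -natr1; field.
by [].
Qed.

(** * Contraction of products of operators *)

Section resolvent.
Context d (T : measurableType d) (R : realType).
Implicit Types (f g : T -> R) (L : (T -> R) -> R).

Variable K : (T -> R) -> T -> R.
Hypothesis pK : plop K.
Hypothesis K1 : forall x, K (fun=> 1) x <= 1.
Variables (c q : R).
Hypothesis q01 : 0 <= q < 1.
Hypothesis K_geo : forall n x, iter n K (fun=> 1) x <= c * q ^+ n.

Definition Apart n f x : R := \sum_(k < n) iter k K f x.
(** The potential [A] of the overview, that is the inverse of [1 - K]. *)
Definition res f x : R := limn (fun n => Apart n f x).

Definition res_norm := c / (1 - q).

Let q1 : 0 < 1 - q. Proof. by case/andP: q01; rewrite subr_gt0. Qed.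

Lemma c_ge0 (x : T) : 0 <= c.
Proof.
by apply: le_trans ler01 _; have := K_geo 0 x; rewrite expr0 mulr1.
Qed.

Lemma iterK_norm f B k : bm f -> (forall x, `|f x| <= B) ->
  forall x, `|iter k K f x| <= c * q ^+ k * B.
Proof.
move=> bf fB x; rewrite (le_trans (plf_norm ((plop_iter k pK).2 x) bf fB))//.
by rewrite mulrC; apply: ler_wpM2r (K_geo k x); exact: le_trans (fB x).
Qed.

Lemma plop_Apart n : plop (Apart n).
Proof. exact: (plop_lsum n (fun i => plop_iter i pK)). Qed.

Lemma ApartB_norm n m f B : bm f -> (forall x, `|f x| <= B) -> (n <= m)%N ->
  forall x, `|Apart m f x - Apart n f x| <= res_norm * B * q ^+ n.
Proof.
move=> bf fB nm x; have B0 : 0 <= B by exact: le_trans (fB x).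
rewrite /Apart -!(big_mkord xpredT (fun k => iter k K f x)).
rewrite (big_cat_nat _ nm)//= addrAC subrr add0r.
rewrite (le_trans (ler_norm_sum _ _ _))//.
rewrite (@le_trans _ _ (\sum_(n <= k < m) c * B * q ^+ k))//.
  by apply: ler_sum => k _; rewrite mulrAC; exact: iterK_norm.
rewrite -mulr_sumr -(subnKC nm) /res_norm.
rewrite (le_trans (ler_wpM2l _ (sum_geometric_le n (m - n) q01)))//.
  by rewrite mulr_ge0//; exact: c_ge0.
by rewrite le_eqVlt; apply/orP; left; apply/eqP; ring.
Qed.

Lemma Apart_norm n f B : bm f -> (forall x, `|f x| <= B) ->
  forall x, `|Apart n f x| <= res_norm * B.
Proof.
move=> bf fB x; have := ApartB_norm bf fB (leq0n n) x.
by rewrite {2}/Apart big_ord0 subr0 expr0 mulr1.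
Qed.

Lemma cvg_Apart f x : bm f -> Apart n f x @[n --> \oo] --> res f x.
Proof.
move=> bf; have [B B0 fB] := bm_bound bf.
apply: dist_cvg => e e0.
have [n nh] := geometric_small (res_norm * B) q01 e0.
exists n => m nm; rewrite (le_trans (ApartB_norm bf fB nm x))//; exact: nh.
Qed.

Lemma res_Apart f B n : bm f -> (forall x, `|f x| <= B) ->
  forall x, `|res f x - Apart n f x| <= res_norm * B * q ^+ n.
Proof.
move=> bf fB x; apply: (cvg_dist_le (n := n) (cvg_Apart bf)) => k nk.
exact: ApartB_norm.
Qed.

Lemma resE f x l : Apart n f x @[n --> \oo] --> l -> res f x = l.
Proof. by move/cvg_lim; exact. Qed.

Lemma res_bound f B : bm f -> (forall x, `|f x| <= B) ->
  forall x, `|res f x| <= res_norm * B.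
Proof.
move=> bf fB x; have := res_Apart 0 bf fB x.
by rewrite /Apart big_ord0 subr0 expr0 mulr1.
Qed.

Lemma plop_res : plop res.
Proof.
split=> [f bf|x].
  split.
    apply: (@measurable_fun_cvg _ _ _ _ (fun n => Apart n f)) => [n|x _].
      exact: (plop_bm (plop_Apart n) bf).1.
    exact: cvg_Apart.
  by have [B _ fB] := bm_bound bf; exists (res_norm * B); exact: res_bound.
split.
- move=> f g bf bg; apply: resE.
  under eq_fun do rewrite (plfD ((plop_Apart _).2 x) bf bg).
  by apply: cvgD; exact: cvg_Apart.
- move=> a f bf; apply: resE.
  under eq_fun do rewrite (plfZ ((plop_Apart _).2 x) _ bf).
  by apply: cvgZr; exact: cvg_Apart.
- move=> f bf f0; have h := cvg_Apart (x := x) bf.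
  rewrite /res; apply: limr_ge; first by apply/cvg_ex; exists (res f x).
  by near=> n; apply: (plop_ge0 (plop_Apart n)).
Unshelve. all: by end_near. Qed.

Lemma res1 x : res (fun=> 1) x <= res_norm.
Proof.
have h (y : T) : `|1 : R| <= 1 by rewrite normr1.
by rewrite (le_trans (ler_norm _))// (le_trans (res_bound (bm_cst _) h x))// mulr1.
Qed.

Lemma ApartS n f x : bm f -> Apart n.+1 f x = f x + Apart n (K f) x.
Proof.
move=> bf; rewrite /Apart big_ord_recl/=; congr (_ + _).
by apply: eq_bigr => i _; rewrite -iterSr.
Qed.

Lemma K_Apart n f x : bm f -> K (Apart n f) x = Apart n (K f) x.
Proof.
move=> bf; rewrite /Apart (plf_sum (pK.2 x)); last first.
  by move=> i; exact: (plop_bm (plop_iter _ pK)).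
by apply: eq_bigr => i _; rewrite -iterSr.
Qed.

Lemma res_fix f x : bm f -> res f x = f x + res (K f) x.
Proof.
move=> bf; apply: resE.
rewrite -cvg_shiftS/=; under eq_fun do rewrite ApartS//.
by apply: cvgD; [exact: cvg_cst|exact/cvg_Apart/(plop_bm pK)].
Qed.

(** The geometric tail of the series is uniform in the state, so [K] passes to the limit by
    positivity alone. *)
Lemma K_res f x : bm f -> K (res f) x = res (K f) x.
Proof.
move=> bf; have [B B0 fB] := bm_bound bf.
have h : K (Apart n f) x @[n --> \oo] --> K (res f) x.
  apply/cvgrPdist_le => e e0.
  have [n nh] := geometric_small (res_norm * B) q01 e0.
  exists n => // m nm.
  rewrite (le_trans (plf_dist (B := e) (pK.2 x) _ _ _))//.
  - exact: (plop_bm plop_res).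
  - exact: (plop_bm (plop_Apart _)).
  - by move=> y; rewrite (le_trans (res_Apart m bf fB y))// nh.
  - by rewrite ler_piMr// ltW.
by rewrite -(cvg_lim _ h)//; under eq_fun do rewrite K_Apart//.
Qed.

Lemma res_fixK f x : bm f -> res f x = f x + K (res f) x.
Proof. by move=> bf; rewrite K_res// res_fix. Qed.

Lemma res_ge f x : bm f -> (forall x, 0 <= f x) -> f x <= res f x.
Proof.
move=> bf f0; rewrite res_fix// lerDl.
by apply: (plop_ge0 plop_res); [exact: (plop_bm pK)|exact: (plop_ge0 pK)].
Qed.

(** Potentials of nonnegative functions are excessive. This carries a lower bound for [res K f] on
    [U] over to every point from which [U] is accessible. *)
Lemma iterK_res_le n f x : bm f -> (forall x, 0 <= f x) ->
  iter n K (res f) x <= res f x.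
Proof.
move=> bf f0; elim: n x => [//|n IH] x.
have bA := plop_bm plop_res bf.
rewrite iterSr (le_trans _ (IH x))//.
apply: (plop_mono (plop_iter n pK)) => //; first exact: (plop_bm pK).
by move=> y; rewrite [leRHS]res_fixK// lerDr.
Qed.

End resolvent.

(** * Linear functionals on polynomials *)

Section poly_functional.
Variable R : realType.
Implicit Types (p q : {poly R}) (s : nat -> R).

(* [pfun s] extends [X^i |-> s i] linearly. *)
Definition pfun s p : R := \sum_(i < size p) p`_i * s i.

Lemma pfunE s p n : (size p <= n)%N -> pfun s p = \sum_(i < n) p`_i * s i.
Proof.
move=> pn; rewrite /pfun (big_ord_widen n (fun i => p`_i * s i) pn).
rewrite big_mkcond; apply: eq_bigr => i _; case: ltnP => // pi.
by rewrite nth_default// mul0r.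
Qed.

Lemma pfunD s p q : pfun s (p + q) = pfun s p + pfun s q.
Proof.
rewrite (pfunE s (size_polyD p q)) (pfunE s (leq_maxl (size p) (size q))).
rewrite (pfunE s (leq_maxr (size p) (size q))) -big_split/=.
by apply: eq_bigr => i _; rewrite coefD mulrDl.
Qed.

Lemma pfunZ s a p : pfun s (a *: p) = a * pfun s p.
Proof.
rewrite (pfunE s (size_scale_leq a p)) mulr_sumr.
by apply: eq_bigr => i _; rewrite coefZ mulrA.
Qed.

Lemma pfun_sum s (F : nat -> {poly R}) n :
  pfun s (\sum_(i < n) F i) = \sum_(i < n) pfun s (F i).
Proof.
elim: n => [|n IH]; last by rewrite !big_ord_recr pfunD/= IH.
by rewrite !big_ord0 /pfun size_poly0 big_ord0.
Qed.

Lemma pfunMXn s k p : pfun s (p * 'X^k) = pfun (fun i => s (k + i)%N) p.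
Proof.
have h : (size (p * 'X^k)%R <= k + size p)%N.
  by rewrite (leq_trans (size_polyMleq _ _))// size_polyXn addnS/= addnC.
rewrite (pfunE s h) big_split_ord/= big1 ?add0r => [|i _].
  by apply: eq_bigr => i _; rewrite coefMXn ltnNge leq_addr/= addKn.
by rewrite coefMXn ltn_ord mul0r.
Qed.

Lemma pfunM s p q :
  pfun s (p * q) = \sum_(i < size q) q`_i * pfun (fun j => s (i + j)%N) p.
Proof.
rewrite -{1}(coefK q) poly_def mulr_sumr.
rewrite (pfun_sum s (fun i => p * (q`_i *: 'X^i))).
by apply: eq_bigr => i _; rewrite -scalerAr pfunZ pfunMXn.
Qed.

Lemma pfun_derivX s p : pfun s (p^`() * 'X) = pfun (fun i => i%:R * s i) p.
Proof.
have h : (size (p^`() * 'X)%R <= size p)%N.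
  apply/leq_sizeP => j pj; rewrite coefMX coef_deriv.
  by case: j pj => //= j pj; rewrite nth_default ?mul0rn.
rewrite (pfunE s h); apply: eq_bigr => -[[|i]/= ip] _; rewrite coefMX/=.
  by rewrite mulr0n !mul0r mulr0.
by rewrite coef_deriv -mulr_natr; ring.
Qed.



Definition nnegp p : Prop := forall i, 0 <= p`_i.

Lemma nnegpD p q : nnegp p -> nnegp q -> nnegp (p + q).
Proof. by move=> hp hq i; rewrite coefD addr_ge0. Qed.

Lemma nnegpM p q : nnegp p -> nnegp q -> nnegp (p * q).
Proof. by move=> hp hq i; rewrite coefM sumr_ge0// => j _; rewrite mulr_ge0. Qed.

Lemma nnegpZ a p : 0 <= a -> nnegp p -> nnegp (a *: p).
Proof. by move=> a0 hp i; rewrite coefZ mulr_ge0. Qed.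

Lemma nnegpC a : 0 <= a -> nnegp a%:P.
Proof. by move=> a0 i; rewrite coefC; case: ifP. Qed.

Lemma le_pfun s p q : (forall i, 0 <= s i) -> nnegp (q - p) ->
  pfun s p <= pfun s q.
Proof.
move=> s0 qp; rewrite -(subrK p q) pfunD lerDr sumr_ge0// => i _.
by rewrite mulr_ge0.
Qed.

End poly_functional.

(** * Products of factors [a + h * A]: mean degree and contraction *)

Section operator_products.
Context d (T : measurableType d) (R : realType).
Implicit Types (f g : T -> R) (L : (T -> R) -> R) (l : seq (R * R)).

(* The head of [l] is applied last. *)
Fixpoint polyop (A : (T -> R) -> T -> R) l f : T -> R :=
  if l is ah :: l' then
    fun x => ah.1 * polyop A l' f x + ah.2 * A (polyop A l' f) x
  else f.

(** The bound [1 / 2 <= a] keeps products bounded away from 0 on the function 1 and gives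
    [2 * a - 1 >= 0] in [coefpoly_deriv]; the upper bounds control the normalisation of one factor
    in [polyop_contract]. *)
Definition admissible l :=
  all (fun ah => (1 / 2 <= ah.1 <= 1) && (0 <= ah.2 <= 1)) l.

(** The clock of the contraction; for the blocks of the process it is the accumulated killing. *)
Definition tmass l : R := \sum_(ah <- l) ah.2.

Lemma plop_polyop A l : plop A -> admissible l -> plop (polyop A l).
Proof.
move=> pA; elim: l => [|[a h] l IH]/=; first by move=> _; exact: plop_id.
move=> /andP[/andP[/andP[a0 a1] /andP[h0 h1]] /IH{}IH].
by apply: (plopDl _ h0 IH (plop_comp pA IH)); lra.
Qed.

Lemma tmass_ge0 l : admissible l -> 0 <= tmass l.
Proof.
rewrite /tmass; elim: l => [|[a h] l IH]; first by rewrite big_nil.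
move=> /andP[/andP[/andP[a0 a1] /andP[h0 h1]] /IH{}IH].
by rewrite big_cons addr_ge0.
Qed.

Lemma polyop1_ge A l x : plop A -> admissible l ->
  (1 / 2) ^+ size l <= polyop A l (fun=> 1) x.
Proof.
move=> pA; elim: l x => [|[a h] l IH] x /=; first by rewrite expr0.
move=> /andP[/andP[/andP[ag al] /andP[h0 h1]] vl].
have bv := plop_bm (plop_polyop pA vl) (bm_cst 1).
have r0 : 0 <= A (polyop A l (fun=> 1)) x.
  by apply: (plop_ge0 pA bv) => z; rewrite (le_trans _ (IH z vl))// exprn_ge0.
rewrite exprS -[leLHS]addr0 lerD ?mulr_ge0// ler_pM// ?exprn_ge0//; exact: IH.
Qed.

Lemma polyop1_gt0 A L l : plop A -> plf L -> L (fun=> 1) = 1 -> admissible l ->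
  0 < L (polyop A l (fun=> 1)).
Proof.
move=> pA pL L1 vl; apply: (@lt_le_trans _ _ ((1 / 2) ^+ size l)).
  by rewrite exprn_gt0// divr_gt0.
have <- : L (fun=> (1 / 2) ^+ size l) = (1 / 2) ^+ size l.
  by rewrite (plf_cst pL) L1 mulr1.
apply: (plf_mono pL); [exact: bm_cst|exact/(plop_bm (plop_polyop pA vl))/bm_cst|].
by move=> x; exact: polyop1_ge.
Qed.

Section fixed_kernel.
Variable K : (T -> R) -> T -> R.
Hypothesis pK : plop K.
Variables (c q : R).
Hypothesis q01 : 0 <= q < 1.
(** To be instantiated by the supremum of [K ^ n 1]. Degrees are weighted by [b], so the estimates
    do not depend on the starting point. *)
Variable b : nat -> R.
Hypothesis b_ge0 : forall n, 0 <= b n.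
Hypothesis bD : forall n m, b (n + m)%N <= b n * b m.
Hypothesis b_geo : forall n, b n <= c * q ^+ n.
Hypothesis K_b : forall n x, iter n K (fun=> 1) x <= b n.

Let K_geo n x : iter n K (fun=> 1) x <= c * q ^+ n.
Proof. exact: le_trans (K_b n x) (b_geo n). Qed.

Definition geomp M : {poly R} := \poly_(k < M) 1.

Fixpoint coefpoly M l : {poly R} :=
  if l is ah :: l' then coefpoly M l' * (ah.1%:P + ah.2 *: geomp M) else 1.

Let e n x := iter n K (fun=> 1) x.

Let bme n : bm (e n). Proof. exact: (plop_bm (plop_iter n pK) (bm_cst 1)). Qed.

Lemma iter_pfun k p x :
  iter k K (fun x => pfun (e ^~ x) p) x = pfun (fun i => e (k + i)%N x) p.
Proof.
rewrite (plf_sum (L := fun f => iter k K f x) ((plop_iter k pK).2 x)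
  (F := fun i x => p`_i * e i x)); last by move=> i; exact: bmZ.
apply: eq_bigr => i _; rewrite (plfZ ((plop_iter k pK).2 x))//.
by rewrite /e iterD.
Qed.

(** Truncating the potential turns a product into a genuine polynomial in [K], whose action on 1 is
    read off the coefficients; [ratio_res] removes the truncation. *)
Lemma polyop_pfun M l : polyop (Apart K M) l (fun=> 1) =
  fun x => pfun (e ^~ x) (coefpoly M l).
Proof.
apply/funext; elim: l => [|[a h] l /funext IH] x /=.
  by rewrite /pfun size_poly1 big_ord1 coef1 mul1r.
rewrite IH mulrDr pfunD -scalerAr pfunZ [_ * a%:P]mulrC mul_polyC pfunZ.
congr (_ + h * _).
rewrite /geomp poly_def mulr_sumr.
rewrite (pfun_sum _ (fun i => _ * (1 *: 'X^i))).
by apply: eq_bigr => i _; rewrite iter_pfun scale1r pfunMXn.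
Qed.

Lemma geomp_nneg M : nnegp (geomp M).
Proof. by move=> i; rewrite coef_poly; case: ifP. Qed.

Lemma coefpoly_nneg M l : admissible l -> nnegp (coefpoly M l).
Proof.
elim: l => [_|[a h] l IH]/=; first by rewrite -polyC1; exact: (nnegpC ler01).
move=> /andP[/andP[/andP[a0 a1] /andP[h0 h1]] /IH{}IH].
apply: nnegpM => //; apply: nnegpD; first by apply: nnegpC; lra.
exact/(nnegpZ h0)/geomp_nneg.
Qed.

Definition tgeomp M : {poly R} := (geomp M)^`() * 'X.

(* Logarithmic derivative of the product [prod (a + h * geomp M)], with [2 * a >= 1]. *)
Lemma coefpoly_deriv M l : admissible l ->
  nnegp ((2 * tmass l) *: (coefpoly M l * tgeomp M)
    - (coefpoly M l)^`() * 'X).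
Proof.
have tg : nnegp (tgeomp M).
  move=> i; rewrite coefMX; case: ifP => // _.
  by rewrite coef_deriv mulrn_wge0// coef_poly; case: ifP.
elim: l => [_|[a h] l IH]/=.
  by rewrite /tmass big_nil mulr0 scale0r derivC mul0r subr0 => i; rewrite coef0.
move=> /andP[/andP[/andP[a0 a1] /andP[h0 h1]] vl]; have {}IH := IH vl.
have pl := coefpoly_nneg M vl.
set p := coefpoly M l in IH pl *; set g := geomp M.
rewrite /tmass big_cons -/(tmass l) /=.
(* By the product rule the new factor contributes [h * p * tgeomp M] to the derivative, against
   [2 * h * p * (a + h * g) * tgeomp M] on the other side; the surplus is the last term. *)
have -> : (2 * (h + tmass l)) *: (p * (a%:P + h *: g) * tgeomp M) -
    (p * (a%:P + h *: g))^`() * 'X =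
    ((2 * tmass l) *: (p * tgeomp M) - p^`() * 'X) * (a%:P + h *: g) +
    h *: (p * tgeomp M) * ((2 * a - 1)%:P + (2 * h) *: g).
  rewrite derivM derivD derivC derivZ add0r /tgeomp -/g -!mul_polyC.
  by ring.
have hg : nnegp g := geomp_nneg M.
have pos r r' : 0 <= r -> 0 <= r' -> nnegp (r%:P + r' *: g).
  by move=> r0 r'0; apply: nnegpD; [exact: nnegpC|exact: nnegpZ].
apply: nnegpD; apply: nnegpM => //.
- by apply: pos; lra.
- by apply: nnegpZ => //; exact: nnegpM.
- by apply: pos; lra.
Qed.

(** Submultiplicativity of [b], one coefficient at a time. It separates the factor [tgeomp] in
    [pfun_mean]. *)
Lemma pfunM_le p r : nnegp p -> nnegp r ->
  pfun b (p * r) <= pfun b p * pfun b r.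
Proof.
move=> hp hr; rewrite pfunM mulr_sumr; apply: ler_sum => i _.
rewrite mulrCA ler_wpM2l// mulr_suml; apply: ler_sum => j _.
by rewrite -mulrA [b j * _]mulrC ler_wpM2l.
Qed.

(** Bounds [\sum_k k * b k], because [\sum_k k * q ^ k = q / (1 - q) ^ 2]; it does not depend on the
    truncation. *)
Definition res_mean := c / (1 - q) ^+ 2.

Lemma pfun_tgeomp M : pfun b (tgeomp M) <= res_mean.
Proof.
have /andP[q0 q1] := q01; have q1' : 0 < 1 - q by rewrite subr_gt0.
have c0 : 0 <= c by have := le_trans (b_ge0 0) (b_geo 0); rewrite expr0 mulr1.
rewrite pfun_derivX (pfunE _ (size_poly _ _)).
rewrite (@le_trans _ _ (\sum_(k < M) c * (k%:R * q ^+ k)))//.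
  apply: ler_sum => i _; rewrite coef_poly ltn_ord mul1r mulrCA.
  by rewrite ler_wpM2l.
rewrite -mulr_sumr ler_wpM2l//.
have := sum_mul_geometric M q1.
have : 0 <= q ^+ M * (M%:R * (1 - q) + q) / (1 - q) ^+ 2.
  have q1l := ltW q1'.
  by rewrite divr_ge0 ?exprn_ge0// mulr_ge0 ?exprn_ge0// addr_ge0// mulr_ge0.
have : q / (1 - q) ^+ 2 <= (1 - q) ^- 2.
  by rewrite ler_piMl ?(ltW q1)// invr_ge0 exprn_ge0// ltW.
lra.
Qed.

(** The coefficientwise bound [coefpoly_deriv] evaluated at [b]. The mean degree is controlled by
    the mass alone, not by the number of factors or by the truncation. *)
Lemma pfun_mean M l : admissible l ->
  pfun (fun i => i%:R * b i) (coefpoly M l)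
    <= 2 * tmass l * res_mean * pfun b (coefpoly M l).
Proof.
move=> vl; rewrite -pfun_derivX.
have pl := coefpoly_nneg M vl; have S0 := tmass_ge0 vl.
apply: le_trans (le_pfun b_ge0 (coefpoly_deriv M vl)) _.
rewrite pfunZ -mulrA; apply: ler_wpM2l; first by rewrite mulr_ge0.
apply: le_trans (pfunM_le pl _) _.
  move=> i; rewrite coefMX; case: ifP => // _.
  by rewrite coef_deriv mulrn_wge0// coef_poly; case: ifP.
rewrite mulrC ler_wpM2r ?pfun_tgeomp// sumr_ge0// => i _.
by rewrite mulr_ge0.
Qed.

Variable Psi : (T -> R) -> R.
Hypothesis pPsi : plf Psi.
Hypothesis Psi1 : Psi (fun=> 1) = 1.
Variable C : R -> R.
Hypothesis C_ge0 : forall s, 0 <= s -> 0 <= C s.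
Hypothesis C_noninc : forall s t, 0 <= s <= t -> C t <= C s.
Hypothesis C_Psi : forall n, C n%:R * b n <= Psi (iter n K (fun=> 1)).

(* At least twice a bound on the mean degree in [K] of an operator product of mass [S]. *)
Definition horizon S := 4 * res_mean * S + 1.

Lemma res_mean_ge0 : 0 <= res_mean.
Proof.
have c0 : 0 <= c by have := le_trans (b_ge0 0) (b_geo 0); rewrite expr0 mulr1.
by rewrite divr_ge0// exprn_ge0// subr_ge0; case/andP: q01 => _ /ltW.
Qed.

Lemma horizon_gt0 S : 0 <= S -> 0 < horizon S.
Proof.
by move=> S0; rewrite /horizon ltr_wpDl// mulr_ge0// mulr_ge0// res_mean_ge0.
Qed.

(** Markov's inequality in linear form: [C t * (1 - i / t) <= C i] for every degree [i], by
    monotonicity of [C] if [i <= t] and by sign otherwise. Since [t] is at least twice the mean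
    degree, half of the total weight remains. *)
Lemma ratio_Apart M l x : admissible l ->
  C (horizon (tmass l)) / 2 * polyop (Apart K M) l (fun=> 1) x
    <= Psi (polyop (Apart K M) l (fun=> 1)).
Proof.
move=> vl; rewrite polyop_pfun; set p := coefpoly M l.
have pl : nnegp p := coefpoly_nneg M vl; have S0 := tmass_ge0 vl.
set t := horizon _; have t0 : 0 < t by exact: horizon_gt0.
have Ct0 : 0 <= C t by rewrite C_ge0// ltW.
rewrite (plf_sum pPsi (F := fun i x => p`_i * e i x)); last by move=> i; exact: bmZ.
apply: (@le_trans _ _ (C t / 2 * pfun b p)).
  apply: ler_wpM2l; first by rewrite divr_ge0.
  by apply: ler_sum => i _; rewrite ler_wpM2l// K_b.
apply: (@le_trans _ _ (\sum_(i < size p) C t * (p`_i * b i - p`_i * (i%:R * b i) / t))).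
  rewrite -mulr_sumr -mulrA ler_wpM2l// sumrB -mulr_suml -!/(pfun _ _).
  have W0 : 0 <= pfun b p by rewrite sumr_ge0// => i _; rewrite mulr_ge0.
  have : pfun (fun i => i%:R * b i) p / t <= pfun b p / 2.
    rewrite ler_pdivrMr// (le_trans (pfun_mean M vl))// -/p.
    rewrite -subr_ge0 /t /horizon.
    rewrite (_ : _ - _ = pfun b p / 2); last by field.
    by rewrite divr_ge0.
  rewrite mulrC; lra.
apply: ler_sum => i _; rewrite (plfZ pPsi)//.
apply: (@le_trans _ _ (p`_i * (C i%:R * b i))); last by rewrite ler_wpM2l.
rewrite (_ : C t * _ = p`_i * (C t * (1 - i%:R / t) * b i)); last by ring.
rewrite ler_wpM2l// ler_wpM2r//.
have [it|ti] := leP i%:R t.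
  apply: (@le_trans _ _ (C t)); last by rewrite C_noninc// it andbT.
  by rewrite ler_piMr// gerBl divr_ge0// ltW.
apply: (@le_trans _ _ 0); last exact: C_ge0.
by rewrite mulr_ge0_le0// subr_le0 ler_pdivlMr// mul1r ltW.
Qed.

Let res := res K.
Let a0 := res_norm c q.
Let pres : plop res := plop_res pK q01 K_geo.

Let a0_ge0 : 0 <= a0.
Proof.
have c0 : 0 <= c by have := le_trans (b_ge0 0) (b_geo 0); rewrite expr0 mulr1.
by rewrite divr_ge0// subr_ge0; case/andP: q01 => _ /ltW.
Qed.

Lemma cvg_polyop_Apart l f : admissible l -> bm f -> forall eps, 0 < eps ->
  exists N, forall M, (N <= M)%N -> forall x,
    `|polyop (Apart K M) l f x - polyop res l f x| <= eps.
Proof.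
move=> vl bf; elim: l vl => [|[a h] l IH] /=.
  by move=> _ eps e0; exists 0%N => M _ x; rewrite subrr normr0 ltW.
move=> /andP[/andP[/andP[ag al] /andP[h0 h1]] vl] eps e0.
have bu M := plop_bm (plop_polyop (plop_Apart pK M) vl) bf.
have bv := plop_bm (plop_polyop pres vl) bf.
have [B B0 vB] := bm_bound bv.
(* The head [a + h * A] amplifies the inductive error by at most [1 + a0]; the other half of [eps]
   pays for truncating [A] in the head itself. *)
have [|N1 hN1] := IH vl (eps / (2 * (1 + a0))).
  by rewrite divr_gt0// mulr_gt0// ltr_pwDl.
have [|N2 hN2] := geometric_small (a0 * B) q01 (e := eps / 2).
  by rewrite divr_gt0.
exists (maxn N1 N2) => M; rewrite geq_max => /andP[{}/hN1 hN1 {}/hN2 hN2] x.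
set u := polyop (Apart K M) l f in hN1 *; set v := polyop res l f in hN1 bv vB *.
have bu' : bm u := bu M.
have h2 : `|Apart K M u x - Apart K M v x| <= a0 * (eps / (2 * (1 + a0))).
  have -> : Apart K M u x - Apart K M v x = Apart K M (fun x => u x - v x) x.
    by rewrite (plopB (plop_Apart pK M)).
  by apply: (Apart_norm pK q01 K_geo) => //; exact: bmB.
have h3 : `|Apart K M v x - res v x| <= eps / 2.
  rewrite distrC (le_trans (res_Apart pK q01 K_geo M bv vB x))//.
have h1' := hN1 x.
have -> : a * u x + h * Apart K M u x - (a * v x + h * res v x) =
  a * (u x - v x) + h * ((Apart K M u x - Apart K M v x) + (Apart K M v x - res v x)) by ring.
rewrite (le_trans (ler_normD _ _))// !normrM (ger0_norm h0) (@ger0_norm _ a); last by lra.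
rewrite (@le_trans _ _ (1 * `|u x - v x| + 1 * (`|Apart K M u x - Apart K M v x| + `|Apart K M v x - res v x|)))//.
  by rewrite lerD// ler_pM// ?ler_normD//; lra.
have : eps / (2 * (1 + a0)) + a0 * (eps / (2 * (1 + a0))) = eps / 2.
  by field; rewrite gt_eqF// ltr_pwDl.
lra.
Qed.

Lemma ratio_res l x : admissible l ->
  C (horizon (tmass l)) / 2 * polyop res l (fun=> 1) x
    <= Psi (polyop res l (fun=> 1)).
Proof.
move=> vl; have S0 := tmass_ge0 vl.
have Ct0 : 0 <= C (horizon (tmass l)) by rewrite C_ge0// ltW// horizon_gt0.
set k := C _ / 2 in Ct0 *; have k0 : 0 <= k by rewrite divr_ge0.
apply/ler_addgt0Pr => eps e0.
have [|N /(_ N (leqnn _)) hN] := cvg_polyop_Apart vl (bm_cst 1) (eps := eps / (1 + k)).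
  by rewrite divr_gt0// ltr_pwDl.
have := ratio_Apart N x vl; rewrite -/k.
have bu := plop_bm (plop_polyop (plop_Apart pK N) vl) (bm_cst 1).
have bv := plop_bm (plop_polyop pres vl) (bm_cst 1).
have := plf_dist pPsi bu bv hN; rewrite Psi1 mulr1.
have := hN x; rewrite !ler_norml => /andP[h1 h2] /andP[h3 h4] h5.
have h6 : k * polyop res l (fun=> 1) x <= k * (polyop (Apart K N) l (fun=> 1) x + eps / (1 + k)).
  by rewrite ler_wpM2l//; lra.
have : eps / (1 + k) + k * (eps / (1 + k)) = eps.
  by field; rewrite gt_eqF// ltr_pwDl.
move: h6; rewrite mulrDr; lra.
Qed.

Variable x0 : T.

Let res_mean_gt0 : 0 < res_mean.
Proof.
have c0 : 0 < c.
  rewrite (lt_le_trans ltr01)//.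
  by have := le_trans (K_b 0 x0) (b_geo 0); rewrite expr0 mulr1.
by rewrite divr_gt0// exprn_gt0// subr_gt0; case/andP: q01.
Qed.

Variable c0 : R.
Hypothesis c0_gt0 : 0 < c0.
Hypothesis res_minor : forall f x, bm f -> (forall x, 0 <= f x) ->
  c0 * Psi f <= res f x.
(** An antiderivative of [C]; only the upper bound on its increments that monotonicity of [C]
    provides is required. *)
Variable I : R -> R.
Hypothesis I_C : forall t u, 0 <= t -> 0 <= u -> I (t + u) <= I t + u * C t.

(** A factor with coefficient [h] multiplies the oscillation by at most [1 - k], where [k] is
    [h * c0 / (2 * (1 + a0))] times [C] at the current horizon. It also advances the horizon by
    [4 * res_mean * h], so the sum of the [k] dominates a multiple of the integral of [C] from
    [horizon 0 = 1] to [horizon S]. *)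
Definition rate S := expR (- (c0 / (2 * (1 + res_norm c q)) / (4 * res_mean)
                              * (I (horizon S) - I 1))).

(** A Doeblin argument on the ratio [u / g] of the products applied to [f] and to 1. One more factor
    contains [h * A >= h * c0 * Psi], which pulls the ratio towards its average [p = Psi u / Psi g]
    with a weight that [ratio_res] bounds below. Since the head is applied last, the relevant
    horizon is that of the tail [l]. *)
Lemma polyop_contract l f m0 M0 : admissible l -> bm f ->
  (forall x, m0 <= f x <= M0) ->
  exists m M, [/\ m0 <= m, M <= M0, M - m <= rate (tmass l) * (M0 - m0) &
    forall x, m * polyop res l (fun=> 1) x <= polyop res l f x
              <= M * polyop res l (fun=> 1) x].
Proof.
move=> vl bf fb.
have p1 : 0 < 1 + a0 by rewrite ltr_pwDl.
have mM0 : 0 <= M0 - m0 by have /andP[] := fb x0; lra.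
elim: l vl => [|[a h] l IH] /=.
  move=> _; exists m0, M0; split => //; last by move=> x; rewrite !mulr1.
  rewrite /rate /tmass big_nil /horizon mulr0 add0r subrr mulr0 oppr0 expR0.
  by rewrite mul1r.
move=> /andP[/andP[/andP[ag al] /andP[h0 h1]] vl].
have {IH}[m [M [mm0 MM0 Mm uMm]]] := IH vl.
set S := tmass l in Mm *.
have -> : tmass ((a, h) :: l) = S + h by rewrite /tmass big_cons addrC.
have S0 : 0 <= S := tmass_ge0 vl.
set g := polyop res l (fun=> 1) in uMm *; set u := polyop res l f in uMm *.
have bu : bm u := plop_bm (plop_polyop pres vl) bf.
have bg : bm g := plop_bm (plop_polyop pres vl) (bm_cst 1).
have g0 x : 0 < g x.
  apply: lt_le_trans (polyop1_ge x pres vl).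
  by rewrite exprn_gt0// divr_gt0.
set t := horizon S; have t0 : 0 < t by exact: horizon_gt0.
have Ct0 : 0 <= C t by rewrite C_ge0// ltW.
have gPsi x : C t / 2 * g x <= Psi g by exact: ratio_res.
have Psig : 0 < Psi g := polyop1_gt0 pres pPsi Psi1 vl.
have bmg r : bm (fun x => r * g x) := bmZ r bg.
have mp : m <= Psi u / Psi g.
  rewrite ler_pdivlMr// -(plfZ pPsi)//.
  by apply: (plf_mono pPsi) => // x; case/andP: (uMm x).
have pM : Psi u / Psi g <= M.
  rewrite ler_pdivrMr// -(plfZ pPsi)//.
  by apply: (plf_mono pPsi) => // x; case/andP: (uMm x).
set p := Psi u / Psi g in mp pM.
have Psiu : Psi u = p * Psi g by rewrite /p divfK// gt_eqF.
pose k := h * (c0 / (2 * (1 + a0)) * C t).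
have k0 : 0 <= k by rewrite mulr_ge0// mulr_ge0// divr_ge0 ?(ltW c0_gt0)// mulr_ge0// ltW.
have ring_k : k * (1 + a0) = h * c0 * (C t / 2) by rewrite /k; field; rewrite gt_eqF.
(* The minorant [h * c0 * Psi g] is at least [k] times the new normalisation. *)
have kg x : k * (a * g x + h * res g x) <= h * c0 * Psi g.
  have h2 : C t / 2 * res g x <= Psi g * a0.
    rewrite -(plfZ (pres.2 x))//.
    rewrite (@le_trans _ _ (res (fun=> Psi g) x))//.
      by apply: (plop_mono pres) => //; exact: bm_cst.
    rewrite (plf_cst (pres.2 x)) ler_wpM2l ?(ltW Psig)//.
    exact: (res1 pK q01 K_geo).
  have h3 := gPsi x.
  have r0 : 0 <= res g x by apply: (plop_ge0 pres bg) => z; exact: ltW.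
  have h4 : C t / 2 * (a * g x + h * res g x) <= Psi g * (1 + a0).
    rewrite (@le_trans _ _ (1 * (C t / 2 * g x) + 1 * (C t / 2 * res g x)))//; last by lra.
    rewrite mulrDr [_ * (a * _)]mulrCA [_ * (h * _)]mulrCA.
    have gx := ltW (g0 x); have C20 : 0 <= C t / 2 by rewrite divr_ge0.
    by rewrite lerD// ler_wpM2r// mulr_ge0.
  rewrite -(ler_pM2r p1) [leLHS]mulrAC ring_k -[leLHS]mulrA -[leRHS]mulrA.
  by apply: ler_wpM2l; rewrite // mulr_ge0// ltW.
(* Both ends move towards [p] by the fraction [k], so the length is multiplied by [1 - k]. *)
exists (m + k * (p - m)), (M - k * (M - p)); split.
- by rewrite (le_trans mm0)// lerDl mulr_ge0// subr_ge0.
- by rewrite (le_trans _ MM0)// gerBl mulr_ge0// subr_ge0.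
- rewrite (_ : _ - _ = (1 - k) * (M - m)); last by ring.
  have mM : 0 <= M - m by lra.
  rewrite (@le_trans _ _ (expR (- k) * (M - m)))//.
    by rewrite ler_wpM2r// expR_ge1Dx.
  rewrite (@le_trans _ _ (expR (- k) * (rate S * (M0 - m0))))//.
    by rewrite ler_wpM2l// expR_ge0.
  rewrite mulrA ler_wpM2r// /rate -expRD ler_expR -opprD lerN2.
  have r0 : 0 < 4 * res_mean by rewrite mulr_gt0.
  have -> : horizon (S + h) = t + 4 * res_mean * h by rewrite /t /horizon; ring.
  have := I_C (ltW t0) (mulr_ge0 (ltW r0) h0).
  set c1 := _ / (2 * _).
  have c10 : 0 <= c1 by rewrite divr_ge0 ?(ltW c0_gt0)// mulr_ge0// ltW.
  move=> hI; rewrite (_ : k = c1 / (4 * res_mean) * (4 * res_mean * h * C t)); last first.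
    by rewrite /k -/c1; field; rewrite gt_eqF.
  have c1r : 0 <= c1 / (4 * res_mean) by apply: divr_ge0 => //; exact: ltW.
  by rewrite -mulrDr ler_wpM2l//; lra.
- move=> x; have kgx := kg x; apply/andP; split.
  (* The minorisation is applied to the nonnegative function [u - m * g], whose [Psi]-integral is
     [(p - m) * Psi g]; [kg] then converts it into a multiple of the new normalisation. The upper
     end is symmetric, with [M * g - u]. *)
  + have bd : bm (fun x => u x - m * g x) by exact: bmB.
    have d0 y : 0 <= u y - m * g y by rewrite subr_ge0; case/andP: (uMm y).
    have := res_minor x bd d0.
    rewrite (plfB pPsi)// (plfB (pres.2 x))// (plfZ pPsi)// (plfZ (pres.2 x))//.
    rewrite Psiu -mulrBl => /(ler_wpM2l h0) hm.
    have := ler_wpM2l (_ : 0 <= p - m) kgx; rewrite subr_ge0 => /(_ mp) hk.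
    have := d0 x; have ag0 : 0 <= a by lra.
    by move=> /(mulr_ge0 ag0) ha; nra.
  + have bd : bm (fun x => M * g x - u x) by exact: bmB.
    have d0 y : 0 <= M * g y - u y by rewrite subr_ge0; case/andP: (uMm y).
    have := res_minor x bd d0.
    rewrite (plfB pPsi)// (plfB (pres.2 x))// (plfZ pPsi)// (plfZ (pres.2 x))//.
    rewrite Psiu -mulrBl => /(ler_wpM2l h0) hm.
    have := ler_wpM2l (_ : 0 <= M - p) kgx; rewrite subr_ge0 => /(_ pM) hk.
    have := d0 x; have ag0 : 0 <= a by lra.
    by move=> /(mulr_ge0 ag0) ha; nra.
Qed.

End fixed_kernel.
End operator_products.

(** * Eigenfunctionals of the potential: forgetting, uniqueness, existence *)

Section eigenfunctional.
Context d (T : measurableType d) (R : realType).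
Implicit Types (f g : T -> R) (L mu : (T -> R) -> R) (l : seq (R * R)).

Variable A : (T -> R) -> T -> R.
Hypothesis pA : plop A.

Definition sandwich l f m M := forall x,
  m * polyop A l (fun=> 1) x <= polyop A l f x <= M * polyop A l (fun=> 1) x.

Hypothesis contract : forall e : R, 0 < e -> exists S : R,
  forall l, admissible l -> S <= tmass l -> forall f m0 M0, bm f ->
  (forall x, m0 <= f x <= M0) ->
  exists m M, [/\ m0 <= m, M <= M0, M - m <= e * (M0 - m0) & sandwich l f m M].

(** Left eigenvectors of [A] normalised to mass 1. Those given by probability measures are the
    quasi-stationary distributions, by [eigenf_qsd] and [qsd_eigenf]. *)
Record eigenf L : Prop := Eigenf {
  eigenf_plf :> plf L;
  eigenf1 : L (fun=> 1) = 1;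
  eigenf_eq : exists a, forall f, bm f -> L (A f) = a * L f }.

Lemma eigenf_polyop L l : eigenf L -> admissible l ->
  forall f, bm f -> L (polyop A l f) = L (polyop A l (fun=> 1)) * L f.
Proof.
move=> eL vl; have [pL L1 [c Lc]] := eL.
suff [k hk] : exists k, forall f, bm f -> L (polyop A l f) = k * L f.
  by move=> f bf; rewrite !hk ?L1 ?mulr1//; exact: bm_cst.
elim: l vl => [|[a h] l IH] /=; first by exists 1 => f _; rewrite mul1r.
move=> /andP[_ vl]; have [k hk] := IH vl.
exists (a * k + h * (c * k)) => f bf.
have bu := plop_bm (plop_polyop pA vl) bf.
have bAu := plop_bm pA bu.
rewrite (plfD pL) ?(plfZ pL)//; [|exact: bmZ|exact: bmZ].
by rewrite Lc// hk//; ring.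
Qed.

Lemma plf_sandwich mu l f m M : plf mu -> admissible l -> bm f ->
  sandwich l f m M ->
  m * mu (polyop A l (fun=> 1)) <= mu (polyop A l f)
    <= M * mu (polyop A l (fun=> 1)).
Proof.
move=> pmu vl bf h.
have b1 := plop_bm (plop_polyop pA vl) (bm_cst 1).
have bu := plop_bm (plop_polyop pA vl) bf.
rewrite -!(plfZ pmu)//; apply/andP; split.
  by apply: (plf_mono pmu) => //; [exact: bmZ|move=> x; case/andP: (h x)].
by apply: (plf_mono pmu) => //; [exact: bmZ|move=> x; case/andP: (h x)].
Qed.

(** An eigenfunctional of [A] is one of every product, so the ratio of its values at [P f] and [P 1]
    is [L f] itself. *)
Lemma eigenf_sandwich L l f m M : eigenf L -> admissible l -> bm f ->
  sandwich l f m M -> m <= L f <= M.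
Proof.
move=> eL vl bf h; have := plf_sandwich (eigenf_plf eL) vl bf h.
rewrite (eigenf_polyop eL vl bf) [m * _]mulrC [M * _]mulrC.
by have := polyop1_gt0 pA (eigenf_plf eL) (eigenf1 eL) vl => L0; rewrite !ler_pM2l.
Qed.

(** One sandwich interval contains both [L f] and the ratio of [mu (P f)] to [mu (P 1)]. Bounds
    [- B] and [B] have oscillation [2 * B], whence [e / 2]. The estimate is multiplied out because
    [mu] may vanish. *)
Lemma polyop_forget L : eigenf L -> forall e : R, 0 < e -> exists S : R,
  forall l, admissible l -> S <= tmass l -> forall mu f B, plf mu -> bm f ->
  (forall x, `|f x| <= B) ->
  `|mu (polyop A l f) - L f * mu (polyop A l (fun=> 1))|
    <= e * B * mu (polyop A l (fun=> 1)).
Proof.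
move=> eL e e0; have [|S hS] := contract (e := e / 2); first by rewrite divr_gt0.
exists S => l vl Sl mu f B pmu bf fB.
have [x|m [M [_ _ Mm h]]] := hS l vl Sl f (- B) B bf.
  by rewrite -ler_norml.
have /andP[m1 M1] := eigenf_sandwich eL vl bf h.
have /andP[m2 M2] := plf_sandwich pmu vl bf h.
have b1 := plop_bm (plop_polyop pA vl) (bm_cst 1).
have z0 : 0 <= mu (polyop A l (fun=> 1)).
  apply: (plf_ge0 pmu b1) => x; by rewrite (le_trans _ (polyop1_ge x pA vl)).
have Mm' : M - m <= e * B by rewrite (le_trans Mm)//; lra.
have := ler_wpM2r z0 m1; have := ler_wpM2r z0 M1; have := ler_wpM2r z0 Mm'.
rewrite mulrBl ler_norml => *; apply/andP; split; lra.
Qed.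

(** Encodes the [n]-th power of [1 + A], a deterministic product of mass [n]. *)
Definition seqQ n := nseq n ((1, 1) : R * R).

Lemma seqQ_adm n : admissible (seqQ n).
Proof.
elim: n => //= n ->; rewrite lexx ler01 !andbT.
by rewrite ler_pdivrMr// mul1r ler1n.
Qed.

Lemma tmass_seqQ n : tmass (seqQ n) = n%:R.
Proof. by rewrite /tmass big_nseq iter_addr_0. Qed.

Lemma eigenf_unique L L' : eigenf L -> eigenf L' -> forall f, bm f -> L f = L' f.
Proof.
move=> eL eL' f bf; have [B B0 fB] := bm_bound bf.
have p : 0 < 2 * B + 1 by lra.
apply/eqP; rewrite -subr_eq0 -normr_le0; apply/ler_addgt0Pr => e e0.
have [|S hS] := contract (e := e / (2 * B + 1)); first by rewrite divr_gt0.
pose l := seqQ (Num.bound `|S|); have vl : admissible l := seqQ_adm _.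
have Sl : S <= tmass l.
  by rewrite tmass_seqQ (le_trans (ler_norm _))// ltW// archi_boundP.
have [x|m [M [_ _ Mm h]]] := hS l vl Sl f (- B) B bf; first by rewrite -ler_norml.
have /andP[m1 M1] := eigenf_sandwich eL vl bf h.
have /andP[m2 M2] := eigenf_sandwich eL' vl bf h.
have : e / (2 * B + 1) * (B - - B) <= e.
  by rewrite mulrAC ler_pdivrMr// ler_wpM2l ?(ltW e0)//; lra.
by rewrite ler_norml => *; apply/andP; split; lra.
Qed.

Variable Psi : (T -> R) -> R.
Hypothesis pPsi : plf Psi.
Hypothesis Psi1 : Psi (fun=> 1) = 1.

Lemma polyop_cat l l' f : polyop A (l ++ l') f = polyop A l (polyop A l' f).
Proof. by elim: l => [//|ah l IH] /=; rewrite IH. Qed.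

(** Power iteration for [1 + A] started at [Psi] and normalised to mass 1. *)
Definition ratioQ n f := Psi (polyop A (seqQ n) f) / Psi (polyop A (seqQ n) (fun=> 1)).

Definition limQ f := limn (fun n => ratioQ n f).

Lemma plf_ratioQ n : plf (ratioQ n).
Proof.
have h0 : 0 <= (Psi (polyop A (seqQ n) (fun=> 1)))^-1.
  by rewrite invr_ge0 ltW// (polyop1_gt0 pA pPsi Psi1 (seqQ_adm _)).
have := plf_comp (plop_polyop pA (seqQ_adm n)) pPsi.
move=> pP; have := plfDl h0 (lexx 0) pP pP; congr plf.
by apply/funext => f; rewrite mul0r addr0 mulrC.
Qed.

Lemma ratioQ1 n : ratioQ n (fun=> 1) = 1.
Proof. by rewrite /ratioQ divff// gt_eqF// (polyop1_gt0 pA pPsi Psi1 (seqQ_adm _)). Qed.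

(** All later ratios stay in the sandwich interval of the [N] factors applied to [f] first: further
    factors only replace [Psi] by another positive functional. The index [N] does not depend on [f],
    which [limQ_cvg0] exploits. *)
Lemma ratioQ_cauchy (e : R) : 0 < e -> exists N, forall n, (N <= n)%N ->
  forall f B, bm f -> (forall x, `|f x| <= B) ->
  `|ratioQ n f - ratioQ N f| <= e * B.
Proof.
move=> e0; have [|S hS] := contract (e := e / 2); first by rewrite divr_gt0.
exists (Num.bound `|S|) => n Nn f B bf fB; set N := Num.bound _.
have SN : S <= tmass (seqQ N).
  by rewrite tmass_seqQ (le_trans (ler_norm _))// ltW// archi_boundP.
have vN := seqQ_adm N.
have [x|m [M [_ _ Mm h]]] := hS _ vN SN f (- B) B bf; first by rewrite -ler_norml.
have bound k : m <= ratioQ (k + N) f <= M.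
  rewrite /ratioQ /seqQ nseqD !polyop_cat.
  have pP := plf_comp (plop_polyop pA (seqQ_adm k)) pPsi.
  have p0 := polyop1_gt0 pA pPsi Psi1 (seqQ_adm (k + N)).
  rewrite /seqQ nseqD polyop_cat in p0.
  by rewrite ler_pdivrMr// ler_pdivlMr//; exact: (plf_sandwich pP vN bf h).
have := bound 0%N; have := bound (n - N)%N; rewrite add0n subnK//.
move=> /andP[h1 h2] /andP[h3 h4].
by rewrite ler_norml; apply/andP; split; lra.
Qed.

Lemma cvg_ratioQ f : bm f -> ratioQ n f @[n --> \oo] --> limQ f.
Proof.
move=> bf; have [B B0 fB] := bm_bound bf.
apply: dist_cvg => e e0.
have p : 0 < B + 1 by lra.
have [|N hN] := ratioQ_cauchy (e := e / (B + 1)); first by rewrite divr_gt0.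
exists N => n Nn; rewrite (le_trans (hN n Nn f B bf fB))//.
by rewrite mulrAC ler_pdivrMr// ler_wpM2l ?(ltW e0)//; lra.
Qed.

Lemma limQ_ratioQ (e : R) : 0 < e -> exists N, forall f B, bm f ->
  (forall x, `|f x| <= B) -> `|limQ f - ratioQ N f| <= e * B.
Proof.
move=> e0; have [N hN] := ratioQ_cauchy e0; exists N => f B bf fB.
by apply: (cvg_dist_le (n := N) (cvg_ratioQ bf)) => k Nk; exact: hN.
Qed.

Lemma limQE f a : ratioQ n f @[n --> \oo] --> a -> limQ f = a.
Proof. by move/cvg_lim; exact. Qed.

Lemma plf_limQ : plf limQ.
Proof.
split.
- move=> f g bf bg; apply: limQE.
  under eq_fun do rewrite (plfD (plf_ratioQ _) bf bg).
  by apply: cvgD; exact: cvg_ratioQ.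
- move=> a f bf; apply: limQE.
  under eq_fun do rewrite (plfZ (plf_ratioQ _) _ bf).
  by apply: cvgZr; exact: cvg_ratioQ.
- move=> f bf f0; have h := cvg_ratioQ bf.
  rewrite /limQ; apply: limr_ge; first by apply/cvg_ex; exists (limQ f).
  by near=> n; apply: (plf_ge0 (plf_ratioQ n)).
Unshelve. all: by end_near. Qed.

Lemma limQ1 : limQ (fun=> 1) = 1.
Proof. by apply: limQE; under eq_fun do rewrite ratioQ1; exact: cvg_cst. Qed.

(** With [P = 1 + A], the ratio of index [n] at [P f] is the ratio of index [n.+1] at [f] times the
    ratio of index [n] at [P 1]. In the limit this is the eigenvalue equation of [P], hence that of
    [A]. *)
Lemma eigenf_limQ : eigenf limQ.
Proof.
split; [exact: plf_limQ|exact: limQ1|].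
pose P f x := f x + A f x.
have bP f : bm f -> bm (P f) by move=> bf; apply: bmD => //; exact: plop_bm.
have b1 : bm (fun _ : T => 1 : R) by exact: bm_cst.
have QP n f : polyop A (seqQ n) (P f) = polyop A (seqQ n.+1) f.
  rewrite /seqQ -addn1 nseqD polyop_cat/=; congr polyop.
  by apply/funext => x; rewrite !mul1r.
have h f : bm f -> limQ (P f) = limQ f * limQ (P (fun=> 1)).
  move=> bf; apply: limQE.
  have -> : (fun n => ratioQ n (P f)) =
      (fun n => ratioQ n.+1 f * ratioQ n (P (fun=> 1))).
    apply/funext => n; rewrite /ratioQ !QP mulrA divfK//.
    by rewrite gt_eqF// (polyop1_gt0 pA pPsi Psi1 (seqQ_adm _)).
  apply: cvgM; last exact/cvg_ratioQ/bP.
  by rewrite (cvg_shiftS (fun n => ratioQ n f)); exact: cvg_ratioQ.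
have PL f : bm f -> limQ (P f) = limQ f + limQ (A f).
  by move=> bf; rewrite (plfD plf_limQ)//; exact: plop_bm.
exists (limQ (A (fun=> 1))) => f bf.
have := h f bf; rewrite !PL// limQ1; lra.
Qed.

Hypothesis A_cvg0 : forall (f : nat -> T -> R) B, (forall n, bm (f n)) ->
  (forall n x, `|f n x| <= B) -> (forall x, f n x @[n --> \oo] --> (0 : R)) ->
  forall x, A (f n) x @[n --> \oo] --> (0 : R).
Hypothesis Psi_cvg0 : forall (f : nat -> T -> R) B, (forall n, bm (f n)) ->
  (forall n x, `|f n x| <= B) -> (forall x, f n x @[n --> \oo] --> (0 : R)) ->
  Psi (f n) @[n --> \oo] --> (0 : R).

Lemma ratioQ_cvg0 k (f : nat -> T -> R) B : (forall n, bm (f n)) ->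
  (forall n x, `|f n x| <= B) -> (forall x, f n x @[n --> \oo] --> (0 : R)) ->
  ratioQ k (f n) @[n --> \oo] --> (0 : R).
Proof.
move=> bf fB f0.
suff h : Psi (polyop A (seqQ k) (f n)) @[n --> \oo] --> (0 : R).
  have := cvgM h (cvg_cst (Psi (polyop A (seqQ k) (fun=> 1)))^-1).
  by rewrite mul0r; apply.
rewrite /seqQ; suff [B' [hb hB h0]] : exists B', [/\ forall n, bm (polyop A (nseq k (1, 1)) (f n)),
    forall n x, `|polyop A (nseq k (1, 1)) (f n) x| <= B'
    & forall x, polyop A (nseq k (1, 1)) (f n) x @[n --> \oo] --> (0 : R)].
  by have := Psi_cvg0 hb hB h0.
elim: k => [|k [B' [hb hB h0]]] /=; first by exists B.
have hbA n := plop_bm pA (hb n).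
have [a ha0 ha] := bm_bound (plop_bm pA (bm_cst 1)).
exists (B' + a * B'); split.
- by move=> n; apply: bmD; exact: bmZ.
- move=> n x; rewrite !mul1r (le_trans (ler_normD _ _))// lerD//.
  have B'0 : 0 <= B' by exact: le_trans (hB n x).
  apply: (plop_norm pA) => // y; exact: le_trans (ler_norm _) (ha y).
- move=> x; under eq_fun do rewrite !mul1r.
  by have := cvgD (h0 x) (A_cvg0 hb hB h0 x); rewrite addr0; apply.
Qed.

(** Continuity along bounded pointwise convergence holds for each [ratioQ N] and survives the limit,
    because that limit is uniform on bounded sets of functions. This yields the sigma-additivity of
    [limQ]. *)
Lemma limQ_cvg0 (f : nat -> T -> R) B : (forall n, bm (f n)) ->
  (forall n x, `|f n x| <= B) -> (forall x, f n x @[n --> \oo] --> (0 : R)) ->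
  limQ (f n) @[n --> \oo] --> (0 : R).
Proof.
move=> bf fB f0; apply/cvgrPdist_le => e e0.
pose B1 := Num.max B 0; have B10 : 0 < B1 + 1 by rewrite ltr_wpDl// le_max lexx orbT.
have [|N hN] := limQ_ratioQ (e := e / 2 / (B1 + 1)); first by rewrite !divr_gt0.
have /cvgrPdist_le/(_ (e / 2)) := ratioQ_cvg0 N bf fB f0.
case; first by rewrite divr_gt0.
move=> n0 _ hn0; exists n0 => // n /hn0; rewrite !sub0r !normrN => h.
have := hN (f n) (B1 + 1) (bf n); rewrite divfK ?gt_eqF// => /(_ _) h2.
have {}h2 : `|limQ (f n) - ratioQ N (f n)| <= e / 2.
  apply: h2 => x; rewrite (le_trans (fB n x))// (@le_trans _ _ B1) ?lerDl//.
  by rewrite le_max lexx.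
rewrite -[limQ _](subrK (ratioQ N (f n))) (le_trans (ler_normD _ _))//; lra.
Qed.

End eigenfunctional.

(** * From functionals and operators to measures and kernels *)

Section measure_of_functional.
Context d (T : measurableType d) (R : realType).
Variable L : (T -> R) -> R.
Hypothesis pL : plf L.
Hypothesis L1 : L (fun=> 1) = 1.
Hypothesis L_cvg0 : forall (f : nat -> T -> R) B, (forall n, bm (f n)) ->
  (forall n x, `|f n x| <= B) -> (forall x, f n x @[n --> \oo] --> (0 : R)) ->
  L (f n) @[n --> \oo] --> (0 : R).

(** Set to 0 off the measurable sets: [plf] says nothing about [L] there, whereas a measure is
    nonnegative on every set. *)
Let m (A : set T) : \bar R := if `[< measurable A >] then (L \1_A)%:E else 0%E.

Let mE A : measurable A -> m A = (L \1_A)%:E.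
Proof. by move=> mA; rewrite /m asboolT. Qed.

Let m0 : m set0 = 0%E.
Proof.
by rewrite mE// indic0 (_ : cst 0 = fun=> 0)// (plf_cst pL) mul0r.
Qed.

Let m_ge0 A : (0 <= m A)%E.
Proof.
rewrite /m; case: asboolP => // mA; rewrite lee_fin.
by apply: (plf_ge0 pL); [exact: bm_indic|move=> x; rewrite indicE].
Qed.

Let m_sigma : semi_sigma_additive m.
Proof.
move=> F mF tF mUF; rewrite mE//.
have bF n : bm (\1_(F n) : T -> R) by exact: bm_indic.
have bU : bm (\1_(\bigcup_n F n) : T -> R) by exact: bm_indic.
(* The remainder of the disjoint union: at a point of [F k] it is 1 as long as [n <= k] and 0
   afterwards, so it is bounded and tends to 0 pointwise. *)
pose f n x : R := \1_(\bigcup_n F n) x - \sum_(i < n) \1_(F i) x.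
have bf n : bm (f n).
  by apply: bmB => //; exact: (bm_sum (F := fun i => \1_(F i))).
have fE x : (forall n, f n x = 0) \/
    exists k, forall n, f n x = 1 - (k < n)%:R.
  have [[k _ Fkx]|nU] := pselect ((\bigcup_n F n) x).
    right; exists k => n; rewrite /f indicE mem_set; last by exists k.
    congr (_ - _).
    have h i : \1_(F i) x = (i == k)%:R :> R.
      rewrite indicE; have [->|ik] := eqVneq i k; first by rewrite mem_set.
      rewrite memNset// => Fix'; move/trivIsetP : tF => /(_ i k I I ik).
      by move/seteqP => [/(_ x (conj Fix' Fkx))].
    under eq_bigr do rewrite h.
    elim: n => [|n IH]; first by rewrite big_ord0.
    rewrite big_ord_recr/= IH ltnS [(k <= n)%N]leq_eqVlt [k == n]eq_sym.
    by case: (ltngtP n k) => _ /=; rewrite ?add0r ?addr0.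
  left=> n; rewrite /f indicE memNset// big1 ?subr0// => i _.
  by rewrite indicE memNset// => Fix'; apply: nU; exists i.
have := L_cvg0 bf (B := 1).
have fB n x : `|f n x| <= 1.
  case: (fE x) => [->|[k ->]]; first by rewrite normr0.
  by case: (k < n)%N; rewrite ?subrr ?subr0 ?normr0 ?normr1.
move=> /(_ fB); have f0 x : f n x @[n --> \oo] --> (0 : R).
  case: (fE x) => [h|[k h]]; first by under eq_fun do rewrite h; exact: cvg_cst.
  apply/cvgrPdist_le => e e0; exists k.+1 => // n /= kn.
  by rewrite h kn subrr subr0 normr0 ltW.
move=> /(_ f0) Lf.
have -> : (fun n => (\sum_(0 <= i < n) m (F i))%E) =
    EFin \o (fun n => L \1_(\bigcup_n F n) - L (f n)).
  apply/funext => n /=.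
  rewrite (plfB pL)//; last exact: (bm_sum (F := fun i => \1_(F i))).
  rewrite (plf_sum pL (F := fun i => \1_(F i)))// subKr -sumEFin big_mkord.
  by apply: eq_bigr => i _; rewrite mE.
apply: cvg_EFin; first exact: nearW.
by have := cvgB (cvg_cst (L \1_(\bigcup_n F n))) Lf; rewrite subr0; apply.
Qed.

HB.instance Definition _ := isMeasure.Build _ _ _ m m0 m_ge0 m_sigma.

Let mT : m setT = 1%E.
Proof. by rewrite mE// indicT (_ : cst 1 = fun=> 1)// L1. Qed.

HB.instance Definition _ := Measure_isProbability.Build _ _ _ m mT.

Lemma probability_of_functional : exists mu : probability T R,
  forall f, bm f -> (\int[mu]_x f x)%R = L f.
Proof.
exists m => f bf.
have fin : (m setT < +oo)%E by rewrite mT ltry.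
apply: (plf_eq (plf_Rintegral (m := m) fin) pL) => // A mA.
by apply: EFin_inj; rewrite Rintegral_indic// [LHS]mE.
Qed.

End measure_of_functional.

Section kernel_operator.
Context d (T : measurableType d) (R : realType).
Implicit Types (Q : R.-spker T ~> T) (f : T -> R).

Lemma spker_fin Q x : (Q x setT < +oo)%E.
Proof. by rewrite (le_lt_trans (sprob_kernel_le1 _ _))// ltry. Qed.

Lemma plf_kapply Q x : plf (kapply Q ^~ x).
Proof. exact: (plf_Rintegral (m := Q x) (spker_fin Q x)). Qed.

Lemma kapply1_le Q x : kapply Q (fun=> 1) x <= 1.
Proof.
by rewrite -lee_fin /kapply Rintegral1 ?spker_fin// sprob_kernel_le1.
Qed.

Lemma kapply_indic Q A x : measurable A -> (kapply Q \1_A x)%:E = Q x A.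
Proof. by move=> mA; rewrite /kapply Rintegral_indic// spker_fin. Qed.

Lemma plop_kapply Q : plop (kapply Q).
Proof.
split=> [f bf|x]; last exact: plf_kapply.
have [B B0 fB] := bm_bound bf.
have bB : bm (fun x => f x + B) by apply: bmD => //; exact: bm_cst.
have fB0 x : 0 <= f x + B by have := fB x; rewrite ler_norml => /andP[]; lra.
have mk g : bm g -> (forall x, 0 <= g x) -> measurable_fun setT (kapply Q g).
  move=> bg g0; apply: measurableT_comp => //.
  apply: (@measurable_fun_integral_kernel _ _ _ _ _ Q (measurable_kernel Q)
    (EFin \o g)).
  - by move=> z; rewrite lee_fin.
  - by apply/measurable_EFinP; exact: bg.1.
split.
  have -> : kapply Q f = fun x => kapply Q (fun x => f x + B) x - kapply Q (fun=> B) x.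
    apply/funext => x; rewrite (plfD (plf_kapply Q x))//; last exact: bm_cst.
    by rewrite addrK.
  by apply: measurable_funB; apply: mk => //; exact: bm_cst.
exists B => x; rewrite (le_trans (plf_norm (plf_kapply Q x) bf fB))//.
by rewrite ler_piMr// kapply1_le.
Qed.

Lemma kapply_cvg0 Q (f : nat -> T -> R) B : (forall n, bm (f n)) ->
  (forall n x, `|f n x| <= B) -> (forall x, f n x @[n --> \oo] --> (0 : R)) ->
  forall x, kapply Q (f n) x @[n --> \oo] --> (0 : R).
Proof.
move=> bf fB f0 x.
have := bounded_cvg_Rintegral (m := Q x) (spker_fin Q x) bf (bm_cst 0) fB f0.
suff -> : (\int[Q x]_y (fun=> 0) y)%R = 0 by [].
by have := plf_cst (plf_kapply Q x) 0; rewrite mul0r.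
Qed.

Lemma kiter_indic Q n A x : measurable A ->
  kiter Q n x A = (iter n (kapply Q) \1_A x)%:E.
Proof.
move=> mA; elim: n x => [|n IH] x /=.
  by rewrite diracE indicE.
rewrite [LHS](_ : _ = \int[Q x]_y kiter Q n y A)%E//.
rewrite /kapply EFin_Rintegral ?spker_fin//.
  by apply: eq_integral => y _; exact: IH.
by apply: (plop_bm (plop_iter n (plop_kapply Q))); exact: bm_indic.
Qed.

Lemma kapply_kiter Q n f : bm f -> kapply (kiter Q n) f = iter n (kapply Q) f.
Proof.
move=> bf; apply/funext => x.
have p2 := (plop_iter n (plop_kapply Q)).2 x.
apply: (plf_eq (plf_kapply _ x) p2) => // A mA.
by apply: EFin_inj; rewrite kapply_indic// kiter_indic.
Qed.

Lemma nneseries_gt0_ex (u : nat -> \bar R) : (0 < \sum_(1 <= n <oo) u n)%E ->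
  (forall n, 0 <= u n)%E -> exists n, (0 < u n)%E.
Proof.
move=> su u0; apply: contrapT => /forallNP h.
have : (\sum_(1 <= n <oo) u n = 0)%E.
  by apply: eseries0 => n _ _; apply/eqP; rewrite eq_le u0 andbT leNgt; apply/negP.
by move=> su0; rewrite su0 ltxx in su.
Qed.

End kernel_operator.

Section cemetery_operator.
Context d (T : measurableType d) (R : realType) (K : R.-spker T ~> T).
Local Notation Kbar := (cemetery_ker K : R.-spker _ ~> _).

Let bm_Some (f : option T -> R) : bm f -> bm (f \o @Some T).
Proof.
move=> [mf [B fB]]; split; last by exists B => x; exact: fB.
apply: measurableT_comp => //.
by move=> _ A mA; rewrite setTI.
Qed.

Lemma kapply_cemetery (f : option T -> R) x : bm f ->
  kapply Kbar f (Some x) =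
  kapply K (f \o @Some T) x + (1 - kapply K (fun=> 1) x) * f None.
Proof.
have p1 := plf_kapply Kbar (Some x).
have dx : 0 <= 1 - kapply K (fun=> 1) x by rewrite subr_ge0 kapply1_le.
apply: (plf_eq (L2 := fun f => kapply K (f \o @Some T) x +
  (1 - kapply K (fun=> 1) x) * f None)) => //.
  split.
  - move=> g h bg bh; rewrite (_ : _ \o _ = fun y => (g \o @Some T) y + (h \o @Some T) y)//.
    by rewrite (plfD (plf_kapply K x) (bm_Some bg) (bm_Some bh))/=; ring.
  - move=> c g bg; rewrite (_ : _ \o _ = fun y => c * (g \o @Some T) y)//.
    by rewrite (plfZ (plf_kapply K x) _ (bm_Some bg))/=; ring.
  - move=> g bg g0; rewrite addr_ge0// ?mulr_ge0//.
    by apply: (plf_ge0 (plf_kapply K x)); [exact: bm_Some|move=> y; exact: g0].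
move=> A mA; apply: EFin_inj; rewrite kapply_indic// cemetery_kerE EFinD EFinM.
have mS : measurable (@Some T @^-1` A) by exact: mA.
rewrite -[X in (_ + (1 - X) * _)%E](_ : (kapply K (fun=> 1) x)%:E = _); last first.
  by rewrite /kapply Rintegral1// spker_fin.
rewrite -(kapply_indic K x mS); congr (_ + _)%E.
Qed.

Lemma kapply_cemetery_None (f : option T -> R) : bm f -> kapply Kbar f None = f None.
Proof.
have p1 := plf_kapply Kbar None.
apply: (plf_eq p1 (L2 := fun f => f None)) => //.

by move=> A mA; apply: EFin_inj; rewrite kapply_indic//= diracE indicE.
Qed.

(** Absorption by time [n] is the complement of survival. This turns [H2] into the statement that
    some [K ^ n 1] is less than 1 at [x]. *)
Lemma kiter_cemetery n x :
  kiter Kbar n (Some x) [set None] = (1 - iter n (kapply K) (fun=> 1) x)%:E.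
Proof.
have mN : measurable [set None : option T].
  rewrite /measurable/= /option_measurable/= (_ : _ @^-1` _ = set0)//.
  by rewrite -subset0 => y.
rewrite kiter_indic//; congr EFin.
suff [+ _] : iter n (kapply Kbar) \1_[set None] \o @Some T =
    (fun x => 1 - iter n (kapply K) (fun=> 1) x) /\
    iter n (kapply Kbar) \1_[set None] None = 1.
  by move=> /(congr1 (fun f => f x)).
elim: n {x} => [|n [IH1 IH2]] /=.
  split; last by rewrite indicE mem_set.
  by apply/funext => y; rewrite /= indicE memNset// subrr.
have bu : bm (iter n (kapply Kbar) (\1_[set None] : option T -> R)).
  exact/(plop_bm (plop_iter n (plop_kapply Kbar)))/bm_indic.
have b1 : bm (iter n (kapply K) (fun=> 1)).
  exact/(plop_bm (plop_iter n (plop_kapply K)))/bm_cst.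
split; last by rewrite kapply_cemetery_None.
apply/funext => y; rewrite /= kapply_cemetery// IH1 IH2.
rewrite (plfB (plf_kapply K y))//; last exact: bm_cst.
by ring.
Qed.

End cemetery_operator.

(** * The antiderivative of a non-increasing function with infinite integral *)

Section antiderivative.
Variable R : realType.
Variable C : R -> R.
Hypothesis C_ge0 : forall s, 0 <= C s.
Hypothesis C_noninc : nonincreasing_fun C.
Hypothesis C_int : (\int[lebesgue_measure]_(s in `[0%R, +oo[) (C s)%:E)%E = +oo%E.

Definition antider t : R := fine (\int[lebesgue_measure]_(s in `[0%R, t]) (C s)%:E)%E.

Let mC D : measurable D -> measurable_fun D (fun s => (C s)%:E).
Proof.
by move=> mD; apply/measurable_EFinP; exact: nonincreasing_measurable.
Qed.

(** The Boolean covers both [[a, b]], used for finiteness, and []a, b]], used for the increments. *)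
Let itv_le (a b : R) (i : bool) : a <= b ->
  (\int[lebesgue_measure]_(s in [set` Interval (BSide i a) (BRight b)]) (C s)%:E
    <= ((b - a) * C a)%:E)%E.
Proof.
move=> ab.
apply: (@le_trans _ _ (\int[lebesgue_measure]_(s in
    [set` Interval (BSide i a) (BRight b)]) (C a)%:E)%E).
  apply: ge0_le_integral => //.
  - by move=> s _; rewrite lee_fin.
  - exact: mC.
  - move=> s /= sab; rewrite lee_fin C_noninc//.
    by move: sab; rewrite itv_boundlr => /andP[+ _]; case: i; rewrite ?bnd_simp// => /ltW.
rewrite integral_cst//= lebesgue_measure_itv/= lte_fin.
have [ab'|ba] := ltP a b; first by rewrite -EFinB -EFinM mulrC.
by rewrite mule0 lee_fin mulr_ge0// subr_ge0.
Qed.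

Let antiderE t : 0 <= t ->
  (antider t)%:E = (\int[lebesgue_measure]_(s in `[0%R, t]) (C s)%:E)%E.
Proof.
move=> t0; rewrite /antider fineK// ge0_fin_numE.
  by apply: le_lt_trans (itv_le true t0) _; rewrite ltry.
by apply: integral_ge0 => s _; rewrite lee_fin.
Qed.

(** Supplies the hypothesis [I_C] of [polyop_contract]. *)
Lemma antiderD t u : 0 <= t -> 0 <= u ->
  antider (t + u) <= antider t + u * C t.
Proof.
move=> t0 u0; rewrite -lee_fin EFinD !antiderE ?addr_ge0//.
have tu : t <= t + u by rewrite lerDl.
rewrite (@itv_bndbnd_setU _ _ _ (BRight t)) ?bnd_simp//.
rewrite ge0_integral_setU//=.
- by rewrite leeD2l// (le_trans (itv_le false tu))// addrAC subrr add0r.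
- by apply: mC; exact: measurableU.
- by move=> s _; rewrite lee_fin.
- apply/disj_set2P; rewrite -subset0 => s [] /=; rewrite !in_itv/=.
  by move=> /andP[_ st] /andP[ts _]; rewrite ltNge st in ts.
Qed.

Lemma antider_mono t u : 0 <= t -> t <= u -> antider t <= antider u.
Proof.
move=> t0 tu; rewrite -lee_fin !antiderE ?(le_trans t0)//.
apply: ge0_subset_integral => //=.
- exact: mC.
- by move=> s _; rewrite lee_fin.
- by move=> s /=; rewrite !in_itv/= => /andP[-> /le_trans]; exact.
Qed.

Lemma antider_unbounded (B : R) : exists n, forall m, (n <= m)%N -> B <= antider m%:R.
Proof.
have h : (\int[lebesgue_measure]_(s in `[0%R, n%:R]) (C s)%:E)%E @[n --> \oo] -->
    (\int[lebesgue_measure]_(s in \bigcup_n `[0%R, n%:R]%classic) (C s)%:E)%E.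
  apply: ge0_nondecreasing_set_cvg_integral => //.
  - apply/nondecreasing_seqP => n; rewrite subsetEset => s /=; rewrite !in_itv/=.
    by move=> /andP[-> /le_trans]; apply; rewrite ler_nat.
  - by move=> n; exact: mC.
  - by move=> n s _; rewrite lee_fin.
rewrite (_ : \bigcup_n _ = `[0, +oo[%classic) ?C_int in h; last first.
  apply/seteqP; split => s /=.
    by move=> [n _ /=]; rewrite !in_itv/= andbT => /andP[].
  rewrite in_itv/= andbT => s0; exists (Num.bound s) => //=.
  by rewrite in_itv/= s0 ltW// archi_boundP.
have /cvgeyPge/(_ B)[n _ hn] := h.
exists n => m /hn /=; rewrite -antiderE//.
Qed.

End antiderivative.

(** * Compactness, continuity and approximation of open sets *)

Section compact_metric.
Context d (R : realType) (E : borelMetricType d R).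
Hypothesis compactE : compact [set: E].

(** The form in which compactness is used: it makes uniform the pointwise positivity of killing, of
    access to [U] and of survival, as well as continuity. A single integer has to encode all the
    constants at once. *)
Lemma compact_uniform (P : nat -> E -> Prop) :
  (forall n m x, (n <= m)%N -> P n x -> P m x) ->
  (forall x : E, exists n, \forall y \near nbhs x, P n y) -> exists n, forall x, P n x.
Proof.
move=> mP hP.
have h x : [set: E] x -> \forall y \near nbhs x & n \near \oo, P n y.
  move=> _; have [n hn] := hP x.
  exists ([set y | P n y], [set m | (n <= m)%N]) => /=.
    by split => //; exists n.
  by move=> [y m] [/= Py nm]; exact: mP Py.
have [n _ hn] := (compact_near_coveringP [set: E]).1 compactE nat \oo P _ h.
by exists n => x; exact: (hn n (leqnn n)).
Qed.

Lemma continuous_bm (f : E -> R) : continuous f -> bm f.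
Proof.
move=> cf; split.
  apply: (measurability _ (RGenOInfty.measurableE R)) => _ [_ [x ->] <-].
  rewrite setTI measurable_borelE; apply: sub_sigma_algebra.
  have /continuousP := cf; apply; exact: interval_open.
have [|x|n hn] := @compact_uniform (fun n x => `|f x| <= n%:R).
- by move=> n m x nm /le_trans; apply; rewrite ler_nat.
- exists (Num.bound (`|f x| + 1)).
  have /cvgrPdist_le/(_ 1 ltr01) := cf x; apply: filterS => y fxy.
  rewrite ltW// (le_lt_trans _ (archi_boundP _))// ?addr_ge0//.
  rewrite -[f y](subrK (f x)) addrC (le_trans (ler_normD _ _))// lerD2l.
  by rewrite distrC.
- by exists n%:R.
Qed.

Lemma lipschitz_continuous (f : E -> R) (k : R) :
  (forall x y, f x - f y <= k * mdist x y) -> continuous f.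
Proof.
move=> fk x; apply/cvgrPdist_le => e e0.
pose r := e / (`|k| + 1).
have k1 : 0 < `|k| + 1 by rewrite ltr_wpDl.
have r0 : 0 < r by rewrite divr_gt0.
apply: filterS (nbhsx_ballx x r r0) => y; rewrite ballEmdist/= => xy.
have kd : k * mdist x y <= e.
  rewrite (@le_trans _ _ ((`|k| + 1) * r))//; last by rewrite /r mulrC divfK// gt_eqF.
  rewrite (@le_trans _ _ ((`|k| + 1) * mdist x y))//.
    by rewrite ler_wpM2r ?mdist_ge0// (le_trans (ler_norm k))// lerDl.
  by rewrite ler_wpM2l ?(ltW k1)// ltW.
have := fk x y; have := fk y x; rewrite metric_sym => h1 h2.
by rewrite ler_norml; apply/andP; split; lra.
Qed.

Section distance_to_complement.
Variable U : set E.

(** Distance to the complement of [U], capped at 1; the element 1 also keeps the set nonempty when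
    [U] is the whole space. *)
Let D y := inf (1 |` [set mdist y z | z in ~` U]).

Let lbD y : has_lbound (1 |` [set mdist y z | z in ~` U]).
Proof. by exists 0 => _ [->|[z _ <-]]; [exact: ler01|exact: mdist_ge0]. Qed.

Let D_lip x y : D x - D y <= mdist x y.
Proof.
rewrite lerBlDr -lerBlDl; apply: lb_le_inf; first by exists 1; left.
move=> _ [->|[z Uz <-]].
  rewrite lerBlDl (@le_trans _ _ 1) ?lerDr ?mdist_ge0//.
  by apply: ge_inf => //; left.
rewrite lerBlDl (@le_trans _ _ (mdist x z))//; last exact: metric_triangle.
by apply: ge_inf => //; right; exists z.
Qed.

(** The functions [min (1, n * D)] lie below the indicator of [U]. Through them the Feller property,
    which concerns continuous functions, gives lower bounds on hitting probabilities of [U]. *)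
Lemma open_lower_approx : open U -> exists phi : nat -> E -> R,
  [/\ forall n, continuous (phi n), forall n x, 0 <= phi n x <= \1_U x
    & forall x, phi n x @[n --> \oo] --> (\1_U x : R)].
Proof.
move=> oU; have D0 x : 0 <= D x.
  apply: lb_le_inf; first by exists 1; left.
  by move=> _ [->|[z _ <-]]; [exact: ler01|exact: mdist_ge0].
have DU x : U x -> 0 < D x.
  move=> Ux; have := open_nbhs_nbhs (conj oU Ux).
  rewrite -nbhs_ballE => -[e /= e0 eU].
  apply: (@lt_le_trans _ _ (Num.min 1 e)); first by rewrite lt_min ltr01.
  apply: lb_le_inf; first by exists 1; left.
  move=> _ [->|[z Uz <-]]; rewrite ge_min ?lexx//; apply/orP; right.
  by rewrite leNgt; apply/negP => xz; apply: Uz; apply: eU; rewrite ballEmdist.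
have DU0 x : ~ U x -> D x = 0.
  move=> Ux; apply/eqP; rewrite eq_le D0 andbT; apply: ge_inf => //.
  by right; exists x => //; exact: mdistxx.
exists (fun n x => Num.min 1 (n%:R * D x)); split.
- move=> n; apply: (@lipschitz_continuous _ n%:R) => x y.
  have := ler_wpM2l (ler0n R n) (D_lip x y); rewrite mulrBr.
  have := ler_wpM2l (ler0n R n) (mdist_ge0 x y); rewrite mulr0.
  have := lexx (1 : R).
  by case: (leP 1 (n%:R * D x)); case: (leP 1 (n%:R * D y)); lra.
- move=> n x; rewrite le_min ler01 mulr_ge0// ge_min indicE.
  have [Ux|nUx] := pselect (U x); first by rewrite mem_set// lexx.
  by rewrite memNset// DU0// mulr0 lexx orbT.
- move=> x; rewrite indicE; have [Ux|nUx] := pselect (U x); last first.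
    rewrite memNset// DU0//; under eq_fun do rewrite mulr0 min_r//.
    exact: cvg_cst.
  rewrite mem_set//; apply/cvgrPdist_le => e e0.
  exists (Num.bound (D x)^-1) => // n /= hn.
  rewrite min_l ?subrr ?normr0 ?(ltW e0)//.
  rewrite -ler_pdivrMr ?DU// mul1r ltW//.
  by rewrite (lt_le_trans (archi_boundP _)) ?ler_nat// invr_ge0.
Qed.

End distance_to_complement.

End compact_metric.

(** * Uniform constants extracted from the hypotheses on the kernel *)

Section quasi_stationary.
Context d (R : realType) (E : borelMetricType d R).
Hypothesis compactE : compact [set: E].
Variable K : R.-spker E ~> E.
Hypothesis H1 : feller K.
Hypothesis H2 : forall x : E,
  (0 < \sum_(1 <= n <oo) kiter (cemetery_ker K) n (Some x) [set None])%E.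

Local Notation Kop := (kapply K).
Local Notation one := (fun=> 1).

Let pK : plop Kop := plop_kapply K.
Let K1 : forall x, Kop one x <= 1 := kapply1_le K.

Let b n := sup (range (kapply (kiter K n) (cst 1))).

Let b_ub n : has_ubound (range (kapply (kiter K n) (cst 1))).
Proof. by exists 1 => _ [x _ <-]; exact: kapply1_le. Qed.

Let K_b n x : iter n Kop one x <= b n.
Proof.
rewrite -kapply_kiter; last exact: bm_cst.
by apply: ub_le_sup => //; exists x.
Qed.

Let iter1_ge0 n x : 0 <= iter n Kop one x.
Proof. by apply: (plop_ge0 (plop_iter n pK)) => //; exact: bm_cst. Qed.

Let bm_iter1 n : bm (iter n Kop one).
Proof. exact/(plop_bm (plop_iter n pK))/bm_cst. Qed.

Let iter1_le n m x : (n <= m)%N -> iter m Kop one x <= iter n Kop one x.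
Proof.
move=> nm; rewrite -(subnKC nm) iterD.
apply: (plop_mono (plop_iter n pK)) => //; first exact: bm_cst.
move=> y; rewrite -kapply_kiter; last exact: bm_cst.
exact: kapply1_le.
Qed.

Let b_le n B (x0 : E) : (forall x, iter n Kop one x <= B) -> b n <= B.
Proof.
move=> h; apply: ge_sup; first by exists (kapply (kiter K n) (cst 1) x0); exists x0.
by move=> _ [x _ <-]; rewrite kapply_kiter//; exact: bm_cst.
Qed.

Let cont_iter n f : continuous f -> continuous (iter n Kop f).
Proof. by move=> cf; elim: n => //= n IH; exact: H1. Qed.

(** The integer [n] serves as the time and, through its inverse, as the gap; survival decreases in
    time, so the property is monotone in [n]. *)
Let uniform_death : exists n, forall x, iter n Kop one x <= 1 - n.+1%:R^-1.
Proof.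
apply: (compact_uniform compactE) => [n m x nm h|x].
  rewrite (le_trans (iter1_le x nm))// (le_trans h)// lerD2l lerN2.
  by rewrite lef_pV2 ?posrE// ler_nat ltnS.
have [n|n] := nneseries_gt0_ex (H2 x); first exact: measure_ge0.
rewrite kiter_cemetery lte_fin subr_gt0 => en.
(* Half of the gap at [x] is given up to continuity; the other half remains on a neighbourhood. *)
have [e e2] : exists e, 1 - iter n Kop one x = 2 * e.
  by exists ((1 - iter n Kop one x) / 2); field.
have e0 : 0 < e by lra.
exists (maxn n (Num.bound e^-1)).
have c1 : continuous (one : E -> R) by move=> y; exact: cvg_cst.
have /cvgrPdist_le/(_ _ e0) := @cont_iter n _ c1 x.
apply: filterS => y; rewrite ler_norml => /andP[h _].
have {}h : - e <= iter n Kop one x - iter n Kop one y := h.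
rewrite (le_trans (iter1_le y (leq_maxl _ _)))//.
have : (maxn n (Num.bound e^-1)).+1%:R^-1 <= e.
  rewrite -[leRHS]invrK lef_pV2 ?posrE ?invr_gt0//.
  have hb : e^-1 < (Num.bound e^-1)%:R by rewrite archi_boundP// invr_ge0 ltW.
  by rewrite ltW// (lt_le_trans hb)// ler_nat ltnW// ltnS leq_maxr.
by set r := _^-1; move: h e2; lra.
Qed.

Lemma kernel_decay (x0 : E) : exists c q, [/\ 0 <= q < 1,
  forall n m, b (n + m)%N <= b n * b m & forall n, b n <= c * q ^+ n].
Proof.
have b_ge0 n : 0 <= b n by exact: le_trans (iter1_ge0 n x0) (K_b n x0).
have bD n m : b (n + m)%N <= b n * b m.
  apply: (b_le x0) => x; rewrite iterD.
  have h : iter n Kop (iter m Kop one) x <= iter n Kop (fun=> b m) x.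
    by apply: (plop_mono (plop_iter n pK)) => //; exact: bm_cst.
  rewrite (le_trans h)// (plf_cst ((plop_iter n pK).2 x)) mulrC.
  by rewrite ler_wpM2r.
have b1 n : b n <= 1.
  by apply: (b_le x0) => x; exact: (iter1_le x (leq0n n)).
have [n hn] := uniform_death.
have {hn} : b n <= 1 - n.+1%:R^-1 by exact: (b_le x0).
set r := 1 - _ => bn.
have r1 : r < 1 by rewrite /r gtrBl invr_gt0.
have r0 : 0 <= r by exact: le_trans (b_ge0 n) bn.
(* [b (n * k) <= r ^ k], so some iterate has norm at most [1 / 2]. *)
have [N0 bN0] : exists N, b N <= 1 / 2.
  have r01 : 0 <= r < 1 by rewrite r0.
  have h2 : 0 < 1 / 2 :> R by rewrite divr_gt0.
  have [k hk] := geometric_small 1 r01 h2.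
  exists (n * k)%N; apply: le_trans (hk k (leqnn k)); rewrite mul1r.
  elim: k {hk} => [|k IH]; first by rewrite muln0.
  by rewrite mulnS exprS (le_trans (bD _ _))// ler_pM.
(* A positive exponent, since [N] is about to be a divisor. *)
pose N := N0.+1.
have bN : b N <= 1 / 2.
  by rewrite /N -addn1 (le_trans (bD _ _))// -[leRHS]mulr1 ler_pM.
have N_gt0 : 0 < N%:R :> R by rewrite ltr0n.
(* By Bernoulli's inequality [q ^+ N >= 1 / 2 >= b N]; no root has to be extracted. *)
pose q := 1 - (2 * N%:R)^-1 : R.
have i1 : 0 < (2 * N%:R)^-1 :> R by rewrite invr_gt0 mulr_gt0.
have i2 : (2 * N%:R)^-1 <= 1 / 2 :> R.
  by rewrite invfM mul1r ler_piMr// invf_le1// ler1n.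
have q01 : 0 <= q < 1 by apply/andP; split; rewrite /q; lra.
have /andP[q0 q1] := q01.
have qN : 1 / 2 <= q ^+ N.
  have bern k : 1 - k%:R * (2 * N%:R)^-1 <= q ^+ k.
    elim: k => [|k IH]; first by rewrite mul0r subr0 expr0.
    have h := ler_wpM2l q0 IH; rewrite exprS (le_trans _ h)//.
    have k0 : 0 <= k%:R * (2 * N%:R)^-1 :> R by rewrite mulr_ge0// ltW.
    rewrite /q -natr1; have := mulr_ge0 (ltW i1) k0; lra.
  apply: le_trans (bern N); rewrite invfM mulrA mulrAC divff ?gt_eqF// mul1r.
  lra.
(* The constant 2 covers the indices [m < N], where [b m <= 1 <= 2 * q ^+ N <= 2 * q ^+ m]; beyond,
   each block of [N] steps gains a factor [q ^+ N]. *)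
exists 2, q; split => //; elim/ltn_ind => m IH.
have [mN|Nm] := ltnP m N.
  have h : q ^+ N <= q ^+ m by rewrite ler_wiXn2l ?(ltW q1)// ltnW.
  rewrite (le_trans (b1 m))//; lra.
rewrite -(subnKC Nm) (le_trans (bD _ _))// exprD.
have hm : (m - N < m)%N by rewrite ltn_subrL (leq_trans _ Nm).
have h := IH _ hm.
rewrite (@le_trans _ _ (1 / 2 * (2 * q ^+ (m - N))))//; first by rewrite ler_pM.
by rewrite mulrCA ler_wpM2l// ler_wpM2r// exprn_ge0.
Qed.

Variable (U : set E) (Psi : probability E R).
Hypotheses (U_open : open U) (U_acc : accessible K U)
  (U_small : weak_small_set K U Psi).

Local Notation PsiL := (fun f : E -> R => (\int[Psi]_x f x)%R).

Let Psi_fin : (Psi setT < +oo)%E.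
Proof. by rewrite probability_setT ltry. Qed.

Let pPsi : plf PsiL := plf_Rintegral Psi_fin.

Let Psi1 : PsiL one = 1.
Proof. by apply: EFin_inj; rewrite (Rintegral1 Psi_fin); exact: probability_setT. Qed.

Let mU : measurable U.
Proof. by rewrite measurable_borelE; exact: sub_sigma_algebra. Qed.

(** Again one integer bounds both the time and the inverse of the mass. Including time 0 in the sum
    is harmless for a lower bound. *)
Let uniform_access : exists n, forall x,
  n.+1%:R^-1 <= \sum_(k < n.+1) iter k Kop \1_U x.
Proof.
have U0 k x : 0 <= iter k Kop \1_U x.
  by apply: (plop_ge0 (plop_iter k pK)); [exact: bm_indic|move=> y; rewrite indicE].
apply: (compact_uniform compactE) => [n m x nm h|x].
  rewrite (@le_trans _ _ n.+1%:R^-1)//.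
    by rewrite lef_pV2 ?posrE// ler_nat ltnS.
  rewrite (le_trans h)// -!(big_mkord xpredT (fun k => iter k Kop \1_U x)).
  by rewrite [leRHS](big_cat_nat _ (nm : (n.+1 <= m.+1)%N))//= lerDl sumr_ge0.
have [n|m] := nneseries_gt0_ex (U_acc x); first exact: measure_ge0.
rewrite kiter_indic// lte_fin => hm.
have [phi [cphi phiU phi_cvg]] := open_lower_approx U_open.
have bphi n : bm (phi n) by exact: continuous_bm.
have bU : bm (\1_U : E -> R) by exact: bm_indic.
(* Dominated convergence: if [U] is charged at time [m] from [x], so is some continuous minorant of
   its indicator, and that charge is continuous in the starting point. *)
have [n hn] : exists n, 0 < iter m Kop (phi n) x.
  apply: contrapT => /forallNP h.
  have c0 : iter m Kop (fun y => \1_U y - phi n y) x @[n --> \oo] --> (0 : R).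
    have eqk f : bm f -> iter m Kop f x = kapply (kiter K m) f x.
      by move=> bf; rewrite kapply_kiter.
    have eqn n : iter m Kop (fun y => \1_U y - phi n y) x =
        kapply (kiter K m) (fun y => \1_U y - phi n y) x by apply: eqk; exact: bmB.
    under eq_fun do rewrite eqn.
    apply: (@kapply_cvg0 _ _ _ (kiter K m) (fun n y => \1_U y - phi n y) 1).
    - by move=> n; exact: bmB.
    - move=> n y; have /andP[p0 pU] := phiU n y.
      have : \1_U y <= 1 :> R by rewrite indicE lern1 leq_b1.
      by move=> ?; rewrite ger0_norm; lra.
    - move=> y; have := cvgB (cvg_cst (\1_U y : R)) (phi_cvg y).
      by rewrite subrr; apply.
  have /cvgrPdist_lt/(_ _ hm)[n _ /(_ n (leqnn n))] := c0.
  rewrite sub0r normrN (plfB ((plop_iter m pK).2 x))//.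
  have := U0 m x; have := h n => /negP; rewrite -leNgt => *.
  by have := ler_norm (iter m Kop \1_U x - iter m Kop (phi n) x); lra.
have [e e2] : exists e, iter m Kop (phi n) x = 2 * e.
  by exists (iter m Kop (phi n) x / 2); field.
have e0 : 0 < e by lra.
have /cvgrPdist_le/(_ _ e0) H := @cont_iter m _ (cphi n) x.
exists (maxn m (Num.bound e^-1)).
move: H; apply: filterS => y; rewrite ler_norml => /andP[_ h].
have {}h : iter m Kop (phi n) x - iter m Kop (phi n) y <= e := h.
have h1 : iter m Kop (phi n) y <= iter m Kop \1_U y.
  by apply: (plop_mono (plop_iter m pK)) => // z; case/andP: (phiU n z).
have h2 : iter m Kop \1_U y <= \sum_(k < (maxn m (Num.bound e^-1)).+1) iter k Kop \1_U y.
  have mm : (m < (maxn m (Num.bound e^-1)).+1)%N by rewrite ltnS leq_maxl.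
  by rewrite (bigD1 (Ordinal mm))//= lerDl sumr_ge0.
have : (maxn m (Num.bound e^-1)).+1%:R^-1 <= e.
  rewrite -[leRHS]invrK lef_pV2 ?posrE ?invr_gt0//.
  have hb : e^-1 < (Num.bound e^-1)%:R by rewrite archi_boundP// invr_ge0 ltW.
  by rewrite ltW// (lt_le_trans hb)// ler_nat ltnW// ltnS leq_maxr.
by set r := _^-1; move: h e2; lra.
Qed.


(** On [U] the small set property gives [A f >= eps * Psi f]. Elsewhere [A f >= K ^ k (A f) >= eps *
    Psi f * K ^ k \1_U], since [A f] is excessive, and these bounds are summed over [k <= n]. *)
Lemma kernel_minor c q : 0 <= q < 1 ->
  (forall n x, iter n Kop one x <= c * q ^+ n) ->
  exists2 c0 : R, 0 < c0 & forall f x, bm f -> (forall x, 0 <= f x) ->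
    c0 * PsiL f <= res Kop f x.
Proof.
move=> q01 K_geo; have pres := plop_res pK q01 K_geo.
have [eps eps0 small] := U_small.
have smallL f x : U x -> bm f -> (forall x, 0 <= f x) -> eps * PsiL f <= res Kop f x.
  move=> Ux bf f0.
  have p1 : plf (fun f => eps * PsiL f).
    have := plfDl (ltW eps0) (lexx 0) pPsi pPsi; congr plf.
    by apply/funext => g; rewrite mul0r addr0.
  apply: (plf_le p1 (pres.2 x)) => // A mA.
  have bA : bm (\1_A : E -> R) by exact: bm_indic.
  rewrite -lee_fin EFinM Rintegral_indic//.
  apply: le_trans (small x Ux A mA) _.
  apply: lime_le; first by apply: is_cvg_nneseries => n _ _; exact: measure_ge0.
  apply: nearW => n.
  have A0 k : 0 <= iter k Kop \1_A x.
    by apply: (plop_ge0 (plop_iter k pK)) => // y; rewrite indicE.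
  (* The small set condition sums from 1 and the potential from 0; the additional term is
     nonnegative. *)
  rewrite (@le_trans _ _ (\sum_(0 <= k < n) kiter K k x A)%E)//.
    case: n => [|n]; first by rewrite !big_geq.
    by rewrite [leRHS]big_nat_recl// [leLHS]big_add1/= leeDr// measure_ge0.
  rewrite big_mkord; under eq_bigr do rewrite kiter_indic//.
  rewrite sumEFin lee_fin.
  have mono k : (n <= k)%N -> Apart Kop n \1_A x <= Apart Kop k \1_A x.
    move=> nk; rewrite /Apart -!(big_mkord xpredT (fun k => iter k Kop \1_A x)).
    by rewrite [leRHS](big_cat_nat _ nk)//= lerDl sumr_ge0.
  have hc := cvg_Apart (x := x) pK q01 K_geo bA.
  rewrite -(cvg_lim _ hc)//; apply: limr_ge; first by apply/cvg_ex; exists (res Kop \1_A x).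
  by exists n => // k; exact: mono.
have [n hn] := uniform_access.
have n0 : 0 < n.+1%:R :> R by rewrite ltr0n.
(* One factor [n.+1] counts the summed bounds, the other comes from [uniform_access]. *)
exists (eps / n.+1%:R ^+ 2); first by rewrite divr_gt0// exprn_gt0.
move=> f x bf f0; have br := plop_bm pres bf.
have bU : bm (\1_U : E -> R) by exact: bm_indic.
have P0 : 0 <= eps * PsiL f by rewrite mulr_ge0 ?(ltW eps0)//; exact: (plf_ge0 pPsi).
have step k : eps * PsiL f * iter k Kop \1_U x <= res Kop f x.
  apply: le_trans (iterK_res_le pK K1 q01 K_geo k x bf f0).
  rewrite -(plfZ ((plop_iter k pK).2 x))//.
  apply: (plop_mono (plop_iter k pK)) => //; first exact: bmZ.
  move=> y; rewrite indicE; have [Uy|nUy] := pselect (U y).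
    by rewrite mem_set// mulr1; exact: smallL.
  by rewrite memNset// mulr0; exact: (plop_ge0 pres).
have : eps * PsiL f * n.+1%:R^-1 <= n.+1%:R * res Kop f x.
  apply: (@le_trans _ _ (eps * PsiL f * \sum_(k < n.+1) iter k Kop \1_U x)).
    by rewrite ler_wpM2l.
  rewrite mulr_sumr mulr_natl -[X in _ *+ X](card_ord n.+1) -sumr_const.
  by apply: ler_sum => k _; exact: step.
move=> h; rewrite -(ler_pM2l n0); apply: le_trans h.
rewrite le_eqVlt; apply/orP; left; apply/eqP.
by field; rewrite gt_eqF.
Qed.

Variable C : R -> R.
Hypothesis C_ge0 : {in `[0, +oo[, forall s, 0 <= C s}.
Hypothesis C_noninc : {in `[0, +oo[ &, nonincreasing_fun C}.
Hypothesis C_int : (\int[lebesgue_measure]_(s in `[0%R, +oo[) (C s)%:E)%E = +oo%E.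
Hypothesis H4 : forall n : nat,
  C n%:R <= (\int[Psi]_x kapply (kiter K n) (cst 1) x) /
            sup (range (kapply (kiter K n) (cst 1))).

Lemma kernel_contract (x0 : E) : exists c q, [/\ 0 <= q < 1,
  forall n x, iter n Kop one x <= c * q ^+ n &
  forall e : R, 0 < e -> exists S : R,
  forall l, admissible l -> S <= tmass l -> forall f m0 M0, bm f ->
  (forall x, m0 <= f x <= M0) ->
  exists m M, [/\ m0 <= m, M <= M0, M - m <= e * (M0 - m0)
    & sandwich (res Kop) l f m M]].
Proof.
have [c [q [q01 bD b_geo]]] := kernel_decay x0.
have K_geo n x : iter n Kop one x <= c * q ^+ n by exact: le_trans (K_b n x) _.
exists c, q; split=> // e e0.
have [c0 c0_gt0 minor] := kernel_minor q01 K_geo.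
have b_ge0 n : 0 <= b n by exact: le_trans (iter1_ge0 n x0) (K_b n x0).
(* Extended by the value at 0 to negative arguments, so that sign and monotonicity hold on the whole
   line. *)
pose C' s := C (Num.max s 0).
have in0 (s : R) : Num.max s 0 \in `[0, +oo[.
  have : 0 <= Num.max s 0 by rewrite le_max lexx orbT.
  by rewrite in_itv/= => ->.
have C'_ge0 s : 0 <= C' s by exact: C_ge0.
have C'_ni : nonincreasing_fun C'.
  move=> s t st; apply: C_noninc => //.
  by rewrite ge_max !le_max lexx st !orbT.
have C'E s : 0 <= s -> C' s = C s by move=> s0; rewrite /C' max_l.
have C'_int : (\int[lebesgue_measure]_(s in `[0%R, +oo[) (C' s)%:E)%E = +oo%E.
  rewrite -C_int; apply: eq_integral => s; rewrite inE/= in_itv/= andbT => s0.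
  by rewrite C'E.
have C'_Psi n : C' n%:R * b n <= PsiL (iter n Kop one).
  rewrite C'E//; have := H4 n.
  rewrite (_ : kapply (kiter K n) (cst 1) = iter n Kop one); last first.
    by rewrite -kapply_kiter//; exact: bm_cst.
  have P0 : 0 <= PsiL (iter n Kop one) by exact: (plf_ge0 pPsi).
  (* For [b n = 0] the quotient in [H4] is a division by zero, but the multiplied-out inequality is
     then trivial. *)
  have [bn0|bn0] := eqVneq (b n) 0; first by rewrite bn0 mulr0.
  have bn : 0 < b n by rewrite lt_def bn0 b_ge0.
  have bE : b n = sup (range (iter n Kop one)).
    by rewrite /b kapply_kiter//; exact: bm_cst.
  by rewrite -ler_pdivlMr// bE.
have contr := polyop_contract pK q01 b_ge0 bD b_geo K_b pPsi Psi1
  (fun s _ => C'_ge0 s) (fun s t h => C'_ni s t (proj2 (andP h))) C'_Psi x0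
  c0_gt0 minor (antiderD C'_ge0 C'_ni).
have rm0 : 0 < res_mean c q.
  have c1 : 0 < c.
    apply: (@lt_le_trans _ _ 1) => //.
    by have := K_geo 0%N x0; rewrite expr0 mulr1.
  by rewrite divr_gt0// exprn_gt0// subr_gt0; case/andP: q01.
have a0 : 0 <= res_norm c q.
  apply: le_trans (res1 pK q01 K_geo x0).
  by apply: (plop_ge0 (plop_res pK q01 K_geo)) => //; exact: bm_cst.
have k0 : 0 < c0 / (2 * (1 + res_norm c q)) / (4 * res_mean c q).
  have d1 : 0 < 2 * (1 + res_norm c q) by rewrite mulr_gt0// ltr_pwDl.
  have d2 : 0 < 4 * res_mean c q by rewrite mulr_gt0.
  exact: divr_gt0 (divr_gt0 c0_gt0 d1) d2.
set k := _ / (4 * _) in k0.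
(* Since [expR x >= x], an increase of the antiderivative by [e^-1 / k] already brings the rate
   below [e]. Mass [n / (4 * res_mean)] pushes the horizon beyond [n]. *)
have [n hn] := antider_unbounded C'_ge0 C'_ni C'_int (antider C' 1 + e^-1 / k).
exists (n%:R / (4 * res_mean c q)) => l vl Sl f m0 M0 bf fb.
have [m [M [h1 h2 h3 h4]]] := contr l f m0 M0 vl bf fb.
exists m, M; split => //; apply: le_trans h3 _.
have mM : 0 <= M0 - m0 by have /andP[] := fb x0; lra.
apply: ler_wpM2r => //; rewrite /rate -/k.
have hz : n%:R <= horizon c q (tmass l).
  have : n%:R <= tmass l * (4 * res_mean c q) by rewrite -ler_pdivrMr// mulr_gt0.
  by rewrite /horizon mulrC; lra.
have hA : antider C' 1 + e^-1 / k <= antider C' (horizon c q (tmass l)).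
  by apply: le_trans (hn n (leqnn n)) _; apply: antider_mono.
have hk : e^-1 <= k * (antider C' (horizon c q (tmass l)) - antider C' 1).
  rewrite mulrC -ler_pdivrMr//; lra.
rewrite expRN -[leRHS]invrK lef_pV2 ?posrE ?expR_gt0 ?invr_gt0//.
by apply: le_trans hk (le_trans _ (expR_ge1Dx _)); rewrite lerDr.
Qed.

End quasi_stationary.

(** * The reinforced process *)

Section occupation_functional.
Context d (T : measurableType d) (R : realType).
Variable eta : nat -> {posnum R}.
Implicit Types (x : nat -> T) (f : T -> R).

Local Notation gamma := (step_size eta).

Definition occ x n f : R :=
  (weight eta n)^-1 * \sum_(k < n.+1) (eta k)%:num * f (x k).

Lemma step_size_gt0 n : 0 < gamma n.
Proof. by rewrite divr_gt0// weight_gt0. Qed.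

Lemma plf_occ x n : plf (occ x n).
Proof.
have w0 := weightV_ge0 eta n; split.
- move=> f g _ _; rewrite /occ -mulrDr -big_split/=; congr (_ * _).
  by apply: eq_bigr => k _; rewrite mulrDr.
- move=> c f _; rewrite /occ [RHS]mulrCA; congr (_ * _); rewrite mulr_sumr.
  by apply: eq_bigr => k _; rewrite mulrCA.
- by move=> f _ f0; rewrite mulr_ge0// sumr_ge0// => k _; rewrite mulr_ge0.
Qed.

Lemma occ1 x n : occ x n (fun=> 1) = 1.
Proof.
rewrite /occ; under eq_bigr do rewrite mulr1.
by rewrite mulVf// gt_eqF// weight_gt0.
Qed.

Lemma occS x n f : occ x n.+1 f =
  occ x n f + gamma n.+1 * (f (x n.+1) - occ x n f).
Proof.
have w1 := weight_gt0 eta n.+1; have w0 := weight_gt0 eta n.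
have wS : weight eta n.+1 = weight eta n + (eta n.+1)%:num by rewrite /weight big_ord_recr.
rewrite /occ big_ord_recr/= /step_size; set s := \sum_(_ < _) _.
have -> : weight eta n = weight eta n.+1 - (eta n.+1)%:num by rewrite wS addrK.
by field; rewrite !gt_eqF//= wS addrK.
Qed.

Lemma weighted_occupationE x n f : bm f ->
  (\int[weighted_occupation eta x n]_y f y)%R = occ x n f.
Proof.
have fin : (weighted_occupation eta x n setT < +oo)%E.
  by rewrite probability_setT ltry.
apply: (plf_eq (plf_Rintegral fin) (plf_occ x n)) => A mA.
apply: EFin_inj; rewrite Rintegral_indic//.
rewrite [LHS](_ : _ = (((weight eta n)^-1)%:E *
  \sum_(k < n.+1) ((eta k)%:num)%:E * \d_(x k) A)%E)// /occ EFinM -sumEFin.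
by congr (_ * _)%E; apply: eq_bigr => k _; rewrite diracE indicE.
Qed.

End occupation_functional.

Lemma restartE d (T : measurableType d) (R : realType) (K : R.-spker T ~> T)
    (mu : probability T R) y A : measurable A ->
  restart K mu y A = (kapply K \1_A y
    + (1 - kapply K (fun=> 1) y) * (\int[mu]_z \1_A z)%R)%:E.
Proof.
move=> mA; have fm : (mu setT < +oo)%E by rewrite probability_setT ltry.
rewrite EFinD EFinM kapply_indic// (Rintegral_indic fm mA).
rewrite [LHS]measure_addE; congr (_ + _)%E.
rewrite [LHS](_ : _ = (1 - fine (K y setT))%:E * mu A)%E//; congr ((_ - _)%:E * _)%E.
by apply: EFin_inj; rewrite fineK ?Rintegral1 ?spker_fin// ge0_fin_numE ?spker_fin.
Qed.

(** From [expR x <= (1 - x)^-1] and [(1 - x) * (1 + x + 2 * x ^+ 2) = 1 + x ^+ 2 * (1 - 2 * x)]. *)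
Lemma expR_le_quadratic (R : realType) (x : R) : `|x| <= 1 / 2 ->
  expR x <= 1 + x + 2 * x ^+ 2.
Proof.
rewrite ler_norml => /andP[xl xu].
have h : 1 - x <= expR (- x) by exact: expR_ge1Dx.
have x1 : 0 < 1 - x by lra.
have : expR x <= (1 - x)^-1.
  by rewrite -[x]opprK expRN opprK lef_pV2 ?posrE ?expR_gt0.
move/le_trans; apply; rewrite -[leLHS]mul1r ler_pdivrMr//.
have : 0 <= x ^+ 2 * (1 - 2 * x) by rewrite mulr_ge0 ?sqr_ge0//; lra.
by lra.
Qed.

(** * Martingale increments and their concentration over blocks *)

Section adapted_process.
Context (R : realType) d (E : measurableType d) (K : R.-spker E ~> E).
Variable eta : nat -> {posnum R}.
Context d' (Omega : measurableType d') (P : probability Omega R).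
Variables (F : nat -> set (set Omega)) (X : nat -> Omega -> E).
Hypothesis filtrationF : filtration F.
Hypothesis adaptedX : adapted F X.
Hypothesis transitionX : forall n A, measurable A ->
  is_cond_prob P (F n) (X n.+1 @^-1` A)
    (fun w => restart K (weighted_occupation eta (X ^~ w) n) (X n w) A).

Local Notation gamma := (step_size eta).
Local Notation Kop := (kapply K).
Local Notation one := (fun=> 1).

Let Fmeasurable n (B : set (g_sigma_algebraType (F n))) :
  measurable B <-> F n B.
Proof.
case: filtrationF => sF _ _; split=> [|FB]; last exact: sub_sigma_algebra.
by apply; split => //; exact: sF.
Qed.

(** Bounded [F n]-measurable variables, written as [bm] over a copy of [Omega] carrying [F n], so
    that the lemmas on functionals apply with [F n] as sigma-field. *)
Definition bmF n (f : Omega -> R) := bm (f : g_sigma_algebraType (F n) -> R).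

Lemma bmF_bm n f : bmF n f -> bm f.
Proof.
move=> [mf bf]; split=> // _ A mA; rewrite setTI.
case: filtrationF => _ + _; apply; apply/(@Fmeasurable n).
by have := mf measurableT A mA; rewrite setTI.
Qed.

Lemma bmF_le n m f : (n <= m)%N -> bmF n f -> bmF m f.
Proof.
move=> nm; have Fnm B : F n B -> F m B.
  elim: m nm => [|m IH]; first by rewrite leqn0 => /eqP ->.
  rewrite leq_eqVlt => /predU1P[->//|]; rewrite ltnS => /IH{}IH /IH.
  by case: filtrationF => _ _; apply.
move=> [mf bf]; split=> // _ A mA; rewrite setTI.
apply/Fmeasurable/Fnm/Fmeasurable.
by have := mf measurableT A mA; rewrite setTI.
Qed.

Lemma bmF_X n k f : (k <= n)%N -> bm f -> bmF n (fun w => f (X k w)).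
Proof.
move=> kn bf; apply: (bmF_le kn).
case: bf => mf [B fB]; split; last by exists B => w; exact: fB.
move=> _ A mA; rewrite setTI; apply/Fmeasurable.
rewrite (_ : _ @^-1` A = X k @^-1` (f @^-1` A))//; apply: adaptedX.
by have := mf measurableT A mA; rewrite setTI.
Qed.

(** The conditional expectation of [g (X n.+1)] given [F n]; accordingly [mdiff] is a martingale
    increment. *)
Definition drift n g w : R :=
  Kop g (X n w) + (1 - Kop one (X n w)) * occ eta (X ^~ w) n g.

Definition mdiff n g w : R := g (X n.+1 w) - drift n g w.

Lemma bmF_occ n g : bm g -> bmF n (fun w => occ eta (X ^~ w) n g).
Proof.
move=> bg; apply: bmZ.
have h i : bmF n (fun w => (eta i)%:num * (if (i <= n)%N then g (X i w) else 0)).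
  by apply: bmZ; case ni : (i <= n)%N; [exact: bmF_X|exact: bm_cst].
have := bm_sum n.+1 h; congr bm; apply/funext => w.
by apply: eq_bigr => i _; rewrite -ltnS ltn_ord.
Qed.

Lemma bmF_drift n g : bm g -> bmF n (drift n g).
Proof.
move=> bg; have bK : bm (Kop g) := plop_bm (plop_kapply K) bg.
have b1 : bm (Kop one) := plop_bm (plop_kapply K) (bm_cst 1).
apply: bmD; first exact: bmF_X.
apply: bmM; last exact: bmF_occ.
apply: bmB; [exact: bm_cst|exact: bmF_X].
Qed.

Lemma bmF_mdiff n m g : (n < m)%N -> bm g -> bmF m (mdiff n g).
Proof.
move=> nm bg; apply: bmB; first exact: bmF_X.
exact/(bmF_le (ltnW nm))/bmF_drift.
Qed.

Lemma plf_drift n w : plf (drift n ^~ w).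
Proof.
have := plfDl ler01 (_ : 0 <= 1 - Kop one (X n w)) (plf_kapply K (X n w))
  (plf_occ eta (X ^~ w) n).
rewrite subr_ge0 kapply1_le => /(_ isT); congr plf.
by apply/funext => g; rewrite mul1r.
Qed.

Lemma drift1 n w : drift n one w = 1.
Proof. by rewrite /drift occ1 mulr1 addrC subrK. Qed.

Lemma mdiff_le n g B w : bm g -> (forall x, `|g x| <= B) -> `|mdiff n g w| <= 2 * B.
Proof.
move=> bg gB; rewrite (le_trans (ler_normB _ _))// mulr2n mulrDl mul1r lerD//.
by rewrite (le_trans (plf_norm (plf_drift n w) bg gB))// drift1 mulr1.
Qed.

Let P_fin : (P setT < +oo)%E. Proof. by rewrite probability_setT ltry. Qed.

Let plfP : plf (fun f : Omega -> R => (\int[P]_w f w)%R) := plf_Rintegral P_fin.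

(** As functionals of [G] over the sigma-field [F n], both sides are positive and linear; [plf_eq]
    reduces to the indicator of a set of [F n], where the claim is the defining identity of
    conditional probability. *)
Let expect_indic n (A : set E) (G : Omega -> R) : measurable A -> bmF n G ->
  (\int[P]_w (G w * \1_A (X n.+1 w)))%R = (\int[P]_w (G w * drift n \1_A w))%R.
Proof.
move=> mA bG; have bA : bm (\1_A : E -> R) by exact: bm_indic.
have bX : bm (fun w => \1_A (X n.+1 w) : R) by exact: (bmF_bm (bmF_X (leqnn _) bA)).
have bD : bm (drift n \1_A) by exact: bmF_bm (bmF_drift n bA).
have plfM (h : Omega -> R) : bm h -> (forall w, 0 <= h w) ->
    plf (fun G : g_sigma_algebraType (F n) -> R => (\int[P]_w (G w * h w))%R).
  move=> bh h0; split.
  - move=> f g bf bg; rewrite -(plfD plfP); [|exact: bmM (bmF_bm bf) bh|exact: bmM (bmF_bm bg) bh].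
    by congr Rintegral; apply/funext => w; rewrite mulrDl.
  - move=> c f bf; rewrite -(plfZ plfP); last exact: bmM (bmF_bm bf) bh.
    by congr Rintegral; apply/funext => w; rewrite mulrA.
  - move=> f bf f0; apply: (plf_ge0 plfP); first exact: bmM (bmF_bm bf) bh.
    by move=> w; rewrite mulr_ge0.
have A0 x : 0 <= \1_A x :> R by rewrite indicE.
apply: (plf_eq (plfM _ bX (fun w => A0 _)) (plfM _ bD _)) => // [w|B mB].
  by apply: (plf_ge0 (plf_drift n w)).
have FB : F n B by exact/Fmeasurable.
have [_ Fm _] := filtrationF.
have mB' : measurable (B : set Omega) := Fm n _ FB.
have bB : bm (\1_B : Omega -> R) by exact: bm_indic.
have [_ hP] := transitionX n mA; have {hP} := hP B FB.
have mX : measurable (X n.+1 @^-1` A).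
  exact: Fm n.+1 _ (adaptedX _ mA).
move=> hP; apply: EFin_inj.
rewrite (EFin_Rintegral P_fin (bmM bB bX)) (EFin_Rintegral P_fin (bmM bB bD)).
transitivity (P (X n.+1 @^-1` A `&` B)).
  rewrite -(Rintegral_indic P_fin); last exact: measurableI.
  rewrite (EFin_Rintegral P_fin); last exact/bm_indic/measurableI.
  apply: eq_integral => w _; congr EFin; rewrite indicI /= mulrC; congr (_ * _).
rewrite -hP [LHS]integral_mkcond; apply: eq_integral => w _.
rewrite patchE restartE// weighted_occupationE// indicE.
by case: ifPn; rewrite ?mul1r ?mul0r.
Qed.

(** The same extension, now in the variable [g]; nonnegativity of [G] is what makes both sides
    positive functionals of [g]. *)
Lemma expect_step n (G : Omega -> R) g : bmF n G -> (forall w, 0 <= G w) -> bm g ->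
  (\int[P]_w (G w * mdiff n g w))%R = 0.
Proof.
move=> bG G0 bg; have bG' := bmF_bm bG.
have bX h : bm h -> bm (fun w => h (X n.+1 w) : R).
  by move=> bh; exact: (bmF_bm (bmF_X (leqnn _) bh)).
have bD h : bm h -> bm (drift n h) by move=> bh; exact: bmF_bm (bmF_drift n bh).
have p1 : plf (fun h => (\int[P]_w (G w * h (X n.+1 w)))%R).
  split.
  - move=> f h bf bh; rewrite -(plfD plfP); [|exact: bmM bG' (bX _ bf)|exact: bmM bG' (bX _ bh)].
    by congr Rintegral; apply/funext => w; rewrite mulrDr.
  - move=> c f bf; rewrite -(plfZ plfP); last exact: bmM bG' (bX _ bf).
    by congr Rintegral; apply/funext => w; rewrite mulrCA.
  - move=> f bf f0; apply: (plf_ge0 plfP); first exact: bmM bG' (bX _ bf).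
    by move=> w; rewrite mulr_ge0.
have p2 : plf (fun h => (\int[P]_w (G w * drift n h w))%R).
  split.
  - move=> f h bf bh; rewrite -(plfD plfP); [|exact: bmM bG' (bD _ bf)|exact: bmM bG' (bD _ bh)].
    by congr Rintegral; apply/funext => w; rewrite (plfD (plf_drift n w))// mulrDr.
  - move=> c f bf; rewrite -(plfZ plfP); last exact: bmM bG' (bD _ bf).
    by congr Rintegral; apply/funext => w; rewrite (plfZ (plf_drift n w))// mulrCA.
  - move=> f bf f0; apply: (plf_ge0 plfP); first exact: bmM bG' (bD _ bf).
    by move=> w; rewrite mulr_ge0// (plf_ge0 (plf_drift n w)).
have := plf_eq p1 p2 (fun A mA => expect_indic mA bG) bg.
move=> /eqP; rewrite -subr_eq0 -(plfB plfP); [|by apply: bmM; auto..].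
move=> /eqP <-; congr Rintegral; apply/funext => w.
by rewrite /mdiff mulrBr.
Qed.

Lemma mdiffN n g w : bm g -> mdiff n (fun x => - g x) w = - mdiff n g w.
Proof. by move=> bg; rewrite /mdiff (plfN (plf_drift n w))//; ring. Qed.

Definition noise p q g w : R := \sum_(p <= i < q) gamma i * mdiff i g w.

Lemma noiseN p q g w : bm g -> noise p q (fun x => - g x) w = - noise p q g w.
Proof.
move=> bg; rewrite /noise -sumrN; apply: eq_bigr => i _.
by rewrite mdiffN// mulrN.
Qed.

Lemma bmF_noise p q g : bm g -> bmF q (noise p q g).
Proof.
move=> bg; elim: q => [|q IH].
  have := bm_cst 0 : bmF 0 _; congr bmF; apply/funext => w.
  by rewrite /noise big_geq.
have [pq|qp] := leqP p q; last first.
  have := bm_cst 0 : bmF q.+1 _; congr bmF; apply/funext => w.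
  by rewrite /noise big_geq.
have := bmD (bmF_le (leqnSn q) IH) (bmZ (gamma q) (bmF_mdiff (ltnSn q) bg)).
by congr bmF; apply/funext => w; rewrite /noise big_nat_recr.
Qed.

Let bmF_expR n f : bmF n f -> bmF n (fun w => expR (f w)).
Proof.
move=> [mf [B fB]]; split; first exact: measurableT_comp.
exists (expR B) => w; rewrite ger0_norm ?expR_ge0// ler_expR.
exact: le_trans (ler_norm _) (fB w).
Qed.

(** Azuma's induction on the last increment: its exponential is at most [1 + x + 2 * s ^+ 2], the
    linear term has zero mean given the past, and [1 + 2 * s ^+ 2 <= expR (2 * s ^+ 2)]. The
    increments of [g] are bounded by [2 * B]. *)
Lemma mgf_noise g B lam p q : bm g -> (forall x, `|g x| <= B) -> 0 <= lam ->
  (forall i, (p <= i < q)%N -> lam * gamma i * (2 * B) <= 1 / 2) -> (p <= q)%N ->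
  (\int[P]_w expR (lam * noise p q g w))%R
    <= expR (\sum_(p <= i < q) 2 * (lam * gamma i * (2 * B)) ^+ 2).
Proof.
move=> bg gB lam0 + pq; rewrite -(subnKC pq); elim: (q - p)%N => [_|n IH hlam].
  rewrite addn0 big_geq// expR0.
  suff -> : (fun w => expR (lam * noise p p g w)) = one.
    have -> : (\int[P]_w one w)%R = 1 by apply: EFin_inj; rewrite (Rintegral1 P_fin); exact: probability_setT.
    by [].
  by apply/funext => w; rewrite /noise big_geq// mulr0 expR0.
have {}IH := IH _; move: IH; set m := (p + n)%N => IH.
have pm : (p <= m)%N by exact: leq_addr.
have {}IH : (\int[P]_w expR (lam * noise p m g w))%R
    <= expR (\sum_(p <= i < m) 2 * (lam * gamma i * (2 * B)) ^+ 2).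
  apply: IH => i /andP[pi im]; apply: hlam.
  by rewrite pi addnS ltnS ltnW.
have hm : lam * gamma m * (2 * B) <= 1 / 2.
  by apply: hlam; rewrite pm addnS ltnSn.
rewrite addnS -/m big_nat_recr//= expRD.
set s := lam * gamma m * (2 * B) in hm *.
pose G w := expR (lam * noise p m g w).
have bG : bmF m G by apply: bmF_expR; apply: bmZ; exact: bmF_noise.
have bD : bm (mdiff m g) by exact: bmF_bm (bmF_mdiff (ltnSn m) bg).
have lg0 : 0 <= lam * gamma m by rewrite mulr_ge0// ltW// step_size_gt0.
have G0 w : 0 <= G w by exact: expR_ge0.
have bG' := bmF_bm bG.
have bGD : bm (fun w => G w * mdiff m g w) by exact: bmM.
apply: (@le_trans _ _ (\int[P]_w ((1 + 2 * s ^+ 2) * G w +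
    lam * gamma m * (G w * mdiff m g w)))%R).
  apply: (plf_mono plfP).
  - apply: (@bmF_bm m.+1); apply: bmF_expR; apply: bmZ; exact: bmF_noise.
  - by apply: bmD; exact: bmZ.
  - move=> w; rewrite /noise big_nat_recr//= -/(noise p m g w) mulrDr expRD -/(G w).
    set x := lam * (_ * _).
    have xs : `|x| <= s.
      rewrite /x mulrA normrM (ger0_norm lg0) ler_wpM2l//; exact: mdiff_le.
    have := expR_le_quadratic (le_trans xs hm).
    have x2 : x ^+ 2 <= s ^+ 2.
      rewrite -real_normK ?num_real// ler_sqr// nnegrE//.
      exact: le_trans (normr_ge0 x) xs.
    move=> hx; have {}hx : expR x <= 1 + 2 * s ^+ 2 + x by lra.
    have := ler_wpM2l (G0 w) hx.
    have -> : lam * gamma m * (G w * mdiff m g w) = G w * x by rewrite /x; ring.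
    by lra.
rewrite (plfD plfP); [|exact: bmZ|exact: bmZ].
rewrite (plfZ plfP)// (plfZ plfP)// expect_step// mulr0 addr0 mulrC.
have I0 : 0 <= (\int[P]_w G w)%R by apply: (plf_ge0 plfP).
by rewrite ler_pM// ?expR_ge1Dx// addr_ge0// mulr_ge0// sqr_ge0.
Qed.

Lemma chernoff_noise g B lam p q e : bm g -> (forall x, `|g x| <= B) -> 0 <= lam ->
  (forall i, (p <= i < q)%N -> lam * gamma i * (2 * B) <= 1 / 2) -> (p <= q)%N ->
  (P [set w | (e <= noise p q g w)%R] <= (expR (- (lam * e)
    + \sum_(p <= i < q) 2 * (lam * gamma i * (2 * B)) ^+ 2))%:E)%E.
Proof.
move=> bg gB lam0 hlam pq; have bY := bmF_bm (bmF_noise p q bg).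
have mA : measurable [set w | e <= noise p q g w].
  have := bY.1 measurableT `[e, +oo[%classic (measurable_itv _).
  by rewrite setTI preimage_itvcy.
rewrite -(Rintegral_indic P_fin mA) lee_fin expRD.
apply: (@le_trans _ _ (\int[P]_w (expR (- (lam * e)) * expR (lam * noise p q g w)))%R).
  have bE : bm (fun w => expR (lam * noise p q g w)).
    by apply: (@bmF_bm q); apply: bmF_expR; apply: bmZ; exact: bmF_noise.
  apply: (plf_mono plfP); [exact: bm_indic|exact: bmZ|].
  move=> w; rewrite indicE -expRD; have [ew|ew] := leP e (noise p q g w).
    rewrite mem_set//= -expR0 ler_expR addrC -mulrBr mulr_ge0//.
    by rewrite subr_ge0.
  by rewrite memNset ?expR_ge0//=; apply/negP; rewrite -ltNge.
rewrite (plfZ plfP); last first.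
  by apply: (@bmF_bm q); apply: bmF_expR; apply: bmZ; exact: bmF_noise.
by rewrite ler_wpM2l ?expR_ge0// mgf_noise.
Qed.

Hypothesis step_noninc : nonincreasing_seq gamma.
Hypothesis step_ln : gamma n * ln n%:R @[n --> \oo] --> (0 : R).

(** Chernoff's bound with [lam = t / gamma p]: as the steps decrease, [lam * gamma i <= t] on the
    whole block. The quadratic terms use up at most half of [lam * e], which leaves [t * e / 2] for
    [k]. *)
Lemma block_noise_le g Dl e : bm g -> 0 <= Dl -> 0 < e ->
  exists2 k : R, 0 < k & forall p q, (p <= q)%N ->
  \sum_(p <= i < q) gamma i <= Dl ->
  (P [set w | (e <= `|noise p q g w|)%R] <= (2 * expR (- (k / gamma p)))%:E)%E.
Proof.
move=> bg Dl0 e0; have [B B0 gB] := bm_bound bg.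
(* The first bound is the range of [expR_le_quadratic]; in the second, [8 * B ^+ 2] is
   [2 * (2 * B) ^+ 2]. *)
have [t [t0 tB tD]] : exists t : R, [/\ 0 < t, t * (2 * B) <= 1 / 2
    & t * (8 * B ^+ 2 * Dl) <= e / 2].
  have d1 : 0 < 2 * (2 * B + 1) by lra.
  have D0 : 0 <= 8 * B ^+ 2 * Dl by rewrite mulr_ge0// mulr_ge0// sqr_ge0.
  have d2 : 0 < 2 * (8 * B ^+ 2 * Dl + 1) by rewrite mulr_gt0// ltr_wpDl.
  exists (Num.min (2 * (2 * B + 1))^-1 (e / (2 * (8 * B ^+ 2 * Dl + 1)))); split.
  - by rewrite lt_min invr_gt0 d1 divr_gt0.
  - apply: (@le_trans _ _ ((2 * (2 * B + 1))^-1 * (2 * B))).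
      by rewrite ler_wpM2r ?ge_min ?lexx// mulr_ge0.
    by rewrite mulrC ler_pdivrMr//; lra.
  - apply: (@le_trans _ _ (e / (2 * (8 * B ^+ 2 * Dl + 1)) * (8 * B ^+ 2 * Dl))).
      by rewrite ler_wpM2r// ge_min lexx orbT.
    rewrite mulrAC ler_pdivrMr//.
    by have := mulr_ge0 (ltW e0) D0; lra.
exists (t * e / 2); first by rewrite divr_gt0// mulr_gt0.
move=> p q pq GD.
have gp := step_size_gt0 eta p.
have lam0 : 0 <= t / gamma p by rewrite divr_ge0// ltW.
have hg i : (p <= i < q)%N -> t / gamma p * gamma i <= t.
  move=> /andP[pi _]; rewrite mulrAC ler_pdivrMr// ler_wpM2l ?(ltW t0)//.
  exact: step_noninc.
have hlam i : (p <= i < q)%N -> t / gamma p * gamma i * (2 * B) <= 1 / 2.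
  by move=> /hg h; rewrite (le_trans _ tB)// ler_wpM2r// mulr_ge0.
have hsum : \sum_(p <= i < q) 2 * (t / gamma p * gamma i * (2 * B)) ^+ 2
    <= t / gamma p * (e / 2).
  apply: (@le_trans _ _ (\sum_(p <= i < q) t / gamma p * (t * (8 * B ^+ 2)) * gamma i)).
    rewrite !big_nat; apply: ler_sum => i /hg h.
    have gi := ltW (step_size_gt0 eta i).
    have x0 : 0 <= t / gamma p * gamma i by rewrite mulr_ge0.
    have B2 : 0 <= 8 * B ^+ 2 by rewrite mulr_ge0// sqr_ge0.
    rewrite (_ : 2 * _ ^+ 2 = (t / gamma p * gamma i) * (8 * B ^+ 2) * (t / gamma p * gamma i)); last by ring.
    rewrite (_ : t / gamma p * (t * (8 * B ^+ 2)) * gamma i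
      = t * (8 * B ^+ 2) * (t / gamma p * gamma i)); last by ring.
    by rewrite ler_wpM2r// ler_wpM2r.
  rewrite -mulr_sumr -[leLHS]mulrA; apply: ler_wpM2l => //; apply: le_trans tD.
  rewrite -[leLHS]mulrA; apply: ler_wpM2l; first exact: ltW.
  by apply: ler_wpM2l => //; rewrite mulr_ge0// sqr_ge0.
have tail h : bm h -> (forall x, `|h x| <= B) ->
    (P [set w | (e <= noise p q h w)%R] <= (expR (- (t * e / 2 / gamma p)))%:E)%E.
  move=> bh hB; have := chernoff_noise e bh hB lam0 hlam pq; move/le_trans; apply.
  rewrite lee_fin ler_expR.
  rewrite (_ : t * e / 2 / gamma p = t / gamma p * e - t / gamma p * (e / 2)); last by field; rewrite gt_eqF.
  by rewrite opprB addrC lerD2r.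
have bng := bmN bg.
have hng x : `|- g x| <= B by rewrite normrN.
have mA h : bm h -> measurable [set w | e <= noise p q h w].
  move=> bh; have bY := bmF_bm (bmF_noise p q bh).
  have := bY.1 measurableT `[e, +oo[%classic (measurable_itv _).
  by rewrite setTI preimage_itvcy.
have -> : [set w | e <= `|noise p q g w|] =
    [set w | e <= noise p q g w] `|` [set w | e <= noise p q (fun x => - g x) w].
  apply/seteqP; split=> w /=; rewrite noiseN// ler_normr.
    by move=> /orP[]; [left|right].
  by move=> [->|->]; rewrite ?orbT.
rewrite (le_trans (measureU2 _ (mA _ bg) (mA _ bng)))//.
rewrite mulr2n mulrDl mul1r EFinD leeD//; exact: tail.
Qed.

Let sum_inv_sq n : \sum_(k < n) (k.+1%:R ^- 2 : R) <= 2.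
Proof.
case: n => [|n]; first by rewrite big_ord0.
suff : \sum_(k < n.+1) (k.+1%:R ^- 2 : R) <= 2 - n.+1%:R^-1.
  by move/le_trans; apply; rewrite gerBl.
elim: n => [|n IH]; first by rewrite big_ord1 expr1n invr1; lra.
rewrite big_ord_recr/= (le_trans (lerD IH (lexx _)))//.
have n1 : 0 < n.+1%:R :> R by rewrite ltr0n.
have n2 : n.+2%:R = n.+1%:R + 1 :> R by rewrite -natr1.
have n20 : 0 < n.+2%:R :> R by rewrite ltr0n.
have h : (n.+2%:R ^- 2 : R) <= (n.+1%:R * n.+2%:R)^-1.
  by rewrite lef_pV2 ?posrE ?exprn_gt0 ?mulr_gt0// expr2 ler_wpM2r ?(ltW n20)// n2 lerDl.
have e : (n.+1%:R * n.+2%:R)^-1 = n.+1%:R^-1 - n.+2%:R^-1 :> R.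
  have h' (a : R) : 0 < a -> (a * (a + 1))^-1 = a^-1 - (a + 1)^-1.
    by move=> a0; field; apply/andP; split; rewrite gt_eqF//; lra.
  by rewrite n2 h'.
rewrite e in h; move: h.
move: (n.+2%:R ^- 2) (n.+1%:R^-1) (n.+2%:R^-1) => x y z; lra.
Qed.

(** Borel-Cantelli: once [gamma p * ln p <= c / 2], the bound [expR (- (c / gamma p))] is at most
    [p ^ -2], which is summable because the [k]-th block starts at [p >= k]. *)
Lemma noise_block_ae g (pb qb : nat -> nat) Dl : bm g ->
  (forall k, (k <= pb k)%N) -> (forall k, (pb k <= qb k)%N) ->
  (forall k, \sum_(pb k <= i < qb k) gamma i <= Dl) ->
  {ae P, forall w, noise (pb k) (qb k) g w @[k --> \oo] --> (0 : R)}.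
Proof.
move=> bg kpb pqb hDl.
have Dl0 : 0 <= Dl.
  by apply: le_trans (hDl 0%N); apply: sumr_ge0 => i _; exact/ltW/step_size_gt0.
have ev e : 0 < e -> {ae P, forall w, exists n, forall k, (n <= k)%N ->
    `|noise (pb k) (qb k) g w| < e}.
  move=> e0; have [c c0 hc] := block_noise_le bg Dl0 e0.
  pose A k := [set w | e <= `|noise (pb k) (qb k) g w|].
  have mA k : measurable (A k).
    have [mY _] := bmF_bm (bmF_noise (pb k) (qb k) bg).
    have mN : measurable_fun setT (fun w => `|noise (pb k) (qb k) g w|).
      exact: measurableT_comp.
    have := mN measurableT `[e, +oo[%classic (measurable_itv _).
    by rewrite setTI preimage_itvcy.
  have [M M0 hM] : exists2 M : R, 0 <= M &
      forall k, (P (A k) <= (M * k.+1%:R ^- 2)%:E)%E.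
    have /cvgrPdist_le/(_ (c / 2)) := step_ln.
    case; first by rewrite divr_gt0.
    (* For [k > N], two tails and [k.+1 <= 2 * p] give [2 * 4 = 8]; for [k <= N] the term
       [N.+1 ^+ 2] makes the bound exceed 1. *)
    move=> N _ hN; exists (8 + N.+1%:R ^+ 2) => [|k].
      by rewrite addr_ge0// sqr_ge0.
    have k1 : 0 < k.+1%:R ^- 2 :> R by rewrite invr_gt0 exprn_gt0// ltr0n.
    have [Nk|kN] := leqP N.+1 k; last first.
      apply: (@le_trans _ _ 1%E); first exact: probability_le1.
      rewrite lee_fin ler_pdivlMr ?exprn_gt0 ?ltr0n// mul1r.
      apply: (@le_trans _ _ (N.+1%:R ^+ 2)); last by rewrite lerDr.
      by rewrite ler_sqr ?nnegrE ?ler0n// ler_nat.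
    apply: le_trans (hc _ _ (pqb k) (hDl k)) _; rewrite lee_fin.
    set p := pb k; have pk : (k <= p)%N := kpb k.
    have gp := step_size_gt0 eta p.
    have k0 : (0 < k)%N by exact: leq_trans Nk.
    have p0 : 0 < p%:R :> R by rewrite ltr0n (leq_trans k0).
    have hp : gamma p * ln p%:R <= c / 2.
      have := hN p (leq_trans (ltnW Nk) pk); rewrite sub0r normrN.
      exact: le_trans (ler_norm _).
    have hln : 2 * ln p%:R <= c / gamma p by rewrite ler_pdivlMr//; lra.
    have h1 : expR (- (c / gamma p)) <= p%:R ^- 2.
      rewrite (@le_trans _ _ (expR (- (2 * ln p%:R))))//.
        by rewrite ler_expR lerN2.
      by rewrite expRN expRM_natl lnK// posrE.
    have h2 : (p%:R ^- 2 : R) <= 4 * k.+1%:R ^- 2.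
      rewrite ler_pdivlMr ?exprn_gt0 ?ltr0n// mulrC ler_pdivrMr ?exprn_gt0//.
      rewrite (_ : 4 * p%:R ^+ 2 = (2 * p%:R) ^+ 2); last by ring.
      rewrite ler_sqr ?nnegrE ?ler0n ?mulr_ge0// -natrM ler_nat.
      by rewrite mul2n -addnn -addn1 leq_add// (leq_trans k0).
    have N0 : 0 <= N.+1%:R ^+ 2 :> R by exact: sqr_ge0.
    move: (le_trans h1 h2) (mulr_ge0 N0 (ltW k1)); rewrite [(8 + _) * _]mulrDl.
    set x := expR _; set y := N.+1%:R ^+ 2 * _; set z := k.+1%:R ^- 2.
    by lra.
  have Psum : (\sum_(0 <= k <oo) P (A k) < +oo)%E.
    apply: (@le_lt_trans _ _ (M * 2)%:E); last exact: ltry.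
    apply: lime_le; first by apply: is_cvg_nneseries => k _ _; exact: measure_ge0.
    apply: nearW => n; apply: (@le_trans _ _ (\sum_(0 <= k < n) (M * k.+1%:R ^- 2)%:E)%E).
      by apply: lee_sum => k _; exact: hM.
    rewrite sumEFin lee_fin -mulr_sumr ler_wpM2l// big_mkord.
    exact: sum_inv_sq.
  have P0 := lim_sup_set_cvg0 mA Psum.
  exists (lim_sup_set A); split => //.
    apply: bigcapT_measurable => n; apply: bigcup_measurable => k _; exact: mA.
  move=> w /= hw n _ ; apply: contrapT => hn; apply: hw.
  exists n => k nk; rewrite ltNge; apply/negP => ek; apply: hn.
  by exists k.
(* Countably many thresholds suffice, so the exceptional sets can be united. *)
have {ev} : {ae P, forall w, forall r, exists n, forall k, (n <= k)%N ->
    `|noise (pb k) (qb k) g w| < r.+1%:R^-1}.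
  by apply/ae_foralln => r; apply: ev; rewrite invr_gt0.
apply: filterS => w h; apply/cvgrPdist_le => e e0.
have [n hn] := h (Num.bound e^-1); exists n => // k /= /hn hk.
rewrite sub0r normrN ltW// (lt_le_trans hk)//.
rewrite -[leRHS]invrK lef_pV2 ?posrE ?invr_gt0//.
have hb : e^-1 < (Num.bound e^-1)%:R by rewrite archi_boundP// invr_ge0 ltW.
by rewrite ltW// (lt_le_trans hb)// ler_nat.
Qed.

End adapted_process.

(** * Summation by parts, choice of the blocks, uniform vanishing over products *)

Section abel.
Variable R : realType.

Lemma abel_le (gamma u : nat -> R) U p q : nonincreasing_seq gamma ->
  (forall n, 0 <= gamma n) -> (forall n, `|u n| <= U) -> (p <= q)%N ->
  `|\sum_(p <= i < q) gamma i * (u i - u i.+1)| <= 2 * gamma p * U.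
Proof.
move=> g_ni g0 uU pq.
(* Keeping the boundary term makes the estimate inductive: a further index adds
   [(gamma m - gamma m.+1) * u m.+1] up to sign, and these coefficients telescope. *)
have h : `|\sum_(p <= i < q) gamma i * (u i - u i.+1) + gamma q * u q|
    <= (2 * gamma p - gamma q) * U.
  rewrite -(subnKC pq); elim: (q - p)%N => [|n IH].
    rewrite addn0 big_geq// add0r normrM ger0_norm//.
    rewrite (_ : 2 * gamma p - gamma p = gamma p); last by ring.
    by rewrite ler_wpM2l.
  rewrite addnS big_nat_recr ?leq_addr//=; set m := (p + n)%N in IH *.
  have d0 : 0 <= gamma m - gamma m.+1 by rewrite subr_ge0 g_ni.
  have -> : \sum_(p <= i < m) gamma i * (u i - u i.+1) + gamma m * (u m - u m.+1)
      + gamma m.+1 * u m.+1 = (\sum_(p <= i < m) gamma i * (u i - u i.+1) + gamma m * u m)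
      - (gamma m - gamma m.+1) * u m.+1 by ring.
  rewrite (le_trans (ler_normB _ _))//.
  rewrite normrM (ger0_norm d0); have := ler_wpM2l d0 (uU m.+1); lra.
have : `|gamma q * u q| <= gamma q * U.
  by rewrite normrM ger0_norm// ler_wpM2l.
move=> h2; rewrite -[X in `|X|](addrK (gamma q * u q)).
rewrite (le_trans (ler_normB _ _))//; lra.
Qed.

End abel.

Section blocks.
Variables (R : realType) (gamma : nat -> R).
Hypothesis gamma_gt0 : forall n, 0 < gamma n.
Hypothesis gamma_sum : (\sum_(0 <= n <oo) (gamma n)%:E)%E = +oo%E.
Hypothesis gamma_cvg : gamma n @[n --> \oo] --> (0 : R).

(** The least endpoint that reaches [dl] overshoots by less than its last step, which is at most
    [dl] beyond [n0]. *)
Lemma block_step_ex (dl : R) : 0 < dl -> exists n0, forall n, (n0 <= n)%N ->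
  exists2 m, (n < m)%N & dl <= \sum_(n.+1 <= i < m.+1) gamma i <= 2 * dl.
Proof.
move=> dl0; have /cvgrPdist_le/(_ _ dl0)[n0 _ hn0] := gamma_cvg.
exists n0 => n n0n.
have [m hm] : exists m, dl <= \sum_(n.+1 <= i < m.+1) gamma i.
  apply: contrapT => /forallNP h.
  suff : (\sum_(0 <= k <oo) (gamma k)%:E <= (\sum_(0 <= i < n.+1) gamma i + dl)%:E)%E.
    by rewrite gamma_sum leye_eq.
  apply: lime_le.
    by apply: is_cvg_nneseries => k _ _; rewrite lee_fin ltW.
  apply: nearW => m; rewrite sumEFin lee_fin.
  have mono j k : (j <= k)%N -> \sum_(0 <= i < j) gamma i <= \sum_(0 <= i < k) gamma i.
    move=> jk; rewrite [leRHS](big_cat_nat _ jk)//= lerDl sumr_ge0// => i _.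
    exact: ltW.
  apply: le_trans (mono m (n + m).+1 _) _; first by rewrite leqW// leq_addl.
  rewrite (big_cat_nat _ (_ : n.+1 <= (n + m).+1)%N)//=; last by rewrite ltnS leq_addr.
  by rewrite lerD2l ltW// ltNge; apply/negP/h.
pose Q m := dl <= \sum_(n.+1 <= i < m.+1) gamma i.
have exQ : exists m, Q m by exists m.
case: (ex_minnP exQ) => k Qk kmin.
have nk : (n < k)%N.
  rewrite ltnNge; apply/negP => kn; move: Qk; rewrite /Q big_geq ?ltnS//.
  by rewrite leNgt dl0.
exists k => //; apply/andP; split; first exact: Qk.
case: k Qk kmin nk => // k Qk kmin nk.
rewrite big_nat_recr//=.
have h1 : \sum_(n.+1 <= i < k.+1) gamma i <= dl.
  rewrite leNgt; apply/negP => h; have := kmin k; rewrite /Q (ltW h) => /(_ isT).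
  by rewrite ltnn.
have h2 : gamma k.+1 <= dl.
  have := hn0 k.+1; rewrite /= sub0r normrN => /(_ _).
  by rewrite ger0_norm ?(ltW (gamma_gt0 _))//; apply; exact: leq_trans n0n (ltnW nk).
by rewrite mulr2n mulrDl mul1r lerD.
Qed.

Lemma blocks_ex (dl : R) : 0 < dl -> exists nb : nat -> nat,
  [/\ forall k, (k <= nb k)%N, forall k, (nb k < nb k.+1)%N &
   forall k, dl <= \sum_((nb k).+1 <= i < (nb k.+1).+1) gamma i <= 2 * dl].
Proof.
move=> /block_step_ex[n0 hn0].
have /choice[nx hnx] : forall n, exists m, (n0 <= n)%N -> (n < m)%N /\
    dl <= \sum_(n.+1 <= i < m.+1) gamma i <= 2 * dl.
  move=> n; have [/hn0[m nm hm]|] := leqP n0 n; first by exists m.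
  by exists 0%N.
pose nb k := iter k nx n0.
have nb0 k : (n0 <= nb k)%N.
  by elim: k => //= k IH; have [/ltnW/(leq_trans IH)] := hnx _ IH.
have nbS k : (nb k < nb k.+1)%N by have [] := hnx _ (nb0 k).
exists nb; split => // [|k]; last by have [] := hnx _ (nb0 k).
by elim=> // k IH; exact: leq_ltn_trans IH (nbS k).
Qed.

End blocks.

(** A product of at most [L] factors is a combination of boundedly many iterates of [A] with bounded
    coefficients. Uniformity over [l] is essential, since the lists to be inserted change with [k]
    and with the trajectory. *)
Lemma polyop_vanish d (T : measurableType d) (R : realType)
    (A : (T -> R) -> T -> R) (nu : nat -> (T -> R) -> R) f : plop A -> bm f ->
  (forall k g h, bm g -> bm h -> nu k (fun x => g x + h x) = nu k g + nu k h) ->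
  (forall k c g, bm g -> nu k (fun x => c * g x) = c * nu k g) ->
  (forall i, nu k (iter i A f) @[k --> \oo] --> (0 : R)) ->
  forall L e, 0 < e -> exists k0, forall k, (k0 <= k)%N ->
  forall l, admissible l -> (size l <= L)%N -> `|nu k (polyop A l f)| <= e.
Proof.
move=> pA bf nuD nuZ nu0 L e e0.
(* Each factor may add one power of [A], so the induction has to allow an arbitrary iterate in
   front. *)
suff h i : exists k0, forall k, (k0 <= k)%N -> forall l, admissible l ->
    (size l <= L)%N -> `|nu k (iter i A (polyop A l f))| <= e by exact: (h 0%N).
elim: L e e0 i => [|L IH] e e0 i.
  have /cvgrPdist_le/(_ _ e0)[k0 _ hk0] := nu0 i.
  exists k0 => k /hk0; rewrite sub0r normrN => h l _; rewrite leqn0 size_eq0.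
  by move=> /eqP ->.
have e2 : 0 < e / 2 by rewrite divr_gt0.
have [k1 h1] := IH _ e2 i; have [k2 h2] := IH _ e2 i.+1.
exists (maxn k1 k2) => k; rewrite geq_max => /andP[/h1{}h1 /h2{}h2].
case=> [_ _|[a h] l]; first by rewrite (le_trans (h1 [::] _ _))//; lra.
move=> /= /andP[/andP[/andP[ag al] /andP[hg hl]] vl]; rewrite ltnS => sl.
have bu := plop_bm (plop_polyop pA vl) bf.
have pi := plop_iter i pA.
have bi := plop_bm pi bu; have bAi := plop_bm pi (plop_bm pA bu).
rewrite (plopD pi); [|exact: bmZ|exact/bmZ/(plop_bm pA)].
rewrite (plopZ pi)// (plopZ pi); last exact: (plop_bm pA).
rewrite nuD; [|exact: bmZ|exact: bmZ]; rewrite !nuZ//.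
have := h1 l vl sl; have := h2 l vl sl; rewrite iterSr => h4 h3.
rewrite (le_trans (ler_normD _ _))// !normrM (ger0_norm hg) (@ger0_norm _ a); last by lra.
rewrite (@le_trans _ _ (1 * (e / 2) + 1 * (e / 2)))//; last by lra.
by rewrite lerD// ler_pM//; lra.
Qed.

(** * A single trajectory compared with products of block operators *)

Section path.
Context (R : realType) d (E : measurableType d) (K : R.-spker E ~> E).
Variable eta : nat -> {posnum R}.
Context d' (Omega : measurableType d').
Variables (X : nat -> Omega -> E) (w : Omega).

Local Notation gamma := (step_size eta).
Local Notation Kop := (kapply K).
Local Notation one := (fun=> 1).
Local Notation m := (occ eta (X ^~ w)).
Local Notation A := (res Kop).

Variables (c q : R).
Hypothesis q01 : 0 <= q < 1.
Hypothesis K_geo : forall n x, iter n Kop one x <= c * q ^+ n.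
Hypothesis step_noninc : nonincreasing_seq gamma.

Let pK : plop Kop := plop_kapply K.
Let pA : plop A := plop_res pK q01 K_geo.
Let K1 : forall x, Kop one x <= 1 := kapply1_le K.
Let a := res_norm c q.
Let pm n : plf (m n) := plf_occ eta (X ^~ w) n.

Let g0 n : 0 <= gamma n. Proof. exact/ltW/step_size_gt0. Qed.

Let m_le n f B : bm f -> (forall x, `|f x| <= B) -> `|m n f| <= B.
Proof.
by move=> bf fB; rewrite (le_trans (plf_norm (pm n) bf fB))// occ1 mulr1.
Qed.

Let A_le f B : bm f -> (forall x, `|f x| <= B) -> forall x, `|A f x| <= a * B.
Proof. exact: res_bound. Qed.

Let a_ge1 : 1 <= a.
Proof.
apply: le_trans (res1 pK q01 K_geo (X 0 w)).
by apply: (res_ge pK q01 K_geo) => //; exact: bm_cst.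
Qed.

Lemma occ_increment f p r : (p <= r)%N ->
  m r f - m p f = \sum_(p.+1 <= i < r.+1) gamma i * (f (X i w) - m i.-1 f).
Proof.
move=> pr; rewrite big_add1/= -(telescope_sumr (fun i => m i f) pr).
by apply: eq_bigr => i _; rewrite occS addrC addKr.
Qed.

Lemma occ_dist f B p i r : bm f -> (forall x, `|f x| <= B) -> (p <= i <= r)%N ->
  `|m i f - m p f| <= 2 * B * \sum_(p.+1 <= j < r.+1) gamma j.
Proof.
move=> bf fB /andP[pi ir]; rewrite occ_increment//.
have B0 : 0 <= B by exact: le_trans (fB (X 0 w)).
rewrite (le_trans (ler_norm_sum _ _ _))// mulr_sumr.
rewrite [leRHS](big_cat_nat _ (_ : (i.+1 <= r.+1)%N))//= -[leLHS]addr0.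
rewrite lerD//; last by rewrite sumr_ge0// => j _; rewrite mulr_ge0// mulr_ge0.
apply: ler_sum => j _; rewrite normrM ger0_norm// mulrC ler_wpM2r//.
by rewrite (le_trans (ler_normB _ _))// mulr2n mulrDl mul1r lerD// m_le.
Qed.

(** The [H] of the overview, [span] below being [G]. The indices start at [p.+1] because passing
    from [occ p] to [occ p.+1] uses [gamma p.+1]. *)
Definition killing p r := \sum_(p.+1 <= i < r.+1) gamma i * (1 - Kop one (X i w)).

Definition span p r := \sum_(p.+1 <= i < r.+1) gamma i.

Lemma killing_bound p r : 0 <= killing p r <= span p r.
Proof.
have h i : 0 <= 1 - Kop one (X i w) <= 1.
  rewrite subr_ge0 K1 gerBl; apply: (plop_ge0 pK) => //; exact: bm_cst.
apply/andP; split; first by apply: sumr_ge0 => i _; rewrite mulr_ge0//; case/andP: (h i).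
by apply: ler_sum => i _; rewrite ler_piMr//; case/andP: (h i).
Qed.

(* The Poisson equation [f = A f - K (A f)] turns [f (X i)] into a killing term, a
   martingale increment and a telescoping difference. *)
Lemma poisson_decomp f i : bm f -> f (X i w) =
  A f (X i w) - A f (X i.+1 w) + mdiff K eta X i (A f) w
  + (1 - Kop one (X i w)) * m i (A f).
Proof. by move=> bf; rewrite /mdiff /drift {1}(res_fixK pK K1 q01 K_geo _ bf); ring. Qed.

(** Freezing the occupation measure at index [p] costs [2 * B * G ^+ 2] in the relaxation term and
    [a] times as much in the killing term, by [occ_dist]; the telescoping difference is bounded by
    [abel_le]. *)
Lemma block_error f B p r : bm f -> (forall x, `|f x| <= B) -> (p <= r)%N ->
  `|m r f - ((1 - span p r) * m p f + killing p r * m p (A f))|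
    <= 2 * B * (1 + a) * span p r ^+ 2 + `|noise K eta X p.+1 r.+1 (A f) w|
       + 2 * gamma p.+1 * (a * B).
Proof.
move=> bf fB pr; set G := span p r.
have bA := plop_bm pA bf; have AB := A_le bf fB.
have G0 : 0 <= G by apply: sumr_ge0.
have -> : m r f - ((1 - G) * m p f + killing p r * m p (A f)) =
    \sum_(p.+1 <= i < r.+1) gamma i * (A f (X i w) - A f (X i.+1 w))
    + noise K eta X p.+1 r.+1 (A f) w
    + \sum_(p.+1 <= i < r.+1) gamma i * ((1 - Kop one (X i w)) * (m i (A f) - m p (A f)))
    - \sum_(p.+1 <= i < r.+1) gamma i * (m i.-1 f - m p f).
  have -> : m r f - ((1 - G) * m p f + killing p r * m p (A f)) =
      (m r f - m p f) + G * m p f - killing p r * m p (A f) by ring.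
  rewrite occ_increment// /G /span /killing /noise !mulr_suml -!big_split/= -!sumrB.
  by apply: eq_bigr => i _; rewrite (poisson_decomp i bf); ring.
have e1 : `|\sum_(p.+1 <= i < r.+1) gamma i * (A f (X i w) - A f (X i.+1 w))|
    <= 2 * gamma p.+1 * (a * B).
  exact: (abel_le (u := fun i => A f (X i w)) step_noninc g0 (fun i => AB (X i w))).
have B0 : 0 <= B by exact: le_trans (fB (X 0 w)).
have aB0 : 0 <= a * B by exact: le_trans (AB (X 0 w)).
have e2 : `|\sum_(p.+1 <= i < r.+1) gamma i *
    ((1 - Kop one (X i w)) * (m i (A f) - m p (A f)))| <= 2 * (a * B) * G * G.
  rewrite (le_trans (ler_norm_sum _ _ _))// {2}/G /span mulr_sumr !big_nat.
  apply: ler_sum => i /andP[pi ir].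
  rewrite normrM ger0_norm// mulrC ler_wpM2r// normrM.
  have h : `|1 - Kop one (X i w)| <= 1.
    have k0 : 0 <= Kop one (X i w) by apply: (plop_ge0 pK) => //; exact: bm_cst.
    by rewrite ger0_norm ?subr_ge0// gerBl.
  rewrite -[leRHS]mul1r ler_pM//; apply: occ_dist => //.
  by rewrite (ltnW pi)/= -ltnS.
have e3 : `|\sum_(p.+1 <= i < r.+1) gamma i * (m i.-1 f - m p f)| <= 2 * B * G * G.
  rewrite (le_trans (ler_norm_sum _ _ _))// {2}/G /span mulr_sumr !big_nat.
  apply: ler_sum => i /andP[pi ir].
  rewrite normrM ger0_norm// mulrC ler_wpM2r//; apply: occ_dist => //.
  by case: i pi ir => //= i pi ir; rewrite -ltnS pi/= ltnW// -ltnS.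
rewrite (le_trans (ler_normB _ _))//.
have := ler_normD (\sum_(p.+1 <= i < r.+1) gamma i * (A f (X i w) - A f (X i.+1 w)))
  (noise K eta X p.+1 r.+1 (A f) w).
have := ler_normD (\sum_(p.+1 <= i < r.+1) gamma i * (A f (X i w) - A f (X i.+1 w))
   + noise K eta X p.+1 r.+1 (A f) w) (\sum_(p.+1 <= i < r.+1) gamma i *
    ((1 - Kop one (X i w)) * (m i (A f) - m p (A f)))).
have -> : 2 * B * (1 + a) * G ^+ 2 = 2 * (a * B) * G * G + 2 * B * G * G by ring.
lra.
Qed.

Lemma noiseD p r g h : bm g -> bm h ->
  noise K eta X p r (fun x => g x + h x) w = noise K eta X p r g w + noise K eta X p r h w.
Proof.
move=> bg bh; rewrite /noise -big_split/=; apply: eq_bigr => i _.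
by rewrite /mdiff (plfD (plf_drift K eta X i w))//; ring.
Qed.

Lemma noiseZ p r s g : bm g ->
  noise K eta X p r (fun x => s * g x) w = s * noise K eta X p r g w.
Proof.
move=> bg; rewrite /noise mulr_sumr; apply: eq_bigr => i _.
by rewrite /mdiff (plfZ (plf_drift K eta X i w))//; ring.
Qed.

Section fixed_blocks.
Variables (nb : nat -> nat) (dl : R).
Hypothesis nbS : forall k, (nb k < nb k.+1)%N.
Hypothesis nb_ge : forall k, (k <= nb k)%N.
Hypothesis nb_span : forall k, dl <= span (nb k) (nb k.+1) <= 2 * dl.
Hypothesis dl_gt0 : 0 < dl.
Hypothesis dl_le : dl <= 1 / 4.

Let G k := span (nb k) (nb k.+1).
Let H k := killing (nb k) (nb k.+1).
Let M k := m (nb k).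
Let nu k g := noise K eta X (nb k).+1 (nb k.+1).+1 (A g) w.

(** The earliest block is the head and so is applied last: unrolling [M k.+1 f], approximately
    [M k ((1 - G k) * f + H k * A f)], backwards in time puts block [k] outermost. *)
Definition block_seq k L := [seq (1 - G i, H i) | i <- iota k L].

(** Spans are at most [2 * dl <= 1 / 2], which is the reason for the bound [1 / 4] on [dl]. *)
Lemma block_seq_adm k L : admissible (block_seq k L).
Proof.
apply/allP => _ /mapP[i _ ->] /=.
have /andP[h0 hG] := killing_bound (nb i) (nb i.+1).
have /andP[h1 h2] := nb_span i.
rewrite -/(G i) -/(H i) in h0 hG h1 h2 *.
move: (G i) (H i) h0 hG h1 h2 => x y h0 hG h1 h2.
have d1 := dl_le; have d0 := dl_gt0.
have t1 : x <= 1 / 2 by lra.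
have t2 : 1 / 2 <= 1 - x by lra.
have t3 : 1 - x <= 1 by lra.
have t4 : y <= 1 by lra.
by rewrite t2 t3 h0 t4.
Qed.

(** This growth stays bounded when [L * dl] is fixed and [dl] tends to 0, since
    [1 + x <= expR x]. *)
Lemma polyop_block_norm k L f B : bm f -> (forall x, `|f x| <= B) ->
  forall x, `|polyop A (block_seq k L) f x| <= (1 + 2 * dl * a) ^+ L * B.
Proof.
move=> bf fB; have a0 : 0 <= a by exact: le_trans a_ge1.
have d1 := dl_le; have d0 := dl_gt0.
elim: L k => [|L IH] k x; first by rewrite expr0 mul1r.
rewrite /block_seq /= -/(block_seq k.+1 L).
set l := block_seq k.+1 L.
have bu : bm (polyop A l f) by exact: (plop_bm (plop_polyop pA (block_seq_adm _ _)) bf).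
have Bu := IH k.+1; have Au := A_le bu Bu x.
have /andP[h0 hG] := killing_bound (nb k) (nb k.+1).
have /andP[h1 h2] := nb_span k.
rewrite -/(G k) -/(H k) in h0 hG h1 h2 *.
rewrite (le_trans (ler_normD _ _))// !normrM (ger0_norm h0) (@ger0_norm _ (1 - G k)); last by lra.
rewrite exprS -mulrA; set Z := _ ^+ L * B in Bu Au *.
have Z0 : 0 <= Z by exact: le_trans (Bu x).
rewrite [leRHS]mulrDl lerD//; first by rewrite ler_pM ?Bu//; lra.
by rewrite -[leRHS]mulrA ler_pM//; lra.
Qed.

Let Err k f := M k.+1 f - ((1 - G k) * M k f + H k * M k (A f)).

(** The error of each block is measured at the product of the later blocks applied to [f], so the
    errors simply add up. *)
Lemma telescope_blocks f L k e : bm f ->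
  (forall i j, (k <= i)%N -> (j < L)%N -> `|Err i (polyop A (block_seq i.+1 j) f)| <= e) ->
  `|M (k + L)%N f - M k (polyop A (block_seq k L) f)| <= e *+ L.
Proof.
move=> bf; elim: L k => [|L IH] k hE; first by rewrite addn0 subrr normr0 mulr0n.
rewrite /block_seq /= -/(block_seq k.+1 L).
set u := polyop A (block_seq k.+1 L) f.
have bu : bm u by exact: (plop_bm (plop_polyop pA (block_seq_adm _ _)) bf).
have -> : M k (fun x => (1 - G k) * u x + H k * A u x) = (1 - G k) * M k u + H k * M k (A u).
  have bAu := plop_bm pA bu.
  by rewrite /M (plfD (pm _) (bmZ _ bu) (bmZ _ bAu)) !(plfZ (pm _)).
have h1 : `|M (k.+1 + L)%N f - M k.+1 u| <= e *+ L.
  by apply: IH => i j ki jL; apply: hE; [exact: ltnW|exact: leqW].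
have h2 : `|Err k u| <= e by exact: hE.
rewrite addnS -addSn mulrS.
rewrite (_ : _ - _ = Err k u + (M (k.+1 + L)%N f - M k.+1 u)); last by rewrite /Err; ring.
by rewrite (le_trans (ler_normD _ _))// lerD.
Qed.

Hypothesis gamma_cvg : gamma n @[n --> \oo] --> (0 : R).

Let nu_small f L e : bm f ->
  (forall i, noise K eta X (nb k).+1 (nb k.+1).+1 (iter i.+1 A f) w @[k --> \oo] --> (0 : R)) ->
  0 < e -> exists k0, forall k, (k0 <= k)%N -> forall l, admissible l ->
  (size l <= L)%N -> `|nu k (polyop A l f)| <= e.
Proof.
move=> bf hf e0; apply: (polyop_vanish pA bf _ _ hf) => //.
- move=> k g h bg bh; rewrite /nu (plopD pA)// noiseD//; exact: (plop_bm pA).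
- move=> k s g bg; rewrite /nu (plopZ pA)// noiseZ//; exact: (plop_bm pA).
Qed.

Let Bmax L B := (1 + 2 * dl * a) ^+ L * B.

(** A span of at most [2 * dl] turns the quadratic term into [8 * Bmax L B * (1 + a) * dl ^+ 2]. The
    noise and the first step of the block vanish as [k] grows and share the remaining [dl ^+ 2]. *)
Let Err_le L f B : bm f -> (forall x, `|f x| <= B) ->
  (forall i, noise K eta X (nb k).+1 (nb k.+1).+1 (iter i.+1 A f) w @[k --> \oo] --> (0 : R)) ->
  exists k0, forall k, (k0 <= k)%N -> forall j, (j <= L)%N ->
  `|Err k (polyop A (block_seq k.+1 j) f)|
    <= (8 * Bmax L B * (1 + a) + 1) * dl ^+ 2.
Proof.
move=> bf fB hf; have a0 : 0 <= a by exact: le_trans a_ge1.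
have d1 := dl_le; have d0 := dl_gt0.
have B0 : 0 <= B by exact: le_trans (fB (X 0 w)).
have BL0 : 0 <= Bmax L B by rewrite mulr_ge0// exprn_ge0// addr_ge0// mulr_ge0// mulr_ge0// ltW.
have dl2 : 0 < dl ^+ 2 by rewrite exprn_gt0.
have e0 : 0 < dl ^+ 2 / 2 by rewrite divr_gt0.
have [k0 hk0] := nu_small L bf hf e0.
have e1 : 0 < dl ^+ 2 / 2 / (2 * (a * Bmax L B) + 1).
  by rewrite divr_gt0// ltr_wpDl// mulr_ge0// mulr_ge0.
have /cvgrPdist_le/(_ _ e1)[k1 _ hk1] := gamma_cvg.
exists (maxn k0 k1) => k; rewrite geq_max => /andP[/hk0 h0 kk1] j jL.
have vl := block_seq_adm k.+1 j.
have sl : (size (block_seq k.+1 j) <= L)%N by rewrite size_map size_iota.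
have h := h0 _ vl sl; set u := polyop _ _ _ in h *.
have bu : bm u := plop_bm (plop_polyop pA vl) bf.
have uB x : `|u x| <= Bmax L B.
  rewrite (le_trans (polyop_block_norm k.+1 j bf fB x))// ler_wpM2r//.
  by apply: ler_weXn2l => //; rewrite lerDl mulr_ge0// mulr_ge0// ltW.
have := block_error bu uB (ltnW (nbS k)); rewrite -/(G k) -/(H k) -/(M k) -/(M k.+1) -/(Err k u).
have /andP[G1 G2] : dl <= G k <= 2 * dl := nb_span k.
have G3 : G k ^+ 2 <= (2 * dl) ^+ 2 by rewrite ler_sqr// nnegrE; lra.
have := hk1 (nb k).+1 (leq_trans kk1 (leqW (nb_ge k))).
rewrite sub0r normrN ger0_norm// => hg.
have : 2 * gamma (nb k).+1 * (a * Bmax L B) <= dl ^+ 2 / 2.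
  have D : 0 < 2 * (a * Bmax L B) + 1 by rewrite ltr_wpDl// mulr_ge0// mulr_ge0.
  have gen (x y z : R) : 0 <= x -> x * (2 * y + 1) <= z -> 2 * x * y <= z.
    by move=> x0; rewrite mulrDr mulr1; lra.
  by apply: gen (g0 _) _; rewrite -ler_pdivlMr.
have c0 : 0 <= 2 * Bmax L B * (1 + a).
  by apply: mulr_ge0; [exact: mulr_ge0|exact: addr_ge0].
have := ler_wpM2l c0 G3; rewrite /nu in h; move: h.
rewrite (_ : 2 * Bmax L B * (1 + a) * (2 * dl) ^+ 2 = 8 * Bmax L B * (1 + a) * dl ^+ 2); last by ring.
rewrite [(_ + 1) * _]mulrDl mul1r.
set X1 := 8 * _ * _ * _; set X2 := _ * G k ^+ 2; set X3 := 2 * gamma _ * _.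
set X4 := dl ^+ 2; lra.
Qed.

Hypothesis noise1 : forall i,
  noise K eta X (nb k).+1 (nb k.+1).+1 (iter i.+1 A one) w @[k --> \oo] --> (0 : R).

(** Tested with 1, the block relation reads [G k = H k * M k (A 1)] up to an error of at most
    [dl / 2], and [M k (A 1) <= a]; hence each block kills at least [dl / (2 * a)]. *)
Lemma block_mass L : dl * (8 * (1 + a) + 1) <= 1 / 2 ->
  exists k0, forall k, (k0 <= k)%N -> L%:R * dl <= 2 * a * tmass (block_seq k L).
Proof.
move=> dla; have d0 := dl_gt0; have a1 := a_ge1.
have one1 (x : E) : `|(one : E -> R) x| <= 1 by rewrite normr1.
have [k0 hk0] := Err_le 0 (bm_cst 1) one1 noise1.
clear one1.
exists k0 => k kk0.
suff hH i : (k0 <= i)%N -> dl <= 2 * a * H i.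
  rewrite /tmass /block_seq; elim: L k kk0 => [|L IH] k kk0 /=.
    by rewrite big_nil mul0r mulr0.
  rewrite big_cons -natr1 mulrDl mul1r mulrDr addrC lerD//; first exact: hH.
  by apply: IH; exact: leqW.
move=> /hk0/(_ 0%N isT); rewrite /= /Bmax expr0 !mul1r mulr1 /Err.
rewrite /M !occ1 mulr1.
have hA : m (nb i) (A one) <= a.
  apply: le_trans (ler_norm _) _; apply: m_le; first exact: (plop_bm pA (bm_cst 1)).
  by move=> x; rewrite -[leRHS]mulr1; apply: (A_le (bm_cst 1)) => y; rewrite normr1.
have /andP[h0 hG] := killing_bound (nb i) (nb i.+1); rewrite -/(H i) -/(G i) in h0 hG.
have /andP[h1 h2] : dl <= G i <= 2 * dl := nb_span i.
have hHa := ler_wpM2l h0 hA.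
have e : (8 * (1 + a) + 1) * dl ^+ 2 <= dl * (1 / 2).
  by rewrite expr2 mulrCA; apply: ler_wpM2l; [exact: ltW|rewrite mulrC].
by rewrite ler_norml => /andP[_ h]; lra.
Qed.

Lemma block_compare f B L : bm f -> (forall x, `|f x| <= B) ->
  (forall i, noise K eta X (nb k).+1 (nb k.+1).+1 (iter i.+1 A f) w @[k --> \oo] --> (0 : R)) ->
  exists k0, forall k, (k0 <= k)%N ->
    `|M (k + L)%N f - M k (polyop A (block_seq k L) f)|
      <= ((8 * ((1 + 2 * dl * a) ^+ L * B) * (1 + a) + 1) * dl ^+ 2) *+ L.
Proof.
move=> bf fB hf; have [k0 hk0] := Err_le L bf fB hf.
exists k0 => k kk0; apply: telescope_blocks => // i j ki jL.
by apply: hk0; [exact: leq_trans kk0 ki|exact: ltnW].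
Qed.

Lemma block_locate k1 n : (nb k1 <= n)%N ->
  exists2 k, (k1 <= k)%N & (nb k <= n <= nb k.+1)%N.
Proof.
move=> k1n; have bd k : (nb k <= n)%N -> (k <= n)%N by exact: leq_trans (nb_ge k).
have ex : exists k, (nb k <= n)%N by exists k1.
case: (ex_maxnP ex bd) => k kn kmax; exists k; first exact: kmax.
rewrite kn/= ltnW// ltnNge; apply/negP => /kmax.
by rewrite ltnn.
Qed.

End fixed_blocks.

(** The order of choices matters: accuracy, required mass [S], total span [N0], and only then the
    block size [dl]. The functional at index [n] is compared with the one [L = N0 / dl] blocks
    earlier, whose influence the product has forgotten. *)
Lemma path_cvg (ell : (E -> R) -> R) (f : E -> R) (nb : nat -> nat -> nat) :
  plf ell -> ell one = 1 ->
  (forall e : R, 0 < e -> exists S : R,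
    forall l, admissible l -> S <= tmass l -> forall mu f B, plf mu -> bm f ->
    (forall x, `|f x| <= B) ->
    `|mu (polyop A l f) - ell f * mu (polyop A l one)| <= e * B * mu (polyop A l one)) ->
  gamma n @[n --> \oo] --> (0 : R) ->
  (forall j, [/\ forall k, (k <= nb j k)%N, forall k, (nb j k < nb j k.+1)%N &
    forall k, j.+1%:R^-1 <= span (nb j k) (nb j k.+1) <= 2 * j.+1%:R^-1]) ->
  bm f ->
  (forall j i, noise K eta X (nb j k).+1 (nb j k.+1).+1 (iter i.+1 A f) w
     @[k --> \oo] --> (0 : R)) ->
  (forall j i, noise K eta X (nb j k).+1 (nb j k.+1).+1 (iter i.+1 A one) w
     @[k --> \oo] --> (0 : R)) ->
  m n f @[n --> \oo] --> ell f.
Proof.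
move=> pell ell1 forget gamma_cvg hnb bf hf h1.
have [B0 B00 fB0] := bm_bound bf.
(* With [B >= 1] the same bound serves for [f] and for the function 1. *)
pose B := B0 + 1; have B1 : 1 <= B by rewrite /B; lra.
have B_gt0 : 0 < B by lra.
have fB x : `|f x| <= B by rewrite (le_trans (fB0 x))// /B lerDl.
have a1 : 1 <= a := a_ge1.
apply/cvgrPdist_le => eps eps0.
have e1 : 0 < eps / (8 * B) by rewrite divr_gt0// mulr_gt0.
have [S hS] := forget _ e1.
(* By [block_mass] a total span of [N0] provides a mass of at least [N0 / (2 * a)], hence at least
   [S]. *)
pose N0 := (Num.bound `|2 * a * S|).+1.
have N0_gt0 : 0 < N0%:R :> R by rewrite ltr0n.
have SN0 : 2 * a * S <= N0%:R.
  rewrite (le_trans (ler_norm _))// ltW//.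
  by rewrite (lt_le_trans (archi_boundP (normr_ge0 _)))// ler_nat.
(* Bounds [(1 + 2 * dl * a) ^+ L * B] whenever [L * dl = N0], and so can be fixed before [dl]. *)
pose Bx := expR (2 * a * N0%:R) * B.
have Bx0 : 0 < Bx by rewrite mulr_gt0// expR_gt0.
pose c' := 8 * Bx * (1 + a) + 1.
have c'0 : 0 < c' by rewrite /c' ltr_wpDl// !mulr_ge0 ?(ltW Bx0)//; lra.
(* In this order: admissibility of the blocks, hypothesis of [block_mass], total error at most 1,
   total error at most [eps / (8 * B)], variation inside one block at most [eps / 4]. *)
pose t := Num.min (Num.min (1 / 4) (1 / 2 / (8 * (1 + a) + 1)))
  (Num.min (Num.min (1 / (N0%:R * c')) (eps / (8 * B) / (N0%:R * c'))) (eps / (16 * B))).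
have D1 : 0 < 8 * (1 + a) + 1 by lra.
have D2 : 0 < N0%:R * c' by rewrite mulr_gt0.
have t0 : 0 < t by rewrite !lt_min !divr_gt0// mulr_gt0.
pose j := Num.bound t^-1; pose dl : R := j.+1%:R^-1.
have dl0 : 0 < dl by rewrite invr_gt0.
have dlt : dl <= t.
  rewrite /dl -[leRHS]invrK lef_pV2 ?posrE ?invr_gt0//.
  have hb : t^-1 < j%:R by rewrite archi_boundP// invr_ge0 ltW.
  by rewrite ltW// (lt_le_trans hb)// ler_nat.
move: (dlt); rewrite !le_min => /andP[/andP[dl4 dla] /andP[/andP[dlN dlNe] dle]].
(* The block size is the inverse of an integer, so [N0] is an exact multiple of it. *)
have [L Ldl] : exists L : nat, L%:R * dl = N0%:R.
  by exists (N0 * j.+1)%N; rewrite natrM /dl mulfK// pnatr_eq0.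
have [nb_ge nbS nb_span0] := hnb j.
have nb_span k : dl <= span (nb j k) (nb j k.+1) <= 2 * dl by exact: nb_span0.
have powB : (1 + 2 * dl * a) ^+ L * B <= Bx.
  rewrite /Bx ler_wpM2r ?(ltW B_gt0)//.
  rewrite (_ : 2 * a * N0%:R = L%:R * (2 * dl * a)); last by rewrite -Ldl; ring.
  rewrite expRM_natl lerXn2r ?nnegrE ?expR_ge0 ?expR_ge1Dx// addr_ge0// mulr_ge0//.
    by rewrite mulr_ge0// ltW.
  by lra.
have eta_le : ((8 * ((1 + 2 * dl * a) ^+ L * B) * (1 + a) + 1) * dl ^+ 2) *+ L
    <= N0%:R * c' * dl.
  set Y := _ ^+ L * B in powB *.
  rewrite -mulr_natr expr2 (_ : _ * L%:R = (8 * Y * (1 + a) + 1) * (L%:R * dl) * dl); last by ring.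
  rewrite Ldl [N0%:R * c']mulrC ler_wpM2r ?(ltW dl0)// ler_wpM2r ?(ltW N0_gt0)//.
  by rewrite /c' lerD2r ler_wpM2r ?ler_wpM2l//; lra.
have eta1 : N0%:R * c' * dl <= 1 by rewrite mulrC -ler_pdivlMr.
have eta2 : N0%:R * c' * dl <= eps / (8 * B) by rewrite mulrC -ler_pdivlMr.
set eta' := N0%:R * c' * dl in eta_le eta1 eta2.
have dla' : dl * (8 * (1 + a) + 1) <= 1 / 2 by rewrite -ler_pdivlMr.
have [k1 hk1] := block_mass nbS nb_ge nb_span dl0 dl4 gamma_cvg (h1 j) L dla'.
have [k2 hk2] := block_compare nbS nb_ge nb_span dl0 dl4 gamma_cvg L bf fB (hf j).
have oneB (x : E) : `|(one : E -> R) x| <= B by rewrite normr1.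
have [k3 hk3] := block_compare nbS nb_ge nb_span dl0 dl4 gamma_cvg L (bm_cst 1) oneB (h1 j).
clear oneB.
exists (nb j (maxn k1 (maxn k2 k3) + L)%N) => // n /= hn.
(* The index [n] lies in block [k]; the product runs over the [L] blocks that end at [nb j k]. *)
have [k kk /andP[nk kn]] := block_locate nb_ge hn.
have kL : (L <= k)%N by exact: leq_trans (leq_addl _ _) kk.
have : (maxn k1 (maxn k2 k3) <= k - L)%N by rewrite leq_subRL// addnC.
rewrite !geq_max => /and3P[/hk1 M1 /hk2 M2 /hk3 M3].
have {M2} := M2; have {M3} := M3; rewrite subnK//.
set l := block_seq _ _ _ in M1 *; rewrite occ1 => M3 M2.
have vl : admissible l := block_seq_adm nb_span dl0 dl4 _ _.
have a_gt0 : 0 < 2 * a by lra.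
have Sl : S <= tmass l.
  by rewrite -(ler_pM2l a_gt0) (le_trans SN0)// -Ldl.
have := hS l vl Sl (m (nb j (k - L)%N)) f B (pm _) bf fB.
set u := m _ (polyop A l f) in M2 *; set v := m _ (polyop A l one) in M3 *.
have -> : eps / (8 * B) * B = eps / 8 by field; rewrite gt_eqF.
have ellB : `|ell f| <= B.
  by rewrite (le_trans (plf_norm pell bf fB))// ell1 mulr1.
have := occ_dist (i := n) bf fB (_ : (nb j k <= n <= nb j k.+1)%N).
rewrite nk kn => /(_ isT); have /andP[_ sp] := nb_span k.
rewrite -/(span _ _) => M4 M5.
have B2 : 2 * B * span (nb j k) (nb j k.+1) <= 4 * B * dl.
  rewrite (_ : 4 * B * dl = 2 * B * (2 * dl)); last by ring.
  by rewrite ler_wpM2l// mulr_ge0// ltW.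
have B4 : 4 * B * dl <= eps / 4.
  have := dle; rewrite ler_pdivlMr ?mulr_gt0//; lra.
have B5 : B * eta' <= eps / 8.
  have := eta2; rewrite ler_pdivlMr ?mulr_gt0//; lra.
have B6 : eta' <= B * eta'.
  by rewrite ler_peMl// mulr_ge0 ?(ltW dl0)// ltW.
have {}M2 := le_trans M2 eta_le.
have {M3} : `|1 - v| <= eta' := le_trans M3 eta_le.
rewrite distrC => M3.
have M3' : `|ell f * (v - 1)| <= B * eta' by rewrite normrM ler_pM.
have v2 : v <= 2 by move: M3; rewrite ler_norml => /andP[_]; lra.
have M5' : `|u - ell f * v| <= eps / 4.
  by rewrite (le_trans M5)// (@le_trans _ _ (eps / 8 * 2))//; [rewrite ler_wpM2l// divr_ge0// ltW|lra].
rewrite distrC.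
(* Variation inside the last block, block errors, forgetting, and the defect of mass; [v] is close
   to 1 because occupation measures have mass 1. *)
have -> : m n f - ell f = (m n f - m (nb j k) f) + (m (nb j k) f - u) +
  (u - ell f * v) + ell f * (v - 1) by ring.
rewrite (le_trans (ler_normD _ _))//.
have := ler_normD (m n f - m (nb j k) f + (m (nb j k) f - u)) (u - ell f * v).
have := ler_normD (m n f - m (nb j k) f) (m (nb j k) f - u).
lra.
Qed.

End path.

(** Dominated convergence for each iterate of the kernel, together with a geometric tail that is
    uniform along the sequence. *)
Lemma res_cvg0 d (T : measurableType d) (R : realType) (K : R.-spker T ~> T)
    (c q : R) : 0 <= q < 1 ->
  (forall n x, iter n (kapply K) (fun=> 1) x <= c * q ^+ n) ->
  forall (f : nat -> T -> R) B, (forall n, bm (f n)) ->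
  (forall n x, `|f n x| <= B) -> (forall x, f n x @[n --> \oo] --> (0 : R)) ->
  forall x, res (kapply K) (f n) x @[n --> \oo] --> (0 : R).
Proof.
move=> q01 K_geo f B bf fB f0 x; have pK := plop_kapply K.
have hA N : Apart (kapply K) N (f n) x @[n --> \oo] --> (0 : R).
  rewrite /Apart; elim: N => [|N IH].
    by under eq_fun do rewrite big_ord0; exact: cvg_cst.
  under eq_fun do rewrite big_ord_recr/=.
  have hE n : iter N (kapply K) (f n) x = kapply (kiter K N) (f n) x.
    by rewrite kapply_kiter.
  have hN : iter N (kapply K) (f n) x @[n --> \oo] --> (0 : R).
    by under eq_fun do rewrite hE; exact: kapply_cvg0 bf fB f0 x.
  by have := cvgD IH hN; rewrite addr0; apply.
apply/cvgrPdist_le => e e0; have e2 : 0 < e / 2 by rewrite divr_gt0.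
have [N hN] := geometric_small (res_norm c q * B) q01 e2.
have /cvgrPdist_le/(_ _ e2)[n0 _ hn0] := hA N.
exists n0 => // n /hn0; rewrite !sub0r !normrN => h.
have h2 := le_trans (res_Apart pK q01 K_geo N (bf n) (fB n) x) (hN N (leqnn N)).
rewrite -[res _ _ _](subrK (Apart (kapply K) N (f n) x)).
by rewrite (le_trans (ler_normD _ _))//; lra.
Qed.

(** * A countable convergence-determining family of sets *)

Section partition.
Context d (R : realType) (E : borelMetricType d R).
Hypothesis compactE : compact [set: E].

Lemma open_metric_ball (x : E) (r : R) : open (ball x r).
Proof.
rewrite openE => y; rewrite ballEmdist/= => xy.
have r0 : 0 < r - mdist x y by rewrite subr_gt0.
apply: filterS (nbhsx_ballx y _ r0) => z; rewrite !ballEmdist/= => yz.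
by rewrite (le_lt_trans (metric_triangle x y z))//; lra.
Qed.

Lemma finite_net (x0 : E) (r : R) : 0 < r ->
  exists (y : nat -> E) N, forall x, exists2 i, (i < N)%N & mdist (y i) x < r.
Proof.
move=> r0; have := compactE; rewrite compact_cover => /(_ E setT (fun x => ball x r)).
case=> [x _||D _ hD]; first exact: open_metric_ball.
  by move=> x _; exists x => //; exact: ballxx.
set s := finmap.enum_fset D.
exists (nth x0 s), (size s) => x.
have [y /= yD] := hD x I; have ys : y \in s by exact: yD.
rewrite ballEmdist/= => xy; exists (index y s); first by rewrite index_mem.
by rewrite nth_index.
Qed.

Lemma uniform_continuity (f : E -> R) (e : R) : continuous f -> 0 < e ->
  exists n, forall x y, mdist x y < n.+1%:R^-1 -> `|f x - f y| <= e.
Proof.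
move=> cf e0; have e2 : 0 < e / 2 by rewrite divr_gt0.
apply: (compact_uniform compactE (P := fun n x => forall y,
  mdist x y < n.+1%:R^-1 -> `|f x - f y| <= e)) => [n m x nm h y xy|x].
  by apply: h; rewrite (lt_le_trans xy)// lef_pV2 ?posrE// ler_nat.
have /cvgrPdist_le/(_ _ e2)/nbhs_ballP[r /= r0 hr] := cf x.
have r2 : 0 < r / 2 by rewrite divr_gt0.
exists (Num.bound (r / 2)^-1).
apply: filterS (nbhsx_ballx x (r / 2) r2) => z; rewrite ballEmdist/= => xz y zy.
have nr : (Num.bound (r / 2)^-1).+1%:R^-1 <= r / 2.
  rewrite -[leRHS]invrK lef_pV2 ?posrE ?invr_gt0//.
  have hb : (r / 2)^-1 < (Num.bound (r / 2)^-1)%:R.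
    by rewrite archi_boundP// invr_ge0 ltW.
  by rewrite ltW// (lt_le_trans hb)// ler_nat.
have hz : `|f x - f z| <= e / 2 by apply: hr; rewrite ballEmdist/=; lra.
have hy : `|f x - f y| <= e / 2.
  apply: hr; rewrite ballEmdist/= (le_lt_trans (metric_triangle x z y))//.
  by have := lt_le_trans zy nr; lra.
rewrite (_ : f z - f y = (f x - f y) - (f x - f z)); last by ring.
by rewrite (le_trans (ler_normB _ _))//; lra.
Qed.

(* Indicators of finite partitions into small Borel sets suffice: a continuous
   function is a uniform limit of their linear combinations. *)
Lemma convergence_determining (x0 : E) : exists B : nat -> nat -> set E,
  (forall n i, measurable (B n i)) /\
  forall (m : nat -> (E -> R) -> R) (ell : (E -> R) -> R),
    (forall k, plf (m k)) -> (forall k, m k (fun=> 1) = 1) ->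
    plf ell -> ell (fun=> 1) = 1 ->
    (forall n i, m k \1_(B n i) @[k --> \oo] --> ell \1_(B n i)) ->
    forall f, continuous f -> m k f @[k --> \oo] --> ell f.
Proof.
have /choice[y /choice[N hy]] : forall n, exists (y : nat -> E), exists N,
    forall x, exists2 i, (i < N)%N & mdist (y i) x < n.+1%:R^-1.
  by move=> n; apply: finite_net => //; rewrite invr_gt0.
pose O n i := ball (y n i) n.+1%:R^-1.
exists (fun n => seqDU (O n)); split=> [n i|m ell pm m1 pl l1 hB f cf].
  apply: seqDU_measurable => k; rewrite measurable_borelE.
  by apply: sub_sigma_algebra; exact: open_metric_ball.
have mO n i : measurable (seqDU (O n) i).
  apply: seqDU_measurable => k; rewrite measurable_borelE.
  by apply: sub_sigma_algebra; exact: open_metric_ball.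
have bf : bm f by exact: continuous_bm.
apply/cvgrPdist_le => e e0; have e4 : 0 < e / 4 by rewrite divr_gt0.
have [n hn] := uniform_continuity cf e4.
pose s x : R := \sum_(i < N n) f (y n i) * \1_(seqDU (O n) i) x.
have bi i : bm (fun x => f (y n i) * \1_(seqDU (O n) i) x).
  by apply: bmZ; exact: bm_indic.
have bs : bm s by exact: (bm_sum (N n) bi).
have fs x : `|f x - s x| <= e / 4.
  have [i0 i0N xi0] := hy n x.
  have : (\bigcup_k O n k) x by exists i0 => //; rewrite /O ballEmdist.
  rewrite seqDU_bigcup_eq => -[j _ xj].
  (* A cell of index at least [N n] excludes the first [N n] balls, which already cover the
     space. *)
  have jN : (j < N n)%N.
    rewrite ltnNge; apply/negP => Nj; case: xj => _; apply.
    rewrite -bigcup_mkord; exists i0; first exact: leq_trans i0N Nj.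
    by rewrite /O ballEmdist.
  have -> : s x = f (y n j).
    rewrite /s (bigD1 (Ordinal jN))//= indicE mem_set// mulr1 big1 ?addr0// => i ij.
    rewrite indicE memNset ?mulr0// => xi.
    have /trivIsetP/(_ i j I I) := @trivIset_seqDU _ (O n).
    have ij' : nat_of_ord i != j by apply: contra ij => /eqP h; apply/eqP/val_inj.
    by move=> /(_ ij')/seteqP[/(_ x (conj xi xj))].
  rewrite distrC; apply: hn.
  by have := @subset_seqDU _ (O n) j x xj; rewrite /O ballEmdist.
have ms : m k s @[k --> \oo] --> ell s.
  have sE L : plf L -> L s = \sum_(i < N n) f (y n i) * L \1_(seqDU (O n) i).
    move=> pL; rewrite (plf_sum pL _ bi); apply: eq_bigr => i _.
    by rewrite (plfZ pL)//; exact: bm_indic.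
  have gen M : \sum_(i < M) f (y n i) * m k \1_(seqDU (O n) i) @[k --> \oo] -->
      \sum_(i < M) f (y n i) * ell \1_(seqDU (O n) i).
    elim: M => [|M IH].
      rewrite big_ord0 (_ : (fun k => _) = fun=> 0); first exact: cvg_cst.
      by apply/funext => k; rewrite big_ord0.
    rewrite big_ord_recr/= (_ : (fun k => _) = fun k =>
      \sum_(i < M) f (y n i) * m k \1_(seqDU (O n) i) +
      f (y n M) * m k \1_(seqDU (O n) M)).
      by apply: cvgD => //; exact: cvgMl_tmp.
    by apply/funext => k; rewrite big_ord_recr.
  rewrite (sE _ pl) (_ : (fun k => m k s) =
    fun k => \sum_(i < N n) f (y n i) * m k \1_(seqDU (O n) i))//.
  by apply/funext => k; exact: sE.
have /cvgrPdist_le/(_ _ e4)[k0 _ hk0] := ms.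
exists k0 => // k /hk0 h.
have h1 : `|m k f - m k s| <= e / 4.
  by have := plf_dist (pm k) bf bs fs; rewrite m1 mulr1.
have h2 : `|ell f - ell s| <= e / 4.
  by have := plf_dist pl bf bs fs; rewrite l1 mulr1.
rewrite (_ : ell f - m k f = (ell f - ell s) + (ell s - m k s) - (m k f - m k s)); last by ring.
rewrite (le_trans (ler_normB _ _))//.
have := ler_normD (ell f - ell s) (ell s - m k s); lra.
Qed.

End partition.

(** * Quasi-stationary distributions as eigenfunctionals of the potential *)

Section qsd_eigenfunctional.
Context d (R : realType) (E : borelMetricType d R).
Hypothesis compactE : compact [set: E].
Variable K : R.-spker E ~> E.
Hypothesis K_gt0 : forall x, (0 < K x setT)%E.
Hypothesis H1 : feller K.
Variables (c q : R).
Hypothesis q01 : 0 <= q < 1.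
Hypothesis K_geo : forall n x, iter n (kapply K) (fun=> 1) x <= c * q ^+ n.

Local Notation Kop := (kapply K).
Local Notation one := (fun=> 1).

Let pK : plop Kop := plop_kapply K.
Let pA : plop (res Kop) := plop_res pK q01 K_geo.
Let bK1 : bm (Kop one) := plop_bm pK (bm_cst 1).

(** The Feller property and compactness make the positivity of [K x setT] uniform, so the
    normalisation in [is_qsd] never degenerates. *)
Lemma survival_gt0 (mu : (E -> R) -> R) : plf mu -> mu one = 1 -> 0 < mu (Kop one).
Proof.
move=> pmu mu1.
have [n hn] : exists n, forall x, n.+1%:R^-1 <= Kop one x.
  apply: (compact_uniform compactE) => [n m x nm|x].
    by apply: le_trans; rewrite lef_pV2 ?posrE// ler_nat ltnS.
  have [e e0 e2] : exists2 e : R, 0 < e & Kop one x = 2 * e.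
    exists (Kop one x / 2); last by field.
    by rewrite divr_gt0// -lte_fin /kapply Rintegral1 ?spker_fin.
  exists (Num.bound e^-1).
  have c1 : continuous (one : E -> R) by move=> y; exact: cvg_cst.
  have cK : continuous (Kop one) by exact: H1.
  have /cvgrPdist_le/(_ _ e0) := cK x.
  apply: filterS => y; rewrite ler_norml => /andP[_ h].
  have {}h : Kop one x - Kop one y <= e := h.
  apply: (@le_trans _ _ e); last by lra.
  rewrite -[leRHS]invrK lef_pV2 ?posrE ?invr_gt0//.
  have hb : e^-1 < (Num.bound e^-1)%:R by rewrite archi_boundP// invr_ge0 ltW.
  by rewrite ltW// (lt_le_trans hb)// ler_nat.
apply: (@lt_le_trans _ _ n.+1%:R^-1); first by rewrite invr_gt0.
have <- : mu (fun=> n.+1%:R^-1) = n.+1%:R^-1 by rewrite (plf_cst pmu) mu1 mulr1.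
by apply: (plf_mono pmu) => //; exact: bm_cst.
Qed.

Lemma kpushE (mu : probability E R) A : measurable A ->
  kpush mu K A = (\int[mu]_x Kop \1_A x)%:E.
Proof.
move=> mA; have muT : (mu setT < +oo)%E by rewrite probability_setT ltry.
rewrite (EFin_Rintegral muT); last exact/(plop_bm pK)/bm_indic.
by apply: eq_integral => x _; rewrite kapply_indic.
Qed.

(** Since [A (g - K g) = g], an eigenvalue [s] of [A] gives [ell g = s * (ell g - ell (K g))]. The
    choice [g = 1] shows [s != 0] and identifies the eigenvalue of [K] as [ell (K 1)]. *)
Lemma eigenf_qsd (ell : (E -> R) -> R) (mu : probability E R) :
  eigenf (res Kop) ell -> (forall f, bm f -> (\int[mu]_x f x)%R = ell f) ->
  is_qsd K mu.
Proof.
move=> [pl l1 [s hs]] muE A mA.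
have key g : bm g -> ell g = s * (ell g - ell (Kop g)).
  move=> bg; have bKg := plop_bm pK bg.
  rewrite -(plfB pl)// -hs; last exact: bmB.
  congr ell; apply/funext => x.
  by rewrite (plfB (pA.2 x))// (res_fix pK q01 K_geo)// addrK.
have bA : bm (\1_A : E -> R) by exact: bm_indic.
have r0 := survival_gt0 pl l1.
have kK : ell (Kop \1_A) = ell (Kop one) * ell \1_A.
  have h1 := key _ (bm_cst 1); have h2 := key _ bA; rewrite l1 in h1.
  have s0 : s != 0 by apply: contra_eq_neq h1 => ->; rewrite mul0r oner_neq0.
  apply: (mulfI s0); rewrite mulrA.
  have -> : s * ell (Kop one) = s - 1 by lra.
  by lra.
have muT : (mu setT < +oo)%E by rewrite probability_setT ltry.
rewrite !kpushE// (_ : \1_setT = one); last by apply/funext => x; rewrite indicT.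
rewrite (muE _ bK1) (muE _ (plop_bm pK bA)).
rewrite kK -EFinM/= mulrAC divff ?gt_eqF// mul1r -muE//.
by rewrite Rintegral_indic.
Qed.

(** Integrating the Poisson equation against [nu], with [nu K = r * nu], gives
    [(1 - r) * nu (A f) = nu f]; the choice [f = 1] excludes [r = 1]. *)
Lemma qsd_eigenf (nu : probability E R) : is_qsd K nu ->
  eigenf (res Kop) (fun f => (\int[nu]_x f x)%R).
Proof.
move=> hnu; have nuT : (nu setT < +oo)%E by rewrite probability_setT ltry.
pose L f := (\int[nu]_x f x)%R.
have pL : plf L := plf_Rintegral nuT.
have L1 : L one = 1.
  by apply: EFin_inj; rewrite /L (Rintegral1 nuT); exact: probability_setT.
have r0 := survival_gt0 pL L1; set r := L (Kop one) in r0.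
have LK f : bm f -> L (Kop f) = r * L f.
  have p2 : plf (fun f => r * L f).
    have := plfDl (ltW r0) (lexx 0) pL pL; congr plf.
    by apply/funext => g; rewrite mul0r addr0.
  apply: (plf_eq (plf_comp pK pL) p2) => A mA.
  have := hnu A mA; rewrite !kpushE// (_ : \1_setT = one); last first.
    by apply/funext => x; rewrite indicT.
  rewrite -(Rintegral_indic nuT mA) -EFinM/= => h.
  have {}h : L \1_A = L (Kop \1_A) / r by exact: EFin_inj h.
  by rewrite h mulrCA divff ?gt_eqF// mulr1.
split=> //; have key f : bm f -> (1 - r) * L (res Kop f) = L f.
  move=> bf; have bA := plop_bm pA bf.
  rewrite mulrBl mul1r -LK// -(plfB pL)//; last exact: plop_bm.
  congr L; apply/funext => x.
  by rewrite {1}(res_fixK pK (kapply1_le K) q01 K_geo)// addrK.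
exists (1 - r)^-1 => f bf; rewrite -/(L _) -/(L f) -(key f bf) mulKf//.
apply: contra_eq_neq (key _ (bm_cst 1)) => ->.
by rewrite mul0r -/(L _) L1 eq_sym oner_neq0.
Qed.

End qsd_eigenfunctional.

Local Open Scope ereal_scope.

Theorem theorem2p5
  (R : realType) (d : measure_display) (E : borelMetricType d R)
  (compactE : compact [set: E])
  (K : R.-spker E ~> E) (K_gt0 : forall x, 0 < K x setT)
  (eta : nat -> {posnum R})
  (d' : measure_display) (Omega : measurableType d') (P : probability Omega R)
  (F : nat -> set (set Omega)) (filtrationF : filtration F)
  (X : nat -> Omega -> E) (adaptedX : adapted F X)
  (x0 : E) (X0 : forall w, X 0%N w = x0)
  (transitionX : forall n A, measurable A ->
     is_cond_prob P (F n) (X n.+1 @^-1` A)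
       (fun w => restart K (weighted_occupation eta (X ^~ w) n) (X n w) A))
  (step_noninc : nonincreasing_seq (step_size eta))
  (step_sum : \sum_(0 <= n <oo) (step_size eta n)%:E = +oo)
  (step_ln : (step_size eta n * ln n%:R)%R @[n --> \oo] --> (0%R : R))
  (H1 : feller K)
  (H2 : forall x : E,
     0 < \sum_(1 <= n <oo) kiter (cemetery_ker K) n (Some x) [set None])
  (U : set E) (Psi : probability E R)
  (H3_open : open U) (H3_nonempty : U !=set0)
  (H3_accessible : accessible K U) (H3_small : weak_small_set K U Psi)
  (C : R -> R)
  (C_ge0 : {in `[0%R, +oo[, forall s, (0 <= C s)%R})
  (C_noninc : {in `[0%R, +oo[ &, nonincreasing_fun C})
  (C_convex : convex_function (`[0%R, +oo[%classic : set R^o) C)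
  (C_int : \int[lebesgue_measure]_(s in `[0%R, +oo[) (C s)%:E = +oo)
  (H4 : forall n : nat,
     (C n%:R <= (\int[Psi]_x kapply (kiter K n) (cst 1) x)
                / sup (range (kapply (kiter K n) (cst 1))))%R) :
  exists mu_star : probability E R,
    [/\ is_qsd K mu_star,
        forall nu : probability E R, is_qsd K nu -> eq_prob nu mu_star
      & {ae P, forall w,
          (weighted_occupation eta (X ^~ w) n : weak_probability E)
            @[n --> \oo] --> (mu_star : weak_probability E)}].
Proof.
have [cc [q [q01 K_geo contract]]] :=
  kernel_contract compactE H1 H2 H3_open H3_accessible H3_small
    C_ge0 C_noninc C_int H4 x0.
have pK : plop (kapply K) := plop_kapply K.
have pA : plop (res (kapply K)) := plop_res pK q01 K_geo.
have PsiT : Psi setT < +oo by rewrite probability_setT ltry.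
pose PsiL (f : E -> R) := (\int[Psi]_x f x)%R.
have pPsi : plf PsiL := plf_Rintegral PsiT.
have Psi1 : PsiL (fun=> 1%R) = 1%R.
  by apply: EFin_inj; rewrite /PsiL (Rintegral1 PsiT); exact: probability_setT.
pose ell := limQ (res (kapply K)) PsiL.
have eell : eigenf (res (kapply K)) ell := eigenf_limQ pA contract pPsi Psi1.
have [pell ell1 _] := eell.
have ell0 (f : nat -> E -> R) B : (forall n, bm (f n)) ->
    (forall n x, (`|f n x| <= B)%R) ->
    (forall x, f n x @[n --> \oo] --> (0%R : R)) ->
    ell (f n) @[n --> \oo] --> (0%R : R).
  apply: (limQ_cvg0 pA contract pPsi Psi1); first exact: res_cvg0 q01 K_geo.
  move=> {}f {}B bf fB f0.
  have := bounded_cvg_Rintegral PsiT bf (bm_cst 0%R) fB f0.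
  suff -> : (\int[Psi]_x (fun=> 0) x)%R = 0%R :> R by [].
  by have := plf_cst pPsi 0%R; rewrite mul0r.
have [mu muE] := probability_of_functional pell ell1 ell0.
exists mu; split.
- exact: (eigenf_qsd compactE K_gt0 H1 q01 K_geo eell muE).
- move=> nu hnu A mA; have nuT : nu setT < +oo by rewrite probability_setT ltry.
  have muT : mu setT < +oo by rewrite probability_setT ltry.
  have enu := qsd_eigenf compactE K_gt0 H1 q01 K_geo hnu.
  have bA : bm (\1_A : E -> R) by exact: bm_indic.
  have := eigenf_unique pA contract enu eell bA.
  by rewrite -muE// => h; rewrite -(Rintegral_indic nuT mA) -(Rintegral_indic muT mA) h.
(* From index 2 on, [ln n] is at least [ln 2 > 0]. *)
have gamma_cvg : step_size eta n @[n --> \oo] --> (0%R : R).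
  apply/cvgrPdist_le => e e0.
  have l2 : (0 < ln 2 :> R)%R by rewrite ln_gt0// ltr1n.
  have /cvgrPdist_le/(_ _ (mulr_gt0 e0 l2))[n0 _ hn0] := step_ln.
  exists (maxn n0 2) => // n /=; rewrite geq_max => /andP[/hn0 h n2].
  have g0 := step_size_gt0 eta n.
  rewrite sub0r normrN gtr0_norm//; rewrite sub0r normrN in h.
  have lnn : (ln 2 <= ln n%:R :> R)%R.
    by rewrite ler_ln ?posrE ?ltr0n ?ler_nat// (leq_trans _ n2).
  rewrite -(ler_pM2r l2) (le_trans _ h)// ger0_norm; first by rewrite ler_wpM2l// ltW.
  by rewrite mulr_ge0 ?(ltW g0)// (le_trans (ltW l2)).
have /choice[nb hnb] : forall j, exists nb : nat -> nat,
    [/\ forall k, (k <= nb k)%N, forall k, (nb k < nb k.+1)%N &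
     forall k, (j.+1%:R^-1 <= \sum_((nb k).+1 <= i < (nb k.+1).+1) step_size eta i
       <= 2 * j.+1%:R^-1)%R].
  by move=> j; apply: (blocks_ex (step_size_gt0 eta) step_sum gamma_cvg); rewrite invr_gt0.
have noise0 j (g : E -> R) : bm g -> {ae P, forall w,
    noise K eta X (nb j k).+1 (nb j k.+1).+1 g w @[k --> \oo] --> (0%R : R)}.
  move=> bg; have [h1 h2 h3] := hnb j.
  apply: (noise_block_ae filtrationF adaptedX transitionX step_noninc step_ln
    (pb := fun k => (nb j k).+1) (qb := fun k => (nb j k.+1).+1)
    (Dl := (2 * j.+1%:R^-1)%R) bg).
  - by move=> k; exact: leqW.
  - by move=> k; rewrite ltnS ltnW.
  - by move=> k; case/andP: (h3 k).
have [B [mB hB]] := convergence_determining compactE x0.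
have bB n i : bm (\1_(B n i) : E -> R) by exact: bm_indic.
have bI i (f : E -> R) : bm f -> bm (iter i.+1 (res (kapply K)) f).
  exact: (plop_bm (plop_iter i.+1 pA)).
(* One null set for all cells, block sizes and iterates. It is fixed before the continuous test
   function, as almost sure weak convergence demands. *)
have ae1 : {ae P, forall w, forall n i j p,
    noise K eta X (nb j k).+1 (nb j k.+1).+1
      (iter p.+1 (res (kapply K)) (\1_(B n i))) w @[k --> \oo] --> (0%R : R)}.
  apply/ae_foralln => n; apply/ae_foralln => i; apply/ae_foralln => j.
  by apply/ae_foralln => p; apply: noise0; exact: bI.
have ae2 : {ae P, forall w, forall j p,
    noise K eta X (nb j k).+1 (nb j k.+1).+1
      (iter p.+1 (res (kapply K)) (fun=> 1%R)) w @[k --> \oo] --> (0%R : R)}.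
  apply/ae_foralln => j; apply/ae_foralln => p.
  by apply: noise0; apply: bI; exact: bm_cst.
apply: filterS2 ae1 ae2 => w h1 h2.
apply/cvg_weak_probabilityP => f cf.
have bf := continuous_bm compactE cf.
rewrite muE//.
rewrite (_ : (fun n => _) = fun n => occ eta (X ^~ w) n f); last first.
  by apply/funext => n; exact: weighted_occupationE.
apply: (hB _ ell) => //.
- by move=> k; exact: plf_occ.
- by move=> k; exact: occ1.
move=> n i.
apply: (path_cvg q01 K_geo step_noninc pell ell1 _ gamma_cvg hnb (bB n i)) => //.
exact: (polyop_forget pA contract eell).
Qed.
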